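(* Let $L/K$ be a finite Galois extension of number fields and $\rho:\mathrm{Gal}(L/K)\to\mathrm{GL}(V)$ a finite-dimensional complex representation. Then in $\mathcal{A}_K$ $$\mathcal{L}(\mathfrak{X}_K,\rho;L/K)=\sum_{\lambda^\bullet\in\mathbb{Y}_K}\mathrm{Tr}_{\mathbb{S}_{\lambda^\bullet}(W_\rho)}(\sigma_K)\,s_{\lambda^\bullet}[\mathfrak{X}_K].$$
   Context: Ring: for a number field $K$ with ring of integers $\mathcal{O}_K$, $\mathbb{P}_K$ is the set of (nonzero) prime ideals and $\mathcal{J}_K^+$ the monoid of (nonzero) integral ideals. $\mathbb{Q}^{\mathrm{ab}}\subset\mathbb{C}$ is the maximal abelian extension of $\mathbb{Q}$ and $\Lambda$ the ring of symmetric functions over $\mathbb{Q}^{\mathrm{ab}}$. For each $\mathfrak{q}\in\mathbb{P}_K$, $\mathfrak{X}^{(\mathfrak{q})}=x_1^{(\mathfrak{q})}+x_2^{(\mathfrak{q})}+\cdots$ is a set of commuting free variables, $\mathfrak{X}_K=(\mathfrak{X}^{(\mathfrak{q})})_{\mathfrak{q}}$; $A_K:=\bigotimes_{\mathfrak{q}}\Lambda[\mathfrak{X}^{(\mathfrak{q})}]$ (direct limit over finite subsets of $\mathbb{P}_K$), graded by $\mathcal{J}_K^+$ (multidegree $(d_{\mathfrak{q}})$ corresponds to $\prod\mathfrak{q}^{d_{\mathfrak{q}}}$), and $\mathcal{A}_K$ is its completion (formal sums of one homogeneous element for each $\mathfrak{a}\in\mathcal{J}_K^+$). $\mathbb{Y}_K$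 is the set of tuples $\lambda^\bullet=(\lambda^{(\mathfrak{q})})_{\mathfrak{q}\in\mathbb{P}_K}$ of partitions, almost all empty, and $s_{\lambda^\bullet}[\mathfrak{X}_K]=\prod_{\mathfrak{q}}s_{\lambda^{(\mathfrak{q})}}[\mathfrak{X}^{(\mathfrak{q})}]$ with $s_\lambda$ the Schur functions. Artin symmetric function: for each $\mathfrak{q}\in\mathbb{P}_K$ choose a prime $\mathfrak{p}$ of $L$ over $\mathfrak{q}$; let $I(\mathfrak{q})\subset D(\mathfrak{q})\subset\mathrm{Gal}(L/K)$ be its inertia and decomposition groups and $\sigma_{\mathfrak{q}}\in D(\mathfrak{q})/I(\mathfrak{q})$ the Frobenius element. Then $\mathcal{L}(\mathfrak{X}_K,\rho;L/K):=\prod_{\mathfrak{q}}\prod_{i\ge1}\det\left(\mathrm{Id}_{V^{I(\mathfrak{q})}}-x_i^{(\mathfrak{q})}\rho(\sigma_{\mathfrak{q}})|_{V^{I(\mathfrak{q})}}\right)^{-1}\in\mathcal{A}_K$. Representations: $G_{L/K}:=\prod_{\mathfrak{q}\in\mathbb{P}_K}N_{\mathrm{Gal}(L/K)}(I(\mathfrak{q}))/I(\mathfrak{q})$, where $N_G(H)$ is the normalizer; $\sigma_K:=(\sigma_{\mathfrak{q}})_{\mathfrak{q}}\in G_{L/K}$. $V_{\mathfrak{q}}$ is the space $V^{I(\mathfrak{q})}$ on which $G_{L/K}$ acts through its $\mathfrak{q}$-component. $W_\rho:=\bigotimes_{\mathfrak{q}}V_{\mathfrak{q}}$ (a factored representation).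 For a partition $\lambda$, $\mathbb{S}_\lambda(W):=W^{\otimes|\lambda|}\otimes_{\mathfrak{S}_{|\lambda|}}S^\lambda$ is the Schur functor ($S^\lambda$ the Specht module; $\mathbb{S}_{(m)}=\mathrm{Sym}^m$, and $\mathbb{S}_\emptyset(W)$ is the trivial one-dimensional representation), and $\mathbb{S}_{\lambda^\bullet}(W_\rho):=\bigotimes_{\mathfrak{q}}\mathbb{S}_{\lambda^{(\mathfrak{q})}}(V_{\mathfrak{q}})$, which is a finite-dimensional representation of $G_{L/K}$ because $\lambda^{(\mathfrak{q})}=\emptyset$ for almost all $\mathfrak{q}$. *)

(* Defs.v *)
From HB Require Import structures.
From mathcomp Require Import all_boot all_order all_algebra all_fingroup all_field all_character.
From mathcomp Require Import finmap monalg.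
From mathcomp Require Import boolp classical_sets functions cardinality reals.
From mathcomp Require Import complex mxtens.

(* Conventions.
   - Vectors are row vectors and matrices act on the right, as in
     mxrepresentation.  In 'Gal(E / K) and in 'S_n the product g * h means
     "g, then h", so g |-> (v |-> v *m rho g) is a left action for ordinary
     composition.
   - The variables x_1, x_2, ... of an alphabet are indexed by nat from 0. *)

Set Implicit Arguments.
Unset Strict Implicit.
Unset Printing Implicit Defensive.
Import GRing.Theory.
Local Open Scope fset_scope.
Local Open Scope ring_scope.

Section MDiv.
Variable I : choiceType.
Implicit Types m a b : {cmonom I}.

(* The monomials dividing m, as a finite set. *)
Definition mdivisors m : {fset {cmonom I}} :=
  [fset a in [seq mkcmonom [fsfun i : finsupp m => nat_of_ord (phi i) | 0%N]
               | phi : {ffun finsupp m -> 'I_(mdeg m).+1}]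
   | mulcm a (divcm m a) == m].

Lemma mdivisorsP m a : reflect (mulcm a (divcm m a) = m) (a \in mdivisors m).
Proof.
rewrite !inE /=; apply: (iffP andP) => [[_ /eqP]//|am]; split; last exact/eqP.
have lem i : (a i <= m i)%N by rewrite -am mulcmE leq_addr.
have led i : (a i <= mdeg m)%N.
  rewrite -am mdegM (leq_trans _ (leq_addr _ _)) //.
  case: (mdomP a i) => // /[dup] ia /(big_fsetD1 i) h. 
  by rewrite mdegE h /= leq_addr.

apply/mapP; exists [ffun i : finsupp m => inord (a (val i))]; first exact: mem_enum.
apply/eqP/cmP => i; rewrite cmE /= fsfun_ffun.
case: insubP => [u _ /= <-|]; first by rewrite ffunE inordK // ltnS led.
by rewrite -cmE_eq0 => /eqP mi0; have := lem i; rewrite mi0 leqn0 => /eqP.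
Qed.

Lemma mulcmK a b : divcm (mulcm a b) a = b.
Proof. by apply/eqP/cmP => i; rewrite divcmE mulcmE addKn. Qed.

Lemma mdivisors_mul a b : a \in mdivisors (mulcm a b).
Proof. by apply/mdivisorsP; rewrite mulcmK. Qed.

Lemma mdivisorsE m a : (a \in mdivisors m) -> exists b, m = mulcm a b.
Proof. by move=> /mdivisorsP <-; exists (divcm m a). Qed.

Lemma mdivisors_sub m a : a \in mdivisors m -> mdivisors a `<=` mdivisors m.
Proof.
move=> /mdivisorsE[b ->]; apply/fsubsetP => c /mdivisorsE[d ->].
by rewrite -mulcmA mdivisors_mul.
Qed.
End MDiv.

(* Formal power series over R, of unbounded degree, in arbitrarily many
   commuting variables indexed by I: all functions from monomials to R. *)
Record mseries (R : Type) (I : choiceType) :=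
  MSeries { mscoef :> {cmonom I} -> R }.

HB.instance Definition _ (R : Type) (I : choiceType) :=
  [isNew for @mscoef R I].
HB.instance Definition _ (R : choiceType) (I : choiceType) :=
  [Choice of mseries R I by <:].

Section Series.
Variables (R : comNzRingType) (I : choiceType).
Local Notation S := (mseries R I).
Implicit Types (f g h : S) (m a b : {cmonom I}).

Lemma mseriesP f g : (forall m, f m = g m) -> f = g.
Proof. by case: f g => f [g] /= fg; congr MSeries; apply/funext. Qed.

Definition mszero : S := MSeries (fun=> 0).
Definition msopp f : S := MSeries (fun m => - f m).
Definition msadd f g : S := MSeries (fun m => f m + g m).
Definition msconst (c : R) : S :=
  MSeries (fun m => if m == onecm I then c else 0).
Definition msvar (i : I) : S := MSeries (fun m => (m == ucm i)%:R).
Definition msmul f g : S :=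
  MSeries (fun m => \sum_(a <- mdivisors m) f a * g (divcm m a)).

Fact msaddA : associative msadd.
Proof. by move=> f g h; apply/mseriesP => m /=; rewrite addrA. Qed.
Fact msaddC : commutative msadd.
Proof. by move=> f g; apply/mseriesP => m /=; rewrite addrC. Qed.
Fact msadd0 : left_id mszero msadd.
Proof. by move=> f; apply/mseriesP => m /=; rewrite add0r. Qed.
Fact msaddN : left_inverse mszero msopp msadd.
Proof. by move=> f; apply/mseriesP => m /=; rewrite addNr. Qed.

HB.instance Definition _ :=
  GRing.isZmodule.Build S msaddA msaddC msadd0 msaddN.


Lemma msmulE f g m (D : {fset {cmonom I}}) : (mdivisors m `<=` D)%fset ->
  msmul f g m =
  \sum_(a <- D) \sum_(b <- D) (if mulcm a b == m then f a * g b else 0).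
Proof.
move=> sD; rewrite /=.
have -> : \sum_(a <- mdivisors m) f a * g (divcm m a) =
    \sum_(a <- mdivisors m)
      \sum_(b <- D) (if mulcm a b == m then f a * g b else 0).
  apply: eq_big_seq => a /mdivisorsP am.
  rewrite (big_fsetD1 (divcm m a)) /=; last first.
    apply: (fsubsetP sD); set d := divcm m a in am *.
    by rewrite -am mulcmC mdivisors_mul.
  rewrite am eqxx big1_fset ?addr0 // => b; rewrite !inE => /andP[bN _] _.
  by case: eqP => // abm; case/eqP: bN; rewrite -abm mulcmK.
apply: big_fset_incl => // a aD aN; apply: big1_fset => b _ _.
by case: eqP => // abm; case/negP: aN; rewrite -abm mdivisors_mul.
Qed.

Fact msmulC : commutative msmul.
Proof.
move=> f g; apply/mseriesP => m.
rewrite !(msmulE _ _ (fsubset_refl _)) exchange_big /=.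
by apply: eq_bigr => a _; apply: eq_bigr => b _; rewrite mulcmC mulrC.
Qed.

Lemma msmul3 f g h m :
  msmul (msmul f g) h m =
  \sum_(c <- mdivisors m) \sum_(a <- mdivisors m) \sum_(b <- mdivisors m)
    (if mulcm (mulcm a b) c == m then f a * g b * h c else 0).
Proof.
set D := mdivisors m; rewrite (msmulE _ _ (fsubset_refl _)) -/D.
transitivity (\sum_(x <- D) \sum_(c <- D) \sum_(a <- D) \sum_(b <- D)
   (if (mulcm a b == x) && (mulcm x c == m) then f a * g b * h c else 0)).
  apply: eq_big_seq => x xD; apply: eq_bigr => c _.
  rewrite (msmulE _ _ (mdivisors_sub xD)) -/D.
  case: (mulcm x c =P m) => xc; last first.
    by symmetry; apply: big1 => a _; apply: big1 => b _; rewrite andbF.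
  rewrite mulr_suml; apply: eq_bigr => a _; rewrite mulr_suml.
  by apply: eq_bigr => b _; rewrite andbT; case: eqP => // _; rewrite mul0r.
rewrite exchange_big /=; apply: eq_bigr => c _.
rewrite exchange_big; apply: eq_bigr => a _.
rewrite exchange_big; apply: eq_bigr => b _ /=.
case: (mulcm (mulcm a b) c =P m) => [abc|abcN]; last first.
  by apply: big1 => x _; case: eqP => //= <-; case: eqP.
rewrite (big_fsetD1 (mulcm a b)) /=; last by rewrite /D -abc mdivisors_mul.
rewrite [X in X && _]eqxx [X in _ && X](introT eqP abc) /=.
rewrite [X in _ + X]big1_fset; first by rewrite addr0.
move=> x; rewrite in_fsetD1 => /andP[xN _] _.
by rewrite eq_sym (negbTE xN).
Qed.

Fact msmulA : associative msmul.
Proof.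
move=> f g h; apply/mseriesP => m; rewrite [in LHS]msmulC !msmul3.
rewrite [RHS]exchange_big; apply: eq_bigr => a _ /=.
rewrite [RHS]exchange_big; apply: eq_bigr => b _; apply: eq_bigr => c _ /=.
have -> : mulcm (mulcm b c) a = mulcm (mulcm a b) c by rewrite mulcmC mulcmA.
by case: eqP => // _; rewrite mulrC mulrA.
Qed.

Fact msmul1 : left_id (msconst 1) msmul.
Proof.
move=> f; apply/mseriesP => m /=.
have D1 : onecm I \in mdivisors m by rewrite -[m]mul0cm mdivisors_mul.
rewrite (big_fsetD1 (onecm I)) //= eqxx mul1r big1_fset ?addr0.
  by rewrite -[X in divcm X]mul0cm mulcmK.
by move=> a; rewrite in_fsetD1 => /andP[/negbTE-> _] _; rewrite mul0r.
Qed.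

Fact msmulDl : left_distributive msmul +%R.
Proof.
move=> f g h; apply/mseriesP => m /=; rewrite -big_split /=.
by apply: eq_bigr => a _; rewrite mulrDl.
Qed.

Fact ms1_neq0 : msconst 1 != 0.
Proof.
apply/eqP => /(congr1 (fun f : S => f (onecm I))) /=.
by rewrite eqxx => /eqP; rewrite oner_eq0.
Qed.

HB.instance Definition _ := GRing.Zmodule_isComNzRing.Build S
  msmulA msmulC msmul1 msmulDl ms1_neq0.

(* A series is a unit when it has an inverse; then ^-1 is that inverse. *)
Definition ms_unit : {pred S} := fun f => `[< exists g, g * f = 1 >].
Definition ms_inv f : S :=
  if pselect (exists g, g * f = 1) is left ex then projT1 (cid ex) else f.

Fact ms_mulVx : {in ms_unit, left_inverse 1 ms_inv *%R}.
Proof.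
move=> f /asboolP uf; rewrite /ms_inv; case: pselect => // ex.
by case: (cid ex).
Qed.
Fact ms_unitPl f g : g * f = 1 -> ms_unit f.
Proof. by move=> gf; apply/asboolP; exists g. Qed.
Fact ms_inv_out : {in [predC ms_unit], ms_inv =1 id}.
Proof.
move=> f; rewrite inE /= => /asboolP nuf; rewrite /ms_inv.
by case: pselect.
Qed.

HB.instance Definition _ := GRing.ComNzRing_hasMulInverse.Build S
  ms_mulVx ms_unitPl ms_inv_out.
End Series.

Section Limits.
Variables (R : comNzRingType) (I J : choiceType).
Local Notation S := (mseries R I).

(* Coefficientwise (eventually constant) convergence along the directed set of
   finite subsets of J; the limit is unique. *)
Definition ms_lim (u : {fset J} -> S) (F : S) : Prop :=
  forall m, exists D0 : {fset J},
    forall D : {fset J}, (D0 `<=` D)%fset -> u D m = F m.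

Definition has_sum (f : J -> S) := ms_lim (fun D => \sum_(j <- D) f j).
Definition has_prod (f : J -> S) := ms_lim (fun D => \prod_(j <- D) f j).
(* The value of the infinite product; 0 when it does not converge. *)
Definition infprod (f : J -> S) : S := xget 0 [set F | has_prod f F]%classic.
End Limits.

Definition is_part (s : seq nat) := sorted geq s && (0%N \notin s).
Record intpart := IntPart { part_seq :> seq nat; _ : is_part part_seq }.
HB.instance Definition _ := [isSub for part_seq].
HB.instance Definition _ := [Choice of intpart by <:].

Definition empty_part : intpart := @IntPart [::] isT.

Section Cells.
Variable la : intpart.

(* The boxes of the Young diagram: box (i, j) has i < size la, j < la_i. *)
Definition cell := {i : 'I_(size la) & 'I_(nth 0%N la i)}.
Definition crow (c : cell) : 'I_(size la) := tag c.
Definition ccol (c : cell) : nat := tagged c.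

Definition semistandard (T : cell -> nat) :=
  [forall c, forall c',
    ((crow c == crow c') && (ccol c <= ccol c')%N ==> (T c <= T c')%N) &&
    ((ccol c == ccol c') && (crow c < crow c')%N ==> (T c < T c')%N)].

(* The number of semistandard tableaux T of shape la with x^T = m.  The entries
   of such a T lie in the (finite) support of m. *)
Definition kostka (m : {cmonom nat}) : nat :=
  #|[set T : {ffun cell -> finsupp m} |
      semistandard (fun c => val (T c)) &&
      [forall v : finsupp m, #|[set c | T c == v]| == m (val v)]]|.

Definition schur (R : comNzRingType) : mseries R nat :=
  MSeries (fun m => (kostka m)%:R).
End Cells.

(* f[X^(q)]: the symmetric function f in the variables x^(q)_0, x^(q)_1, ... *)
Definition in_alphabet (R : comNzRingType) (Q : choiceType) (q : Q)
    (f : mseries R nat) : mseries R (Q * nat)%type :=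
  MSeries (fun m =>
    if all (fun v => v.1 == q) (finsupp m)
    then f (mkcmonom [fsfun i in [fset v.2 | v in finsupp m] => m (q, i) | 0%N])
    else 0).

Section TensorPower.
Variables (F : fieldType) (m d : nat).

(* The basis e_(f 0) (x) ... (x) e_(f (m-1)) of the m-th tensor power of F^d,
   indexed by the f : {ffun 'I_m -> 'I_d}. *)
Definition tpow_dim := #|{: {ffun 'I_m -> 'I_d}}|.
Definition tpow_val (a : 'I_tpow_dim) : {ffun 'I_m -> 'I_d} := enum_val a.
Definition tpow_rank (f : {ffun 'I_m -> 'I_d}) : 'I_tpow_dim := enum_rank f.

Lemma tpow_valK : cancel tpow_val tpow_rank.
Proof. exact: enum_valK. Qed.
Lemma tpow_rankK : cancel tpow_rank tpow_val.
Proof. exact: enum_rankK. Qed.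

Definition tpow_mx (A : 'M[F]_d) : 'M[F]_tpow_dim :=
  \matrix_(a, b) \prod_(k < m) A (tpow_val a k) (tpow_val b k).

(* The right action of 'S_m by permutation of the tensor factors:
   e_f . s = e_(f o s^-1). *)
Definition place_mx (s : 'S_m) : 'M[F]_tpow_dim :=
  \matrix_(a, b) (tpow_val b == [ffun k => tpow_val a ((s^-1)%g k)])%:R.

Lemma tpow_mx1 : tpow_mx 1%:M = 1%:M.
Proof.
apply/matrixP => a b; rewrite !mxE.
have [->|ab] := eqVneq a b.
  by rewrite big1 // => k _; rewrite mxE eqxx.
have /existsP[k kab] : [exists k, tpow_val a k != tpow_val b k].
  apply: contraNT ab => /existsPn h; apply/eqP/(can_inj tpow_valK)/ffunP => k.
  by apply/eqP; move: (h k); rewrite negbK.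
by rewrite (bigD1 k) //= mxE (negbTE kab) mul0r.
Qed.

Lemma tpow_mxM A B : tpow_mx (A *m B) = tpow_mx A *m tpow_mx B.
Proof.
apply/matrixP => a b; rewrite !mxE.
under eq_bigr do rewrite mxE.
rewrite bigA_distr_bigA /= (reindex tpow_val) /=; last first.
  by exists tpow_rank => x _; rewrite ?tpow_valK ?tpow_rankK.
by apply: eq_bigr => c _; rewrite !mxE -big_split.
Qed.

Lemma place_mx_repr : mx_repr [set: 'S_m] place_mx.
Proof.
split=> [|s t _ _].
  apply/matrixP => a b; rewrite !mxE invg1; congr (_%:R : F).
  rewrite (_ : [ffun _ => _] = tpow_val a); last first.
    by apply/ffunP => k; rewrite ffunE perm1.
  by rewrite (inj_eq (can_inj tpow_valK)) eq_sym.
apply/matrixP => a b; rewrite !mxE.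
pose c : 'I_tpow_dim := tpow_rank [ffun k => tpow_val a ((s^-1)%g k)].
rewrite (bigD1 c) //= !mxE tpow_rankK eqxx mul1r big1 ?addr0 => [|e ec].
  congr ((_ == _)%:R : F); apply/ffunP => k.
  by rewrite !ffunE invMg permM.
rewrite !mxE; case: eqP => [ec'|]; last by rewrite mul0r.
by case/eqP: ec; rewrite /c -ec' tpow_valK.
Qed.
Canonical place_repr := MxRepresentation place_mx_repr.

Lemma tpow_place A s : tpow_mx A *m place_mx s = place_mx s *m tpow_mx A.
Proof.
apply/matrixP => a b; rewrite !mxE.
pose c : 'I_tpow_dim := tpow_rank [ffun k => tpow_val a ((s^-1)%g k)].
pose e : 'I_tpow_dim := tpow_rank [ffun k => tpow_val b (s k)].
rewrite (bigD1 e) //= big1 => [|x xe]; last first.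
  rewrite !mxE; case: eqP => [xe'|]; last by rewrite mulr0.
  case/eqP: xe; rewrite /e xe' -[LHS]tpow_valK; congr tpow_rank.
  by apply/ffunP => k; rewrite !ffunE permK.
rewrite [RHS](bigD1 c) //= [X in _ = _ + X]big1 => [|x xc]; last first.
  rewrite !mxE; case: eqP => [xc'|]; last by rewrite mul0r.
  by case/eqP: xc; rewrite /c -xc' tpow_valK.
rewrite !addr0 !mxE /c /e !tpow_rankK eqxx mul1r.
rewrite (_ : _ == _); last by apply/eqP/ffunP => k; rewrite !ffunE permKV.
rewrite mulr1 [RHS](reindex_inj (@perm_inj _ s)) /=.
by apply: eq_bigr => k _; rewrite !ffunE permK.
Qed.
End TensorPower.

Section Specht.
Variables (F : fieldType) (la : intpart).
Local Notation m := (sumn la).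
Implicit Types (s u : 'S_m) (t : {ffun 'I_m -> cell la}).

(* A Young tableau is recorded by the box occupied by each number, and its
   tabloid by the row of each number.  The span of the tabloids of shape la
   embeds in the m-th tensor power of F^(size la), compatibly with 'S_m. *)
Definition tableau (t : {ffun 'I_m -> cell la}) := injectiveb t.

Definition tabloid (t : {ffun 'I_m -> cell la}) : {ffun 'I_m -> 'I_(size la)} :=
  [ffun k => crow (t k)].

(* Each entry k of t is replaced by s k. *)
Definition tab_act (s : 'S_m) (t : {ffun 'I_m -> cell la}) :
    {ffun 'I_m -> cell la} :=
  [ffun k => t ((s^-1)%g k)].

Definition col_stab (t : {ffun 'I_m -> cell la}) : {set 'S_m} :=
  [set s : 'S_m | [forall k, ccol (t (s k)) == ccol (t k)]].

Definition polytabloid (t : {ffun 'I_m -> cell la}) : 'rV[F]_(tpow_dim m (size la)) :=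
  \sum_(s in col_stab t)
    (-1) ^+ odd_perm s *: delta_mx 0 (tpow_rank (tabloid (tab_act s t))).

(* The Specht module is the span of the polytabloids. *)
Definition specht_mx := (\sum_(t | tableau t) <<polytabloid t>>)%MS.

Lemma tab_actM s u t : tab_act (s * u)%g t = tab_act u (tab_act s t).
Proof. by apply/ffunP => k; rewrite !ffunE invMg permM. Qed.

Lemma tableau_act s t : tableau t -> tableau (tab_act s t).
Proof.
move=> /injectiveP ti; apply/injectiveP => i j; rewrite !ffunE => /ti.
exact: perm_inj.
Qed.

Lemma col_stab_act s t : col_stab (tab_act s t) = (col_stab t :^ s)%g.
Proof.
apply/setP => u; rewrite mem_conjg !inE.
apply/forallP/forallP => h k.
  by have := h (s k); rewrite !ffunE permK /conjg invgK !permM.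
by have := h ((s^-1)%g k); rewrite !ffunE /conjg invgK !permM permKV.
Qed.

Lemma delta_place d (s : 'S_m) (f : {ffun 'I_m -> 'I_d}) :
  delta_mx 0 (tpow_rank f) *m place_mx F _ s =
  delta_mx 0 (tpow_rank [ffun k => f ((s^-1)%g k)]) :> 'rV[F]_(tpow_dim m d).
Proof.
rewrite -rowE; apply/rowP => b; rewrite !mxE tpow_rankK eqxx /=.
by rewrite (can2_eq (@tpow_valK m d) (@tpow_rankK m d)).
Qed.

Lemma polytabloidJ s t :
  polytabloid t *m place_mx F _ s = polytabloid (tab_act s t).
Proof.
rewrite /polytabloid mulmx_suml [RHS](reindex_inj (conjg_inj s)) /=.
apply: eq_big => u; first by rewrite col_stab_act memJ_conjg.
move=> _; rewrite odd_permJ -scalemxAl delta_place; congr (_ *: delta_mx 0 _).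
congr tpow_rank; apply/ffunP => k; rewrite !ffunE; congr (crow (t _)).
by rewrite -conjVg /conjg !permM permK.
Qed.

Lemma specht_module : mxmodule (place_repr F m (size la)) specht_mx.
Proof.
apply/mxmoduleP => s _; rewrite sumsmxMr_gen; apply/sumsmx_subP => t tt.
rewrite genmxE (eqmxMr _ (genmxE _)) polytabloidJ.
by rewrite (sumsmx_sup (tab_act s t)) ?tableau_act // genmxE.
Qed.

Definition specht_repr := submod_repr specht_module.
End Specht.

Lemma tensmx11 (F : fieldType) m n :
  (1%:M : 'M[F]_m) *t (1%:M : 'M[F]_n) = 1%:M.
Proof.
apply/matrixP => i j.
case: (mxtens_indexP i) => a b {i}; case: (mxtens_indexP j) => c e {j}.
rewrite tensmxE !mxE (inj_eq (can_inj (@mxtens_indexK _ _))) xpair_eqE.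
by rewrite -natrM mulnb.
Qed.

Section SchurFunctor.
Variables (F : fieldType) (la : intpart).
Variables (gT : finGroupType) (G : {group gT}) (d : nat).
Variable rW : mx_representation F G d.
Local Notation m := (sumn la).
Local Notation k := (\rank (specht_mx F la)).

Definition tens_specht_mx (g : gT) : 'M[F]_(tpow_dim m d * k) :=
  tpow_mx m (rW g) *t 1%:M.

Lemma tens_specht_mx_repr : mx_repr G tens_specht_mx.
Proof.
split=> [|g h Gg Gh]; rewrite /tens_specht_mx.
  by rewrite repr_mx1 tpow_mx1 tensmx11.
by rewrite repr_mxM // tpow_mxM tensmx_mul mulmx1.
Qed.
Canonical tens_specht_repr := MxRepresentation tens_specht_mx_repr.

(* W^(x)m is a right 'S_m-module, and the Specht module a left one through
   s . v = v *m specht_repr s^-1.  The tensor product over the group algebra of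
   'S_m is the quotient by the span of all (w . s) (x) v - w (x) (s . v). *)
Definition balanced_mx : 'M[F]_(tpow_dim m d * k) :=
  (\sum_(s : 'S_m)
     <<place_mx F d s *t 1%:M - 1%:M *t specht_repr F la (s^-1)%g>>)%MS.

Lemma balanced_module : mxmodule tens_specht_repr balanced_mx.
Proof.
apply/mxmoduleP => g Gg; rewrite sumsmxMr_gen; apply/sumsmx_subP => s _.
rewrite genmxE (eqmxMr _ (genmxE _)) (sumsmx_sup s) //= genmxE.
rewrite /tens_specht_mx mulmxBl !tensmx_mul !mulmx1 !mul1mx -tpow_place.
apply/submxP; exists (tpow_mx m (rW g) *t 1%:M).
by rewrite mulmxBr !tensmx_mul !mulmx1 !mul1mx.
Qed.

(* The Schur functor of la applied to rW. *)
Definition schur_repr := factmod_repr balanced_module.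
End SchurFunctor.

(* Finite-dimensional matrix representations of a possibly infinite group. *)
Record group_repr (F : fieldType) (G : groupType) (n : nat) := GroupRepr {
  group_repr_mx :> G -> 'M[F]_n;
  _ : group_repr_mx 1%g = 1%:M;
  _ : {morph group_repr_mx : x y / (x * y)%g >-> x *m y}
}.

Section ProductGroup.
Variables (Q : choiceType) (gT : Q -> finGroupType) (G : forall q, {group gT q}).

Definition prod_group := forall q, subg_of (G q).
HB.instance Definition _ := Choice.on prod_group.
Implicit Types x y z : prod_group.

Definition prod_one : prod_group := fun q => 1%g.
Definition prod_mul x y : prod_group := fun q => (x q * y q)%g.
Definition prod_inv x : prod_group := fun q => (x q)^-1%g.

Fact prod_mulA : associative prod_mul.
Proof. by move=> x y z; apply: functional_extensionality_dep => q; apply: mulgA. Qed.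
Fact prod_mul1 : left_id prod_one prod_mul.
Proof. by move=> x; apply: functional_extensionality_dep => q; apply: mul1g. Qed.
Fact prod_mulr1 : right_id prod_one prod_mul.
Proof. by move=> x; apply: functional_extensionality_dep => q; apply: mulg1. Qed.
Fact prod_mulV : left_inverse prod_one prod_inv prod_mul.
Proof. by move=> x; apply: functional_extensionality_dep => q; apply: mulVg. Qed.
Fact prod_mulrV : right_inverse prod_one prod_inv prod_mul.
Proof. by move=> x; apply: functional_extensionality_dep => q; apply: mulgV. Qed.

HB.instance Definition _ := isGroup.Build prod_group
  prod_mulA prod_mul1 prod_mulr1 prod_mulV prod_mulrV.

Variables (F : fieldType) (d : Q -> nat).
Variable V : forall q, mx_representation F (G q) (d q).

Fixpoint tens_dim (s : seq Q) : nat :=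
  if s is q :: s' then (d q * tens_dim s')%N else 1%N.

Fixpoint tens_mx (x : prod_group) (s : seq Q) : 'M[F]_(tens_dim s) :=
  if s is q :: s' then V q (sgval (x q)) *t tens_mx x s' else 1%:M.

Lemma tens_mx1 s : tens_mx 1%g s = 1%:M.
Proof. by elim: s => //= q s ->; rewrite repr_mx1 tensmx11. Qed.

Lemma tens_mxM s : {morph tens_mx^~ s : x y / (x * y)%g >-> x *m y}.
Proof.
move=> x y; elim: s => /= [|q s ->]; first by rewrite mulmx1.
by rewrite tensmx_mul repr_mxM ?subgP.
Qed.

(* The tensor product, over the q in s, of the representations V q of prod_group,
   which acts on V q through its q-component. *)
Definition tens_repr (s : seq Q) : group_repr F prod_group (tens_dim s) :=
  GroupRepr (tens_mx1 s) (tens_mxM s).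
End ProductGroup.

Section FixedRepr.
Variables (F : fieldType) (gT : finGroupType) (G H : {group gT}) (n : nat).
Hypothesis sHG : H \subset G.
Variable rG : mx_representation F G n.

Definition normalizer_repr : mx_representation F 'N_G(H)%g n :=
  subg_repr rG (subsetIl G 'N(H)%g).

Lemma fixed_module : mxmodule normalizer_repr (rfix_mx rG H).
Proof.
apply/mxmoduleP => x NGx.
by have := fintype.subsetP (norm_sub_rstabs_rfix_mx rG sHG) x NGx; rewrite inE => /andP[].
Qed.

Lemma fixed_rker : H \subset rker (submod_repr fixed_module).
Proof.
rewrite rker_submod; apply/fintype.subsetP => x Hx.
have NGx : x \in 'N_G(H)%g by rewrite inE (fintype.subsetP sHG) // (fintype.subsetP (normG H)).
by rewrite inE NGx /=; apply/eqP; apply: rfix_mx_id.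
Qed.

(* The space of H-fixed vectors, as a representation of N_G(H) / H. *)
Definition fixed_repr :
    mx_representation F ('N_G(H) / H)%g (\rank (rfix_mx rG H)) :=
  quo_repr fixed_rker (subsetIr G 'N(H)%g).
End FixedRepr.

Definition integral_pred (F : fieldType) : {pred F} :=
  fun x => `[< integralOver (intr : int -> F) x >].
Arguments integral_pred F : clear implicits.

Section Integers.
Variable F : fieldType.

Fact integral_pred_subring : subring_closed (integral_pred F).
Proof.
split=> [|x y /asboolP ix /asboolP iy|x y /asboolP ix /asboolP iy]; apply/asboolP.
- exact: integral1.
- exact: integral_sub.
- exact: integral_mul.
Qed.
HB.instance Definition _ :=
  GRing.isSubringClosed.Build F (integral_pred F) integral_pred_subring.

Record ringInt := RingInt { intval :> F; _ : intval \in integral_pred F }.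
HB.instance Definition _ := [isSub for intval].
HB.instance Definition _ := [Choice of ringInt by <:].
HB.instance Definition _ := [SubChoice_isSubComNzRing of ringInt by <:].

(* idealr_closed includes 1 \notin pi_mem. *)
Record primeIdeal := PrimeIdeal {
  pi_mem :> ringInt -> bool;
  pi_ideal : idealr_closed pi_mem;
  pi_prime : prime_idealr_closed pi_mem;
  pi_neq0 : exists2 x, pi_mem x & x != 0
}.
HB.instance Definition _ := gen_eqMixin primeIdeal.
HB.instance Definition _ := gen_choiceMixin primeIdeal.

HB.instance Definition _ (q : primeIdeal) :=
  isIdealr.Build ringInt (pi_mem q) (pi_ideal q).
HB.instance Definition _ (q : primeIdeal) :=
  isPrimeIdealrClosed.Build ringInt (pi_mem q) (@pi_prime q).

Definition residue_ring (q : primeIdeal) := {ideal_quot (pi_mem q : {pred ringInt})}.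
End Integers.

Section Extension.
Variables (K : fieldExtType rat) (L : splittingFieldType K).
Local Notation O := ringInt.
Local Notation Gal := 'Gal({:L} / 1%AS)%g.

Fact int_incl_subproof (x : O K) : (intval x)%:A \in integral_pred L.
Proof.
have /asboolP ix : intval x \in integral_pred K by case: x.
apply/asboolP; have [p mp px] := integral_rmorph (in_alg L) ix.
by exists p; rewrite // -(eq_map_poly (fun z => rmorph_int (in_alg L) z)).
Qed.
Definition int_incl (x : O K) : O L := RingInt (int_incl_subproof x).

Fact int_gal_subproof (g : gal_of {:L}) (x : O L) : g (intval x) \in integral_pred L.
Proof.
have /asboolP ix : intval x \in integral_pred L by case: x.
apply/asboolP; have [p mp px] := integral_rmorph (gal_repr g) ix.
by exists p; rewrite // -(eq_map_poly (fun z => rmorph_int g z)).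
Qed.
Definition int_gal (g : gal_of {:L}) (x : O L) : O L :=
  RingInt (int_gal_subproof g x).

Definition lies_over (p : primeIdeal L) (q : primeIdeal K) : Prop :=
  forall x : O K, p (int_incl x) = q x.

Implicit Types (p : primeIdeal L) (q : primeIdeal K).

Definition decomposition p : {set gal_of {:L}} :=
  [set g in Gal | `[< forall x, p (int_gal g x) = p x >]].

Definition inertia p : {set gal_of {:L}} :=
  [set g in Gal | `[< forall x, p (int_gal g x - x) >]].

Fact inertia_group_set p : group_set (inertia p).
Proof.
apply/group_setP; split=> [|g h].
  rewrite inE group1; apply/asboolP => x.
  rewrite (_ : int_gal 1%g x = x) ?subrr; last by apply/val_inj/gal_id.
  by case: (pi_ideal p).
rewrite !inE => /andP[Gg /asboolP Ig] /andP[Gh /asboolP Ih].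
rewrite groupM //; apply/asboolP => x.
rewrite (_ : int_gal (g * h)%g x = int_gal h (int_gal g x)); last first.
  by apply/val_inj/galM/memvf.
have [_ _ Ip] := pi_ideal p.
have := Ip 1 _ _ (Ih (int_gal g x)) (Ig x).
by rewrite mul1r addrA subrK.
Qed.
Canonical inertia_group p := Group (inertia_group_set p).

(* s is the class in D / I of the g with g x = x ^ N modulo p, where N is the
   cardinality of the residue ring of q. *)
Definition frobenius q p (s : coset_of (inertia p)) : Prop :=
  s \in (decomposition p / inertia p)%g /\
  exists2 N : nat, ([set: residue_ring q] #= `I_N)%card &
    forall g, g \in decomposition p -> coset (inertia p) g = s ->
      forall x : O L, p (int_gal g x - x ^+ N).
End Extension.
Arguments frobenius {K L} q p s.

(* The variables x^(q)_i. *)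
Notation pvar K := (primeIdeal K * nat)%type.

(* The union of the finite abelian extensions of the rationals inside C. *)
Definition Qab (R : realType) : set (complex R) :=
  [set z | exists (E : splittingFieldType rat) (iota : {rmorphism E -> complex R}),
     [/\ galois 1%AS {:E}, abelian 'Gal({:E} / 1%AS)%g &
         exists x, iota x = z] ]%classic.

(* A product of one homogeneous symmetric function of degree d_q in each alphabet
   X^(q) is a series in the x^(q)_i that is multihomogeneous of degree (d_q) and
   symmetric in each alphabet separately; the finite sums of such products give
   all the series with these two properties.  An element of the completion has
   one component in each multidegree, so the completion consists of all the
   series with coefficients in Qab that are symmetric in each alphabet
   separately.  Since a monomial has finite support, bijections of nat may
   replace finitary permutations. *)
Definition AK (R : realType) (K : fieldExtType rat) :
    set (mseries (complex R) (pvar K)) :=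
  [set F : mseries (complex R) (pvar K) |
     (forall m, Qab (F m)) /\
     (forall m1 m2 : {cmonom (pvar K)},
        (forall q, exists2 p : nat -> nat, bijective p &
           forall i, m1 (q, i) = m2 (q, p i)) ->
        F m1 = F m2)]%classic.

(* The almost everywhere empty families of partitions. *)
Definition multipart (K : fieldExtType rat) :=
  {fsfun primeIdeal K -> intpart with empty_part}.

Definition schur_multi (R : comNzRingType) (K : fieldExtType rat)
    (la : multipart K) : mseries R (pvar K) :=
  \prod_(q <- finsupp la) in_alphabet q (schur (la q) R).

Section Artin.
Variables (R : realType) (K : fieldExtType rat) (L : splittingFieldType K).
Local Notation Gal := 'Gal({:L} / 1%AS)%g.
Local Notation C := (complex R).
Variables (P : primeIdeal K -> primeIdeal L).
Variables (n : nat) (rho : mx_representation C Gal n).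
Local Notation I q := (inertia_group (P q)).

Lemma inertia_sub (p : primeIdeal L) : inertia_group p \subset Gal.
Proof. by apply/fintype.subsetP => g; rewrite inE => /andP[]. Qed.

Definition GLK := prod_group (fun q => ('N_Gal(I q) / I q)%G).

Definition Vrepr (q : primeIdeal K) := fixed_repr (inertia_sub (P q)) rho.

(* The factors outside finsupp la are trivial and one-dimensional. *)
Definition schurW (la : multipart K) :=
  tens_repr (fun q => schur_repr (la q) (Vrepr q)) (finsupp la).

Definition artin_factor (sigma : GLK) (v : pvar K) :
    mseries C (pvar K) :=
  (\det (1%:M - msvar C v *:
           map_mx (msconst _) (Vrepr v.1 (sgval (sigma v.1)))))^-1.

Definition artin_series (sigma : GLK) := infprod (artin_factor sigma).

Definition schur_term (sigma : GLK) (la : multipart K) :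
    mseries C (pvar K) :=
  msconst _ (\tr (schurW la sigma)) * schur_multi C la.
End Artin.

(* Main.v *)
(* At each prime the claim is sum_la Tr_{S_la(V)}(A) s_la = prod_i det(1 - x_i A)^-1.
   Averaging over S_m gives Tr_{S_la(V)}(A) = 1/m! sum_s Tr(A^{(x)m} s) chi_la(s), so
   the coefficient of x^mu on the left is an average of Tr(A^{(x)m} s) against
   sum_la K_{la,mu} chi_la(s).  By Young's rule the latter is the permutation character
   h_mu of the action of S_m on words of content mu, and counting orbits (Burnside) turns
   the average into prod_i h_{mu_i}(eigenvalues of A), the coefficient on the right.
   For Young's rule, the chi_la are orthonormal, and <chi_la, h_la> = 1 because the
   generating polytabloid is antisymmetric under column permutations.  The product
   <h_mu, h_nu> counts matrices with margins mu and nu, hence equals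
   sum_la K_{la,mu} K_{la,nu} by Cauchy's identity, an iterated Pieri rule.  As K is
   unitriangular for the statistic sum_i i la_i, it follows by induction that
   h_mu - sum_la K_{la,mu} chi_la has norm zero.  All coefficients lie in Q(zeta_N) with
   N = |Gal(L/K)|, and s_la is symmetric because K_{la,mu} = <chi_la, h_mu>. *)
Require Import Defs.
From HB Require Import structures.
From mathcomp Require Import all_boot all_order all_algebra all_fingroup all_field all_character.
From mathcomp Require Import finmap monalg.
From mathcomp Require Import boolp classical_sets functions cardinality reals.
From mathcomp Require Import complex mxtens.
From mathcomp Require Import all_solvable zify ring.

Set Implicit Arguments.
Unset Strict Implicit.
Unset Printing Implicit Defensive.
Import GRing.Theory Num.Theory.
Local Open Scope fset_scope.
Local Open Scope ring_scope.

(** * Horizontal strips *)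

(** Partitions are first handled inside the finite type [shape N], so that sums over them can be
    exchanged freely; hypotheses such as [sz ka + j <= N] guarantee that no shape leaves this box.
    Schur polynomials are introduced by the branching rule, one variable at a time, which reduces
    Pieri's rule to counting the shapes around two given ones. No decomposition into irreducibles is
    used for S_m. An inner product of characters is the trace of an averaging projector on matrices,
    and only the values 0 and 1 are computed in this way, when the space of intertwiners is zero or
    a line. This is decided by evaluating intertwiners at a single generator of the Specht module.
    The statistic sum_i i la_i takes the place of the dominance order twice: strict columns of
    tableaux bound it for Kostka numbers, antisymmetry along columns bounds it for intertwiners. A
    class function of norm zero vanishes because phi(s^-1) is the conjugate of phi(s), which rests
    on diagonalising matrices of finite order. The same diagonalisation supplies the eigenvalues at
    each prime and shows that they are roots of unity of order dividing the order of the Galois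
    group. *)

Section HorizontalStrips.
Local Open Scope nat_scope.

Lemma card_in_cancel (T T' : finType) (A : {pred T}) (B : {pred T'})
    (f : T -> T') (g : T' -> T) :
  {in A, forall x, f x \in B} -> {in B, forall y, g y \in A} ->
  {in A, cancel f g} -> {in B, cancel g f} -> #|A| = #|B|.
Proof.
move=> fA gB fK gK.
rewrite -(fintype.card_in_image (can_in_inj fK)); apply: fintype.eq_card => y.
apply/fintype.imageP/idP => [[x xA ->]|yB]; first exact: fA.
by exists (g y); rewrite ?gK ?gB.
Qed.

Section Shapes.
Variable N : nat.

(** A finite box containing every partition of size at most N. Rows need not decrease; [strip _ p]
    forces this on [p], so chains of strips meet partitions only. *)
Definition shape := {ffun 'I_N.+1 -> 'I_N.+1}.
Implicit Types (p q ka la nu tau : shape).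

Definition prow p (i : nat) : nat :=
  if i <= N then nat_of_ord (p (inord i)) else 0.

Definition shape_of (f : nat -> nat) : shape := [ffun i : 'I_N.+1 => inord (f i)].

Definition sz p := \sum_(i < N.+1) prow p i.

Definition shape0 : shape := [ffun => ord0].

Lemma prowE p (i : 'I_N.+1) : prow p i = p i.
Proof. by rewrite /prow -ltnS ltn_ord inord_val. Qed.

Lemma prow_out p i : N < i -> prow p i = 0.
Proof. by rewrite /prow ltnNge => /negbTE->. Qed.

Lemma prowP p q : (forall i, prow p i = prow q i) -> p = q.
Proof. by move=> h; apply/ffunP => i; apply/val_inj; have := h i; rewrite !prowE. Qed.

Lemma prow_shape_of f i : (forall j, f j <= N) -> (N < i -> f i = 0) ->
  prow (shape_of f) i = f i.
Proof.
move=> fN f0; rewrite /prow; case: leqP => iN; last by rewrite f0.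
by rewrite ffunE inordK ?ltnS // inordK // ltnS.
Qed.

Lemma prow0 i : prow shape0 i = 0.
Proof. by rewrite /prow; case: ifP => // _; rewrite ffunE. Qed.

Lemma prow_le_sz p i : prow p i <= sz p.
Proof.
have [iN|/prow_out-> //] := leqP i N.
rewrite -(inordK (n' := N) (m := i)) ?ltnS // /sz (bigD1 (inord i)) //=; exact: leq_addr.
Qed.

Lemma sz0 : sz shape0 = 0.
Proof. by rewrite /sz big1 // => i _; rewrite prow0. Qed.

Lemma sz_eq0 p : (sz p == 0) = (p == shape0).
Proof.
apply/eqP/eqP => [p0|->]; last exact: sz0.
by apply: prowP => i; rewrite prow0; have := prow_le_sz p i; lia.
Qed.

(** Interlacing form of a horizontal strip: [la] contains [ka], and no column of the difference has
    two boxes. *)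
Definition strip ka la :=
  [forall i : 'I_N.+1, (ka i <= la i) && (prow la i.+1 <= ka i)].

Lemma stripP ka la :
  reflect (forall i, prow ka i <= prow la i /\ prow la i.+1 <= prow ka i)
          (strip ka la).
Proof.
apply: (iffP forallP) => h i; last first.
  by have [] := h i; rewrite !prowE => -> ->.
have [iN|Ni] := leqP i N; last by rewrite !prow_out //; lia.
have /andP[] := h (inord i); rewrite -!prowE inordK ?ltnS //.
Qed.

Lemma strip_sz ka la : strip ka la -> sz ka <= sz la.
Proof. by move=> /stripP h; apply: leq_sum => i _; case: (h i). Qed.

Lemma strip0 ka : strip ka shape0 = (ka == shape0).
Proof.
apply/idP/eqP => [/strip_sz|->]; first by rewrite sz0 leqn0 sz_eq0 => /eqP.
by apply/stripP => i; rewrite !prow0.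
Qed.

Lemma sum_shift (f : nat -> nat) :
  f N.+1 = 0 -> \sum_(i < N.+1) f i = f 0 + \sum_(i < N.+1) f i.+1.
Proof. by move=> f0; rewrite big_ord_recl big_ord_recr /= f0 addn0. Qed.

(** If the last row were nonempty, all [N.+1] rows would be, giving more than N boxes. The exchange
    below shifts row indices by one and relies on this to lose no row. *)
Lemma decr_top p : (forall i, prow p i.+1 <= prow p i) -> sz p <= N ->
  prow p N = 0.
Proof.
move=> h pN; case E : (prow p N) => [//|r].
have dec i j : i <= j -> prow p j <= prow p i.
  by move=> /subnK <-; elim: (j - i) => // k IH; apply: leq_trans IH; rewrite addSn.
suff: N.+1 <= sz p by lia.
rewrite -[X in X <= _](card_ord N.+1) -sum1_card.
by apply: leq_sum => i _; have := dec i N (ltn_ord i); rewrite E; lia.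
Qed.

Lemma strip_decr ka la : strip ka la -> forall i, prow la i.+1 <= prow la i.
Proof. by move=> /stripP h i; have := h i; lia. Qed.

(* Up to the part added to the first row, reflecting each row length inside the
   interval of its possible values exchanges the common covers of two shapes
   with their common subshapes. *)
Lemma card_strip_exchange tau ka j : sz ka + j <= N ->
  #|[pred la | [&& strip tau la, strip ka la & sz la == sz ka + j]]| =
  #|[pred nu | [&& strip nu tau, strip nu ka & sz tau <= sz nu + j]]|.
Proof.
move=> kjN.
(* Row [i.+1] of a common cover and row [i] of a common subshape range over the same interval, from
   [M i.+1] to [m i]; [dn] and [up] reflect it. Row 0 of a cover is bounded only below, by [M 0],
   and absorbs the remaining boxes, so its size equation turns into an inequality for the
   subshape. *)
pose M i := maxn (prow tau i) (prow ka i).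
pose m i := minn (prow tau i) (prow ka i).
pose dn la i := M i.+1 + m i - prow la i.+1.
pose up nu i := if i is i'.+1 then M i + m i' - prow nu i'
                else M 0 + (sz nu + j - sz tau).
have Mm : \sum_(i < N.+1) M i + \sum_(i < N.+1) m i = sz tau + sz ka.
  by rewrite -!big_split /=; apply: eq_bigr => i _; rewrite /M /m; lia.
have M0 i : N < i -> M i = 0 by move=> Ni; rewrite /M !prow_out.
have m0 i : N < i -> m i = 0 by move=> Ni; rewrite /m !prow_out.
have dnE la : strip tau la -> strip ka la -> forall i,
    prow (shape_of (dn la)) i = dn la i.
  move=> /stripP h1 /stripP h2 i; apply: prow_shape_of => [{}i|Ni]; last first.
    by rewrite /dn M0 ?m0 //; lia.
  have := h1 i.+1; have := h2 i.+1; have := h1 i; have := h2 i.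
  rewrite /dn /M /m.
  have: prow tau i <= N by rewrite /prow; case: ifP => // _; rewrite -ltnS.
  lia.
have dnsz la : strip tau la -> strip ka la ->
    sz (shape_of (dn la)) + sz la + M 0 = sz tau + sz ka + prow la 0.
  move=> h1 h2; rewrite /sz (eq_bigr _ (fun (i : 'I__) _ => dnE _ h1 h2 i)).
  rewrite -/(sz _) -/(sz _) -Mm (sum_shift (M0 N.+1 _)) //.
  rewrite [X in _ + X + _ = _](sum_shift (prow_out _ _)) //.
  have ac a b c d e f : a + b = c + d -> a + (f + b) + e = e + c + d + f by lia.
  apply: ac.
  rewrite -!big_split /=; apply: eq_bigr => i _.
  move/stripP: h1 => h1; move/stripP: h2 => h2.
  have := h1 i.+1; have := h2 i.+1; have := h1 i; have := h2 i.
  rewrite /dn /M /m; lia.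
have upE0 nu i : strip nu tau -> strip nu ka -> N < i -> up nu i = 0.
  move=> h1 h2; case: i => // i Ni /=; rewrite M0 // /m.
  have := stripP _ _ h1 i; have := stripP _ _ h2 i.
  have := @prow_out ka i; have [<-|] := eqVneq N i; last by lia.
  by rewrite (decr_top (strip_decr h2)); lia.
have upsz nu : strip nu tau -> strip nu ka -> sz tau <= sz nu + j ->
    \sum_(i < N.+1) up nu i = sz ka + j.
  move=> h1 h2 le; rewrite (sum_shift (upE0 _ _ h1 h2 _)) //.
  suff: \sum_(i < N.+1) up nu i.+1 + \sum_(i < N.+1) prow nu i + M 0 =
      \sum_(i < N.+1) M i + \sum_(i < N.+1) m i.
    rewrite -/(sz nu) [up nu 0]/=; lia.
  rewrite [X in _ = X + _](sum_shift (M0 N.+1 _)) //.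
  have ac a b c d e : a + b = c + d -> a + b + e = e + c + d by lia.
  apply: ac; rewrite -!big_split /=.
  apply: eq_bigr => i _; have := stripP _ _ h1 i; have := stripP _ _ h2 i.
  rewrite /M /m; lia.
have uple nu i : strip nu tau -> strip nu ka -> sz tau <= sz nu + j ->
    up nu i <= N.
  move=> h1 h2 le; have [Ni|iN] := ltnP N i; first by rewrite upE0.
  apply: leq_trans kjN; rewrite -(upsz nu) // -(inordK (n' := N) (m := i)) ?ltnS //.
  by rewrite (bigD1 (inord i)) //= leq_addr.
have upE nu : strip nu tau -> strip nu ka -> sz tau <= sz nu + j -> forall i,
    prow (shape_of (up nu)) i = up nu i.
  by move=> h1 h2 le i; apply: prow_shape_of => [k|]; [apply: uple|apply: upE0].
have dnB la : [&& strip tau la, strip ka la & sz la == sz ka + j] ->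
    [&& strip (shape_of (dn la)) tau, strip (shape_of (dn la)) ka
      & sz tau <= sz (shape_of (dn la)) + j].
  move=> /and3P[h1 h2 /eqP sla]; apply/and3P.
  have dE := dnE _ h1 h2; have ds := dnsz _ h1 h2.
  move/stripP: h1 => h1; move/stripP: h2 => h2.
  split; try (apply/stripP => i; rewrite dE; have := h1 i; have := h2 i;
    have := h1 i.+1; have := h2 i.+1; rewrite /dn /M /m; lia).
  by have := h1 0; have := h2 0; rewrite /M in ds; lia.
have upA nu : [&& strip nu tau, strip nu ka & sz tau <= sz nu + j] ->
    [&& strip tau (shape_of (up nu)), strip ka (shape_of (up nu))
      & sz (shape_of (up nu)) == sz ka + j].
  move=> /and3P[h1 h2 le]; apply/and3P.
  have uE := upE _ h1 h2 le; have us := upsz _ h1 h2 le.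
  move/stripP: h1 => h1; move/stripP: h2 => h2.
  split; try (apply/stripP => i; rewrite !uE; case: i => [|i];
    rewrite /up /M /m; try have := h1 i; try have := h2 i;
    have := h1 0; have := h2 0; try have := h1 i.+1; try have := h2 i.+1; lia).
  by rewrite -us /sz; apply/eqP/eq_bigr => i _; rewrite uE.
apply: (card_in_cancel (f := fun la => shape_of (dn la))
          (g := fun nu => shape_of (up nu))).
- by move=> la; rewrite !inE; apply: dnB.
- by move=> nu; rewrite !inE; apply: upA.
- move=> la; rewrite !inE => laA; have /and3P[h1 h2 le] := dnB _ laA.
  have /and3P[g1 g2 /eqP sla] := laA; have ds := dnsz _ g1 g2.
  apply: prowP => i; rewrite upE //; case: i => [|i] /=; rewrite ?dnE //.
    by move/stripP: g1 => g1; move/stripP: g2 => g2;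
       have := g1 0; have := g2 0; rewrite /M in ds *; lia.
  move/stripP: g1 => g1; move/stripP: g2 => g2.
  have := g1 i; have := g2 i; have := g1 i.+1; have := g2 i.+1.
  by rewrite /dn /M /m; lia.
- move=> nu; rewrite !inE => nuB; have /and3P[h1 h2 /eqP sla] := upA _ nuB.
  have /and3P[g1 g2 le] := nuB.
  apply: prowP => i; rewrite dnE // /dn upE //=.
  have := stripP _ _ g1 i; have := stripP _ _ g2 i.
  by rewrite /M /m; lia.
Qed.
End Shapes.

End HorizontalStrips.

(** * Schur polynomials, Pieri's rule and Cauchy's identity *)

Section SchurRec.
Variable N : nat.
Local Notation shape := (shape N).
Implicit Types (p q ka la nu tau : shape).

(* Chains of horizontal strips with [mu 0], ..., [mu d.-1] boxes ending at p: for p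
   the shape of a partition, these are the semistandard tableaux of content mu. *)
Fixpoint strip_chains (d : nat) (mu : nat -> nat) (p : shape) : nat :=
  if d is d'.+1 then
    (\sum_(ka | strip ka p && (sz p == sz ka + mu d')) strip_chains d' mu ka)%N
  else p == shape0 N.

Variable (R : comNzRingType).
Implicit Types (x : nat -> R).

(** Branching rule: the power of the last variable is the size of the outermost strip. For a
    partition this is the Schur polynomial in d variables. *)
Fixpoint schur_poly (d : nat) x (p : shape) : R :=
  if d is d'.+1 then
    \sum_(ka | strip ka p) schur_poly d' x ka * x d' ^+ (sz p - sz ka)
  else (p == shape0 N)%:R.

(** The complete homogeneous symmetric polynomial h_j, split by the power of the last variable. *)
Fixpoint complete_poly (d : nat) x (j : nat) : R :=
  if d is d'.+1 then \sum_(i < j.+1) complete_poly d' x (j - i) * x d' ^+ i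
  else (j == 0%N)%:R.

(** Splitting off the last variable expands both sides in the s_tau of the other variables. The
    power of [x d] is then fixed by the total degree [sz ka + j]. The coefficient on the left counts
    the common subshapes of [tau] and [ka], that on the right their common covers, and
    [card_strip_exchange] equates the two. *)
Lemma pieri d x ka j : (sz ka + j <= N)%N ->
  schur_poly d x ka * complete_poly d x j =
  \sum_(la | strip ka la && (sz la == sz ka + j)%N) schur_poly d x la.
Proof.
elim: d ka j => [|d IH] ka j kjN /=.
  rewrite (bigID (pred1 (shape0 N))) /= [X in _ + X]big1 ?addr0; last first.
    by move=> la /andP[_ /negbTE->].
  have [->|ka0] := eqVneq ka (shape0 N); last first.
    rewrite mul0r big1 // => la; rewrite andbC => /andP[/eqP->].
    by rewrite strip0 (negbTE ka0).
  rewrite mul1r big_mkcond (bigD1 (shape0 N)) //= eqxx !sz0 strip0 eqxx !andbT /=.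
  rewrite add0n eq_sym big1 ?addr0; first by case: ifP.
  by move=> la /negbTE->; rewrite andbF.
transitivity (\sum_tau schur_poly d x tau * x d ^+ (sz ka + j - sz tau) *+
   #|[pred nu | [&& strip nu tau, strip nu ka & (sz tau <= sz nu + j)%N]]|).
  transitivity (\sum_(nu | strip nu ka) \sum_(i < j.+1)
     \sum_(tau | strip nu tau && (sz tau == sz nu + (j - i))%N)
       schur_poly d x tau * x d ^+ (sz ka + j - sz tau)).
    rewrite mulr_suml; apply: eq_bigr => nu nuka; rewrite mulr_sumr.
    apply: eq_bigr => i _; have := strip_sz nuka; have := ltn_ord i.
    move=> ij skn; rewrite mulrACA IH; last by lia.
    rewrite mulr_suml; apply: eq_bigr => tau /andP[_ /eqP->].
    by rewrite -exprD; congr (_ * _ ^+ _); lia.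
  transitivity (\sum_(nu | strip nu ka)
     \sum_(tau | strip nu tau && (sz tau <= sz nu + j)%N)
       schur_poly d x tau * x d ^+ (sz ka + j - sz tau)).
    apply: eq_bigr => nu nuka; pose g tau := schur_poly d x tau * x d ^+ (sz ka + j - sz tau).
    rewrite (exchange_big_dep (fun tau => strip nu tau && (sz tau <= sz nu + j)%N)).
      apply: eq_bigr => tau /andP[nut le]; have := strip_sz nut => snt.
      have lt : (sz nu + j - sz tau < j.+1)%N by lia.
      rewrite (big_pred1 (Ordinal lt)) // => i.
      have := ltn_ord i => ij; rewrite nut /=; apply/eqP/eqP => [h|-> /=]; [apply/val_inj => /=|]; lia.
    by move=> /= i tau _ /andP[-> /eqP->] /=; have := ltn_ord i; lia.
  rewrite (exchange_big_dep xpredT) //=; apply: eq_bigr => tau _.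
  rewrite sumr_const; congr (_ *+ _); apply: fintype.eq_card => nu.
  by rewrite !inE andbCA.
transitivity (\sum_tau schur_poly d x tau * x d ^+ (sz ka + j - sz tau) *+
   #|[pred la | [&& strip tau la, strip ka la & sz la == (sz ka + j)%N]]|).
  by apply: eq_bigr => tau _; rewrite card_strip_exchange.
under [RHS]eq_bigr => la /andP[_ /eqP sla] do rewrite sla.
rewrite [RHS](exchange_big_dep xpredT) //=; apply: eq_bigr => tau _.
rewrite sumr_const; congr (_ *+ _); apply: fintype.eq_card => la.
by rewrite !inE [RHS]andbC.
Qed.

Lemma strip_chains_sz d mu p : strip_chains d mu p != 0%N -> sz p = (\sum_(e < d) mu e)%N.
Proof.
elim: d p => [|d IH] p /=; first by rewrite big_ord0 eqb0 negbK => /eqP->; rewrite sz0.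
rewrite sum_nat_eq0 negb_forall => /existsP[ka].
by rewrite negb_imply => /andP[/andP[_ /eqP->] /IH->]; rewrite big_ord_recr.
Qed.

Lemma schur_poly0 d x : schur_poly d x (shape0 N) = 1.
Proof.
elim: d => [|d IH] /=; first by rewrite eqxx.
rewrite (big_pred1 (shape0 N)) => [|ka]; first by rewrite IH subnn mulr1.
by rewrite strip0.
Qed.

(** By [pieri], each factor h_{mu_e} adds a horizontal strip of [mu e] boxes to the shapes reached
    from s_0 = 1, so chains are counted. The second alphabet of Cauchy's identity is present only
    through the exponents [mu]. *)
Lemma cauchy_shapes E d x (mu : nat -> nat) : (\sum_(e < E) mu e <= N)%N ->
  \prod_(e < E) complete_poly d x (mu e) = \sum_la (strip_chains E mu la)%:R * schur_poly d x la.
Proof.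
elim: E => [|E IH]; rewrite ?big_ord0 ?big_ord_recr /=.
  move=> _; rewrite (bigD1 (shape0 N)) //= eqxx schur_poly0 mulr1 big1 ?addr0 //.
  by move=> la /negbTE->; rewrite mul0r.
move=> muN; rewrite IH; last exact: leq_trans (leq_addr _ _) muN.
rewrite mulr_suml.
transitivity (\sum_ka (strip_chains E mu ka)%:R *
   \sum_(la | strip ka la && (sz la == sz ka + mu E)%N) schur_poly d x la).
  apply: eq_bigr => ka _; rewrite -mulrA.
  have [->|/strip_chains_sz kas] := eqVneq (strip_chains E mu ka) 0%N; first by rewrite !mul0r.
  by rewrite pieri // kas.
rewrite (eq_bigr _ (fun ka _ => mulr_sumr _ _ _ _)).
rewrite (exchange_big_dep xpredT) //=; apply: eq_bigr => la _.
by rewrite natr_sum mulr_suml.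
Qed.

End SchurRec.

(** * Kostka numbers *)

Section StripChains.
Local Open Scope nat_scope.

Section Triangular.
Variable N : nat.
Local Notation shape := (shape N).
Implicit Types (p q ka la nu tau : shape) (mu : nat -> nat).

(** The classical statistic n(p), strictly decreasing along the dominance order, hence a numerical
    substitute for it. *)
Definition wsum p := \sum_(i < N.+1) i * prow p i.

Lemma strip_chains_ext d mu mu' p : (forall e, e < d -> mu e = mu' e) ->
  strip_chains d mu p = strip_chains d mu' p.
Proof.
elim: d p => //= d IH p h; rewrite (h d) //; apply: eq_bigr => ka _.
by apply: IH => e ed; apply: h; apply: ltnW.
Qed.

Lemma strip_chains_step d mu p : strip_chains d.+1 mu p != 0 ->
  exists ka, [/\ strip ka p, sz p = sz ka + mu d & strip_chains d mu ka != 0].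
Proof.
rewrite /= sum_nat_eq0 negb_forall => /existsP[ka].
by rewrite negb_imply => /andP[/andP[ska /eqP e] k0]; exists ka.
Qed.

Lemma strip_chains_rows d mu p : strip_chains d mu p != 0 -> forall i, d <= i -> prow p i = 0.
Proof.
elim: d p => [|d IH] p; first by rewrite /= eqb0 negbK => /eqP-> i _; rewrite prow0.
case/strip_chains_step => ka [/stripP h _ /IH k0] [//|i] /k0; have := h i; lia.
Qed.

(** Every added box lies in a row of index at most d and so contributes at most d. The identity [E]
    measures the defect by the boxes added in rows above row d; without defect all of them are in
    row d. *)
Lemma strip_wsum d ka p : strip ka p -> (forall i, d < i -> prow p i = 0) ->
  wsum p <= wsum ka + d * (sz p - sz ka) /\
  (wsum p = wsum ka + d * (sz p - sz ka) -> forall i, i < d -> prow ka i = prow p i).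
Proof.
move=> h p0; have /stripP h' := h.
have E : wsum p + \sum_(i < N.+1) (d - i) * (prow p i - prow ka i) =
    wsum ka + d * (sz p - sz ka).
  rewrite /sz -sumnB; last by move=> i _; case: (h' i).
  rewrite big_distrr -!big_split /=; apply: eq_bigr => i _.
  have := h' i; have := p0 i; have [di|id] := ltnP d i; first by move=> ->; lia.
  move=> _ [kp _]; rewrite -{1}(subnKC kp) -[X in _ = _ + X * _](subnKC id); ring.
split=> [|e i id]; first by rewrite -E leq_addr.
have [Ni|iN] := ltnP N i; first by rewrite !prow_out.
have /eqP : \sum_(i < N.+1) (d - i) * (prow p i - prow ka i) = 0.
  by apply/eqP; rewrite -(eqn_add2l (wsum p)) E addn0 e.
rewrite sum_nat_eq0 => /forallP /(_ (inord i)) /=; rewrite inordK ?ltnS //.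
by have := h' i; nia.
Qed.

(** In tableau terms, strict columns place an entry e in a row of index at most e. Equality means
    that row e is filled with the entries e exactly. *)
Lemma strip_chains_wsum d mu p : strip_chains d mu p != 0 ->
  wsum p <= \sum_(e < d) e * mu e /\
  (wsum p = \sum_(e < d) e * mu e -> forall i, i < d -> prow p i = mu i).
Proof.
elim: d p => [|d IH] p.
  rewrite /= eqb0 negbK => /eqP->; split=> //.
  by rewrite /wsum big1 // => i _; rewrite prow0 muln0.
move=> pn0; have pr := strip_chains_rows pn0.
have [ka [h s kn0]] := strip_chains_step pn0; have [le eq] := IH _ kn0.
have [] := strip_wsum h pr; rewrite s addKn big_ord_recr /= => le' eq'.
set S := \sum_(i < d) _ in le eq *.
split=> [|e i]; first by lia.
have e1 : wsum ka = \sum_(e < d) e * mu e by lia.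
have e2 : wsum p = wsum ka + d * mu d by lia.
have kap := eq' e2; rewrite ltnS leq_eqVlt => /orP[/eqP->|id]; last first.
  by rewrite -kap // eq.
suff : sz p = sz ka + prow p d by lia.
have [Nd|dN] := ltnP N d.
  rewrite (prow_out _ Nd) addn0; apply: eq_bigr => j _; rewrite kap //.
  by have := ltn_ord j; lia.
rewrite /sz -[in RHS](inordK (n' := N) (m := d)) ?ltnS // (bigD1 (inord d)) //= addnC.
have kd := strip_chains_rows kn0; rewrite [in RHS](bigD1 (inord d)) //= inordK ?ltnS //.
rewrite (kd d) // add0n; congr (_ + _); apply: eq_bigr => j; rewrite -val_eqE /= inordK ?ltnS //.
by case: (ltngtP j d) => // jd _; [rewrite kap|rewrite kd ?pr // ltnW].
Qed.

(** The only chain adds the rows of [p] one by one. Any other penultimate shape would have too small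
    a weight, by the equality case of [strip_chains_wsum]. *)
Lemma strip_chains_diag d mu p : (forall i, i < d -> prow p i = mu i) ->
  (forall i, d <= i -> prow p i = 0) -> (forall i, prow p i.+1 <= prow p i) ->
  strip_chains d mu p = 1.
Proof.
have wsumE e q : (forall i, e <= i -> prow q i = 0) -> wsum q = \sum_(i < e) i * prow q i.
  move=> q0; rewrite /wsum (big_ord_widen_cond (maxn N.+1 e) xpredT (fun i => i * prow q i)) ?leq_maxl //.
  rewrite [RHS](big_ord_widen_cond (maxn N.+1 e) xpredT (fun i => i * prow q i)) ?leq_maxr //=.
  rewrite big_mkcond [RHS]big_mkcond /=; apply: eq_bigr => i _.
  case: ltnP => iN; case: ltnP => ie //; first by rewrite q0 ?muln0.
  by rewrite prow_out ?muln0.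
elim: d mu p => [|d IH] mu p pmu p0 dec /=.
  suff -> : p = shape0 N by rewrite eqxx.
  by apply: prowP => i; rewrite p0 ?prow0.
pose k := shape_of N (fun i => if i < d then prow p i else 0).
have kE i : prow k i = if i < d then prow p i else 0.
  apply: prow_shape_of => [j|Ni]; last by rewrite prow_out // if_same.
  by case: ifP => // _; rewrite /prow; case: ifP => // _; rewrite -ltnS.
rewrite (bigD1 k) /=; last first.
  apply/andP; split.
    apply/stripP => i; rewrite kE; case: ltnP => id; first by have := dec i; lia.
    by rewrite (p0 i.+1).
  rewrite -pmu // /sz.
  have [Nd|dN] := ltnP N d.
    rewrite (prow_out _ Nd) addn0; apply/eqP/eq_bigr => j _; rewrite kE.
    by rewrite (leq_trans (ltn_ord j) Nd).
  rewrite -[in X in _ == _ + X](inordK (n' := N) (m := d)) ?ltnS // (bigD1 (inord d)) //= addnC.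
  rewrite [X in _ == X + _](bigD1 (inord d)) //= [prow k _]kE inordK ?ltnS // ltnn add0n.
  apply/eqP; congr (_ + _); apply: eq_bigr => j; rewrite -val_eqE /= inordK ?ltnS // kE.
  by case: (ltngtP j d) => // jd _; rewrite p0.
rewrite IH ?big1 ?addn0 //.
- move=> ka /andP[/andP[h /eqP s] kak]; apply/eqP; apply: contraNT kak => kn0.
  have [le eq] := strip_chains_wsum kn0; have kr := strip_chains_rows kn0.
  have [le' _] := strip_wsum h p0; rewrite s addKn in le'.
  rewrite (wsumE _ _ p0) big_ord_recr /= pmu // in le'.
  have e : \sum_(i < d) i * prow p i = \sum_(i < d) i * mu i.
    by apply: eq_bigr => i _; rewrite pmu // ltnW // ltnS.
  rewrite e in le'.
  apply/eqP/prowP => i; rewrite kE; case: ltnP => id; last by rewrite kr.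
  rewrite eq ?pmu ?ltnS // 1?ltnW //.
  by apply/eqP; rewrite eqn_leq le -(leq_add2r (d * mu d)).
- by move=> i id; rewrite kE id pmu // ltnW.
- by move=> i di; rewrite kE ltnNge di.
- move=> i; rewrite !kE; have := dec i; case: ltnP => id; case: ltnP => //; lia.
Qed.

End Triangular.

End StripChains.

(** * Tableaux on a square grid as chains of strips *)

Section BoxTableaux.
Local Open Scope nat_scope.

Lemma card_ord_lt n k : k <= n -> #|[pred j : 'I_n | j < k]| = k.
Proof.
move=> kn; rewrite -[RHS]card_ord -(fintype.card_image (f := widen_ord kn)); last first.
  by move=> i j /(congr1 val) /= /val_inj.
apply: fintype.eq_card => j; rewrite !inE; apply/idP/fintype.imageP => [jk|[i _ ->]]; last exact: (valP i).
by exists (Ordinal jk) => //; apply/val_inj.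
Qed.

Lemma card_downset n (A : {pred 'I_n}) :
  (forall i j : 'I_n, i <= j -> j \in A -> i \in A) ->
  forall j : 'I_n, (j \in A) = (j < #|A|).
Proof.
move=> down j; apply/idP/idP => [jA|]; last apply: contraTT => jA.
  rewrite -[X in X <= _](card_ord_lt (ltn_ord j)); apply/subset_leq_card/fintype.subsetP => i.
  by rewrite inE ltnS => ij; apply: down jA.
rewrite -leqNgt -[X in _ <= X](card_ord_lt (ltnW (ltn_ord j))).
apply/subset_leq_card/fintype.subsetP => i iA; rewrite inE ltnNge.
by apply: contra jA => ji; apply: down ji iA.
Qed.

Section Boxes.
Variable N : nat.
Local Notation shape := (shape N).
Implicit Types (p q ka la nu tau : shape) (mu : nat -> nat).
Local Notation box := ('I_N.+1 * 'I_N.+1)%type.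

Lemma card_boxes p : #|[pred c : box | c.2 < p c.1]| = sz p.
Proof.
rewrite -sum1_card -(pair_big_dep xpredT (fun i (j : 'I_N.+1) => j < p i) (fun _ _ => 1)) /=.
apply: eq_bigr => i _; rewrite sum1_card card_ord_lt ?prowE //.
by apply: ltnW; apply: ltn_ord.
Qed.

(* The value d marks the boxes outside of the diagram. *)
Definition box_tableau d mu p : {pred {ffun box -> 'I_d.+1}} := fun T =>
  [&& [forall i : 'I_N.+1, forall j : 'I_N.+1, (T (i, j) < d) == (j < p i)],
      [forall i : 'I_N.+1, forall j : 'I_N.+1, forall j' : 'I_N.+1, (j <= j') ==> (T (i, j) <= T (i, j'))],
      [forall i : 'I_N.+1, forall i' : 'I_N.+1, forall j : 'I_N.+1,
         (i < i') && (T (i', j) < d) ==> (T (i, j) < T (i', j))]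
    & [forall v : 'I_d, #|[pred c : box | T c == v :> nat]| == mu v]].

Arguments box_tableau : clear implicits.

Lemma box_tableauP d mu p (T : {ffun box -> 'I_d.+1}) :
  reflect [/\ forall i j : 'I_N.+1, (T (i, j) < d) = (j < p i),
              forall i j j' : 'I_N.+1, j <= j' -> T (i, j) <= T (i, j'),
              forall i i' j : 'I_N.+1, i < i' -> T (i', j) < d -> T (i, j) < T (i', j)
            & forall v, v < d -> #|[pred c : box | T c == v :> nat]| = mu v]
          (T \in box_tableau d mu p).
Proof.
apply: (iffP and4P) => [[h1 h2 h3 h4]|[h1 h2 h3 h4]]; split.
- by move=> i j; move/forallP: h1 => /(_ i) /forallP/(_ j)/eqP.
- by move=> i j j'; move/forallP: h2 => /(_ i) /forallP/(_ j)/forallP/(_ j')/implyP.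
- move=> i i' j ii Tij; move/forallP: h3 => /(_ i) /forallP/(_ i')/forallP/(_ j)/implyP.
  by apply; rewrite ii.
- by move=> v vd; move/forallP: h4 => /(_ (Ordinal vd)) /eqP.
- by apply/forallP => i; apply/forallP => j; rewrite h1.
- by do 3! apply/forallP => ?; apply/implyP; apply: h2.
- by do 3! apply/forallP => ?; apply/implyP => /andP[]; apply: h3.
- by apply/forallP => v; apply/eqP/h4.
Qed.

(** The boxes with the largest entry d form a horizontal strip since columns are strict; removing
    them leaves a tableau of shape [shp T]. *)
Lemma box_tableau_rec d mu p :
  #|box_tableau d.+1 mu p| =
  \sum_(ka | strip ka p && (sz p == sz ka + mu d)) #|box_tableau d mu ka|.
Proof.
pose shp (T : {ffun box -> 'I_d.+2}) : shape :=
  [ffun i => inord #|[pred j : 'I_N.+1 | T (i, j) < d]|].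
have shpP T : T \in box_tableau d.+1 mu p ->
    forall i j : 'I_N.+1, (T (i, j) < d) = (j < shp T i).
  case/box_tableauP => h1 h2 _ _ i j; rewrite ffunE inordK.
    rewrite -card_downset ?inE // => j1 j2 j12; rewrite !inE.
    by apply: leq_ltn_trans; apply: h2.
  apply: leq_ltn_trans (ltn_ord (p i)).
  rewrite -[X in _ <= X](card_ord_lt (ltnW (ltn_ord (p i)))).
  apply/subset_leq_card/fintype.subsetP => k; rewrite !inE -h1 => lt; exact: ltnW.
have shpS T : T \in box_tableau d.+1 mu p ->
    strip (shp T) p && (sz p == sz (shp T) + mu d).
  move=> TB; have h := shpP T TB; have /box_tableauP[h1 h2 h3 h4] := TB.
  apply/andP; split.
    apply/forallP => /= i; apply/andP; split.
      rewrite leqNgt; apply/negP => lt.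
      have pN : p i < N.+1 := ltn_ord (p i).
      have := h i (inord (p i)); have := h1 i (inord (p i)).
      by rewrite inordK // lt ltnn => /negbT; rewrite -leqNgt => /ltnW; rewrite ltnNge => ->.
    rewrite leqNgt /prow; case: ifP => // iN; apply/negP => lt.
    have sN : shp T i < N.+1 := ltn_ord (shp T i).
    have := h i (inord (shp T i)); rewrite inordK // ltnn => /negbT Td.
    have := h1 (inord i.+1) (inord (shp T i)); rewrite inordK // lt => Td'.
    have := h3 i (inord i.+1) (inord (shp T i)).
    by rewrite inordK ?ltnS // => /(_ (leqnn _) Td'); lia.
  rewrite -(h4 d) // -!card_boxes.
  rewrite -(cardID [pred c : box | T c < d] [pred c : box | c.2 < p c.1]); apply/eqP.
  congr (_ + _); apply: fintype.eq_card => -[i j]; rewrite !inE /= -h1 -?h; lia.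
rewrite -sum1_card (partition_big shp (fun ka => strip ka p && (sz p == sz ka + mu d))) /=; last first.
  by move=> T TB; apply: shpS.
apply: eq_bigr => ka /andP[ska /eqP sze].
rewrite sum1_card.
(* The outside marker is [d.+1] before the removal and [d] after it. [f] merges the entries d with
   the outside; [g] restores them in the boxes of [p] not in [ka]. *)
pose f (T : {ffun box -> 'I_d.+2}) : {ffun box -> 'I_d.+1} :=
  [ffun c => inord (minn (T c) d)].
pose g (T : {ffun box -> 'I_d.+1}) : {ffun box -> 'I_d.+2} :=
  [ffun c => inord (if T c < d then T c : nat else if c.2 < p c.1 then d else d.+1)].
have fE T (c : box) : f T c = minn (T c) d :> nat by rewrite ffunE inordK //; lia.
have gE T (c : box) : nat_of_ord (g T c) = if T c < d then T c : nat else if c.2 < p c.1 then d else d.+1.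
  rewrite ffunE inordK //; case: ifP; first by lia.
  by case: ifP.
have kap (i j : 'I_N.+1) : j < ka i -> j < p i.
  by move=> jk; apply: leq_trans jk _; move/forallP: ska => /(_ i) /andP[].
have kaS (i i' j : 'I_N.+1) : i < i' -> j < p i' -> j < ka i.
  move=> ii jp; have := strip_decr ska; have /stripP := ska.
  rewrite -!prowE in jp *.
  move=> h dec; apply: leq_trans jp _; apply: leq_trans (proj2 (h i)).
  rewrite -(subnK ii); elim: (i' - i.+1) => // k; apply: leq_trans; exact: dec.
apply: (card_in_cancel (f := f) (g := g)).
- move=> T /andP[TB /eqP shk]; have h := shpP T TB; rewrite shk in h.
  have /box_tableauP[h1 h2 h3 h4] := TB; apply/box_tableauP; split.
  + by move=> i j; rewrite fE -h; lia.
  + by move=> i j j' jj; rewrite !fE; have := h2 i j j' jj; lia.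
  + by move=> i i' j ii; rewrite !fE; have := h3 i i' j ii; lia.
  + move=> v vd; rewrite -(h4 v) ?(ltnW vd) //; last by lia.
    by apply: fintype.eq_card => c; rewrite !inE fE; lia.
- move=> T TB; have /box_tableauP[h1 h2 h3 h4] := TB.
  have gd i j : (g T (i, j) < d) = (j < ka i).
    by rewrite gE h1 /=; have := h1 i j; case: ifP => // jk; case: ifP; lia.
  have gB : g T \in box_tableau d.+1 mu p.
    apply/box_tableauP; split.
    + move=> i j; rewrite gE h1 /=; case: ifP => [jk|_]; last by case: ifP; lia.
      by rewrite kap //; have := h1 i j; lia.
    + move=> i j j' jj; rewrite !gE /=; have := h2 i j j' jj.
      by case: ifP; case: ifP; try (case: ifP); try (case: ifP); lia.
    + move=> i i' j ii; rewrite !gE /=.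
      have := h3 i i' j ii; have := kaS i i' j ii; have := h1 i j; have := h1 i' j.
      have := kap i j; have := kap i' j; move: (nat_of_ord (T _)) (nat_of_ord (T _)).
      move=> a b; move: (j < ka i) (j < ka i') (j < p i) (j < p i') => [] [] [] [] /=;
      by repeat (case: ifP => ?); lia.
    + move=> v; rewrite ltnS leq_eqVlt => /orP[/eqP->|vd].
        apply/eqP; rewrite -(eqn_add2l (sz ka)) -sze -!card_boxes eq_sym.
        rewrite -(cardID [pred c : box | c.2 < ka c.1] [pred c : box | c.2 < p c.1]); apply/eqP.
        congr (_ + _); apply: fintype.eq_card => -[i j]; rewrite !inE /= ?gE ?h1 /=.
          by have := kap i j; case: (j < ka i) => //; lia.
        have := h1 i j; have := kap i j.
        repeat (case: ifP => ? //=); lia.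
      rewrite -(h4 v) //; apply: fintype.eq_card => c; rewrite !inE gE.
      by case: ifP => //; case: ifP; lia.
  apply/andP; split => //; apply/eqP/ffunP => i; apply/val_inj.
  have H j := etrans (esym (gd i j)) (shpP _ gB i j).
  apply/eqP; rewrite eqn_leq; apply/andP; split; rewrite leqNgt; apply/negP => lt.
    have lk : ka i < N.+1 := ltn_ord _.
    by have := H (inord (ka i)); rewrite inordK // ltnn lt.
  have lk : shp (g T) i < N.+1 := ltn_ord _.
  by have := H (inord (shp (g T) i)); rewrite inordK // ltnn lt.
- move=> T /andP[TB /eqP shk]; have /box_tableauP[h1 h2 h3 h4] := TB.
  apply/ffunP => -[i j]; apply/val_inj; rewrite /= gE fE /=; have := h1 i j.
  by have := ltn_ord (T (i, j)); move: (nat_of_ord (T _)) => a; repeat (case: ifP => ?); lia.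
- move=> T TB; have /box_tableauP[h1 h2 h3 h4] := TB.
  apply/ffunP => -[i j]; apply/val_inj; rewrite /= fE gE /=; have := h1 i j.
  by have := ltn_ord (T (i, j)); move: (nat_of_ord (T _)) => a; repeat (case: ifP => ?); lia.
Qed.

Lemma card_box_tableau d mu p : #|box_tableau d mu p| = strip_chains d mu p.
Proof.
elim: d p => [|d IH] p; last first.
  by rewrite box_tableau_rec /=; apply: eq_bigr => ka _.
rewrite /=; have [->|p0] := eqVneq p (shape0 N).
  rewrite (fintype.eq_card1 (x := [ffun=> ord0])) // => T; rewrite !inE.
  have -> : T = [ffun=> ord0] by apply/ffunP => c; rewrite ord1 ffunE.
  rewrite eqxx; apply/box_tableauP; split=> // [i j|i j j' _].
    by rewrite !ffunE.
  by rewrite !ffunE.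
apply: fintype.eq_card0 => T; apply: contra_neqF p0 => /box_tableauP[h _ _ _].
apply/ffunP => i; apply/val_inj; rewrite ffunE /=; apply/eqP.
by have := h i ord0; rewrite !ltn0 /=; case: (nat_of_ord (p i)).
Qed.
End Boxes.

End BoxTableaux.

Section KostkaNumbers.
Local Open Scope nat_scope.

Section Parts.
Implicit Types (la : intpart).

Lemma part_nth_decr la i : nth 0 la i.+1 <= nth 0 la i.
Proof.
case: la => s /= /andP[so _]; elim: s i so => [|a s IH] i; first by rewrite !nth_nil.
case: s IH => [|b s] IH; first by rewrite /= nth_nil.
by move=> /= /andP[ab so]; case: i => [//|i]; apply: (IH i).
Qed.

Lemma part_nth_gt0 la i : (0 < nth 0 la i) = (i < size la).
Proof.
case: (ltnP i (size la)) => iN; last by rewrite nth_default.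
by case: la iN => s /= /andP[_ s0] iN; rewrite lt0n; apply: contraNneq s0 => <-; apply: mem_nth.
Qed.

Lemma nth_le_sumn (s : seq nat) i : nth 0 s i <= sumn s.
Proof.
by elim: s i => [|a s IH] [|i] //=; [apply: leq_addr|apply: leq_trans (IH i) (leq_addl _ _)].
Qed.

Lemma sumn_sum_nth (s : seq nat) n : size s <= n -> sumn s = \sum_(i < n) nth 0 s i.
Proof.
elim: n s => [|n IH] [|a s] //=; rewrite ?big_ord0 //.
  by rewrite big1 // => i _; rewrite nth_nil.
by rewrite ltnS => /IH->; rewrite big_ord_recl.
Qed.

Lemma part_size_le la : size la <= sumn la.
Proof.
rewrite (sumn_sum_nth (leqnn _)) -[X in X <= _]card_ord -sum1_card.
by apply: leq_sum => i _; rewrite part_nth_gt0.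
Qed.

Lemma part_eq la la' : (forall i, nth 0 la i = nth 0 la' i) -> la = la'.
Proof.
move=> h; apply/val_inj/(@eq_from_nth _ 0) => // /=.
have le (l l' : intpart) : (forall i, nth 0 l i = nth 0 l' i) -> size l <= size l'.
  move=> hh; rewrite leqNgt; apply/negP => lt.
  by have := hh (size l'); rewrite (nth_default _ (leqnn _)); have := part_nth_gt0 l (size l'); lia.
by apply/eqP; rewrite eqn_leq !le.
Qed.

Definition part_shape N la : shape N := shape_of N (nth 0 la).

Lemma prow_part N la i : sumn la <= N -> prow (part_shape N la) i = nth 0 la i.
Proof.
move=> lN; apply: prow_shape_of => [j|Ni]; first exact: leq_trans (nth_le_sumn _ _) lN.
by rewrite nth_default //; have := part_size_le la; lia.
Qed.

Lemma sz_part N la : sumn la <= N -> sz (part_shape N la) = sumn la.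
Proof.
move=> lN; rewrite (sumn_sum_nth (n := N.+1)); last by have := part_size_le la; lia.
by apply: eq_bigr => i _; rewrite prow_part.
Qed.

Lemma cell_inj la (x y : cell la) : crow x = crow y -> ccol x = ccol y -> x = y.
Proof.
case: x y => i j [i' j'] /= e; case: i' / e j' => j' e.
by congr existT; apply/val_inj.
Qed.

Lemma ccol_lt la (x : cell la) : ccol x < nth 0 la (crow x).
Proof. exact: ltn_ord. Qed.

Lemma cell_at la i j : j < nth 0 la i -> exists x : cell la, crow x = i :> nat /\ ccol x = j.
Proof.
move=> ij; have il : i < size la by rewrite -part_nth_gt0; lia.
by exists (existT _ (Ordinal il) (Ordinal ij)).
Qed.

Lemma semistandardP la (T : cell la -> nat) :
  reflect ((forall x y, crow x = crow y -> ccol x <= ccol y -> T x <= T y) /\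
           (forall x y, ccol x = ccol y -> crow x < crow y -> T x < T y))
          (semistandard T).
Proof.
apply: (iffP forallP) => [h|[h1 h2] x].
  by split=> x y e l; have /forallP/(_ y)/andP[/implyP a /implyP b] := h x;
    [apply: a|apply: b]; rewrite e eqxx.
apply/forallP => y; apply/andP; split; apply/implyP => /andP[/eqP e l].
  exact: h1.
exact: h2.
Qed.

(** Passes from fillings of the dependent type [cell la], with values in the support of [m], to grid
    fillings: [f] extends a tableau by the marker d off the diagram. All genuine entries are below d
    because [m] vanishes from d on. *)
Lemma kostkaE N d la (m : {cmonom nat}) : sumn la <= N ->
  (forall i, d <= i -> m i = 0) -> kostka la m = strip_chains d m (part_shape N la).
Proof.
move=> lN md; rewrite -card_box_tableau /kostka.
pose f (T : {ffun cell la -> finsupp m}) : {ffun 'I_N.+1 * 'I_N.+1 -> 'I_d.+1} :=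
  [ffun c : 'I_N.+1 * 'I_N.+1 => inord (if [pick x : cell la | (crow x == c.1 :> nat) && (ccol x == c.2)] is Some x
                    then val (T x) else d)].
have md' (v : finsupp m) : val v < d.
  by rewrite ltnNge; apply/negP => /md /eqP; rewrite cmE_eq0 (valP v).
have fE T (x : cell la) (c : 'I_N.+1 * 'I_N.+1) :
    crow x = c.1 :> nat -> ccol x = c.2 -> f T c = val (T x) :> nat.
  move=> xr xc; rewrite ffunE; case: pickP => [y /andP[/eqP yr /eqP yc]|/(_ x)].
    rewrite inordK; last by apply: leq_trans (md' _) _.
    congr (val (T _)); apply: cell_inj; first by apply/val_inj; rewrite /= yr.
    by rewrite yc.
  by rewrite xr xc !eqxx.
have fO T (c : 'I_N.+1 * 'I_N.+1) : nth 0 la c.1 <= c.2 -> f T c = d :> nat.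
  move=> out; rewrite ffunE; case: pickP => [y /andP[/eqP yr /eqP yc]|_].
    by have := ccol_lt y; rewrite yr yc; lia.
  by rewrite inordK.
have cN (x : cell la) : crow x < N.+1 /\ ccol x < N.+1.
  have := ltn_ord (crow x); have := ccol_lt x; have := nth_le_sumn la (crow x).
  by have := part_size_le la; lia.
pose pos (x : cell la) : 'I_N.+1 * 'I_N.+1 := (inord (crow x), inord (ccol x)).
have posr x : (pos x).1 = crow x :> nat by rewrite inordK //; case: (cN x).
have posc x : (pos x).2 = ccol x :> nat by rewrite inordK //; case: (cN x).
have fpos T x : f T (pos x) = val (T x) :> nat by apply: fE.
have finj : injective f.
  move=> T T' e; apply/ffunP => x; apply/val_inj.
  by rewrite /= -!fpos e.
have row_part (i : 'I_N.+1) : part_shape N la i = nth 0 la i :> nat.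
  by rewrite -prowE prow_part.
have pos_surj (c : 'I_N.+1 * 'I_N.+1) : c.2 < nth 0 la c.1 -> exists x, pos x = c.
  case: c => i j /cell_at[x [xr xc]]; exists x.
  by rewrite /pos xr xc !inord_val.
have posP c : nth 0 la (c.1 : 'I_N.+1) <= (c.2 : 'I_N.+1) \/ exists x, pos x = c.
  by have [|/pos_surj] := leqP (nth 0 la c.1) c.2; [left|right].
have pos_inj : injective pos.
  move=> x y e; apply: cell_inj; last by rewrite -posc e posc.
  by apply/val_inj; rewrite /= -posr e posr.
have cont (T : {ffun cell la -> finsupp m}) (v : finsupp m) :
    #|[set x | T x == v]| = #|[pred c : 'I_N.+1 * 'I_N.+1 | f T c == val v :> nat]|.
  rewrite -(fintype.card_image pos_inj); apply: fintype.eq_card => c; rewrite inE.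
  apply/fintype.imageP/eqP => [[x]|fv]; first by rewrite inE => /eqP<- ->; rewrite fpos.
  have [out|[x xc]] := posP c.
    by have := md' v; rewrite -fv fO // ltnn.
  by exists x => //; rewrite inE; apply/eqP/val_inj; rewrite /= -fpos xc.
rewrite -(fintype.card_image finj); apply: fintype.eq_card => B.
apply/fintype.imageP/box_tableauP => [[T]|[h1 h2 h3 h4]].
  rewrite inE => /andP[/semistandardP[s1 s2] /forallP cT] ->.
  split=> [i j|i j j' jj|i i' j ii lt|v vd].
  - rewrite row_part; case: (leqP (nth 0 la i) j) => ij.
      by rewrite fO // ltnn.
    by have [x <-] := pos_surj (i, j) ij; rewrite fpos md'.
  - have [out|/(pos_surj (i, j'))[y ye]] := leqP (nth 0 la i) j'.
      by rewrite [X in _ <= X]fO // -ltnS.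
    have /(pos_surj (i, j))[x xe] : j < nth 0 la i.
      by apply: leq_ltn_trans jj _; have := ccol_lt y; rewrite -posr -posc ye.
    rewrite -xe -ye !fpos; apply: s1; last by rewrite -!posc xe ye.
    by apply/val_inj; rewrite /= -!posr xe ye.
  - have [out|/(pos_surj (i', j))[y ye]] := leqP (nth 0 la i') j.
      by move: lt; rewrite fO // ltnn.
    have /(pos_surj (i, j))[x xe] : j < nth 0 la i.
      have := ccol_lt y; rewrite -posr -posc ye /= => /leq_trans; apply.
      rewrite -(subnK (ltnW ii)); elim: (i' - i) => // k; apply: leq_trans.
      exact: part_nth_decr.
    by rewrite -xe -ye !fpos; apply: s2; rewrite -?posc -?posr xe ye.
  - have [vm|vm] := boolP (v \in finsupp m).
      by have /eqP := cT (FSetSub vm); rewrite cont.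
    move: (vm); rewrite -cmE_eq0 => /eqP->; apply: fintype.eq_card0 => c; rewrite !inE.
    apply: contraNF vm => /eqP e; have [out|[x xc]] := posP c.
      by move: vd; rewrite -e fO // ltnn.
    by rewrite -e -xc fpos; apply: valP.
(* An entry that occurs has a positive count in [m], hence lies in the support, as the value type of
   [kostka] demands. *)
have Bm x : (B (pos x) : nat) \in finsupp m.
  have Bd : B (pos x) < d by rewrite h1 row_part posr posc ccol_lt.
  rewrite -cmE_neq0 -(h4 _ Bd) -lt0n; apply/card_gt0P; exists (pos x).
  by rewrite inE.
pose T := [ffun x => FSetSub (Bm x)].
have TE x : val (T x) = B (pos x) by rewrite ffunE.
have BE : B = f T.
  apply/ffunP => c; apply/val_inj.
  have [out|[x <-]] := posP c; last by rewrite /= fpos TE.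
  rewrite /= fO //; apply/eqP; rewrite eqn_leq -ltnS ltn_ord /= leqNgt.
  by case: c out => i j out; rewrite h1 row_part -leqNgt.
have h2' (c c' : 'I_N.+1 * 'I_N.+1) : c.1 = c'.1 -> c.2 <= c'.2 -> B c <= B c'.
  by case: c c' => [i j] [i' j'] /= ->; apply: h2.
have h3' (c c' : 'I_N.+1 * 'I_N.+1) : c.2 = c'.2 -> c.1 < c'.1 -> B c' < d -> B c < B c'.
  by case: c c' => [i j] [i' j'] /= ->; apply: h3.
exists T => //; rewrite inE; apply/andP; split.
  apply/semistandardP; split=> x y e l; rewrite !TE.
    by apply: h2'; rewrite ?posc // /pos /= e.
  apply: h3'; rewrite ?posr //; first by rewrite /pos /= e.
  by rewrite -TE md'.
by apply/forallP => v; rewrite cont -BE h4.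
Qed.
End Parts.

End KostkaNumbers.

(** * Partitions of m and the triangularity of Kostka numbers *)

Section PartitionEnumeration.
Local Open Scope nat_scope.

Section PartsOf.
Variable m : nat.
Implicit Types (la : intpart) (p : shape m).

Definition decr p := [forall i : 'I_m.+1, prow p i.+1 <= prow p i].

Lemma decrP p : reflect (forall i, prow p i.+1 <= prow p i) (decr p).
Proof.
apply: (iffP forallP) => h i //; have [im|mi] := ltnP i m.+1; first exact: (h (Ordinal im)).
by rewrite prow_out // leqW.
Qed.

(** The default [empty_part] is never reached for a decreasing shape, the only case in which
    [part_of] is evaluated. *)
Definition part_of p : intpart :=
  insubd empty_part [seq x <- mkseq (prow p) m.+1 | x != 0].

Lemma nth_filter_neq0 (s : seq nat) i : sorted geq s ->
  nth 0 [seq x <- s | x != 0] i = nth 0 s i.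
Proof.
elim: s i => // a s IH i /= pas; have so := path_sorted pas.
case: eqVneq pas => [->|_] pas; last by case: i => [//|i] /=; apply: IH.
have /all_pred1P-> : all (pred1 0) s.
  have := order_path_min (rev_trans leq_trans) pas.
  by apply: sub_all => x; rewrite /= leqn0.
rewrite /=; have -> : [seq x <- nseq (size s) 0 | x != 0] = [::].
  by elim: (size s).
by case: i => [|i] //=; rewrite nth_nseq if_same.
Qed.

Lemma nth_part_of p i : decr p -> nth 0 (part_of p) i = prow p i.
Proof.
move=> /decrP dp; rewrite /part_of.
have so : sorted geq (mkseq (prow p) m.+1).
  by apply/(sortedP 0) => j; rewrite size_mkseq => jm; rewrite !nth_mkseq //; [exact: dp|exact: ltnW].
have fp : is_part [seq x <- mkseq (prow p) m.+1 | x != 0].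
  by rewrite /is_part (sorted_filter (rev_trans leq_trans)) // mem_filter eqxx.
rewrite val_insubd fp nth_filter_neq0 //.
have [im|mi] := ltnP i m.+1; first by rewrite nth_mkseq.
by rewrite nth_default ?size_mkseq // prow_out.
Qed.

Lemma sumn_part_of p : decr p -> sz p <= m -> sumn (part_of p) = sz p.
Proof.
move=> dp pm; rewrite (sumn_sum_nth (n := m.+1)).
  by apply: eq_bigr => i _; rewrite nth_part_of.
rewrite leqNgt -part_nth_gt0 nth_part_of // prow_out //.
Qed.

Lemma part_of_shape p : decr p -> sz p <= m -> part_shape m (part_of p) = p.
Proof.
move=> dp pm; apply: prowP => i.
by rewrite prow_part ?nth_part_of // sumn_part_of.
Qed.

Lemma decr_part la : sumn la <= m -> decr (part_shape m la).
Proof. by move=> lm; apply/decrP => i; rewrite !prow_part ?part_nth_decr. Qed.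

Lemma shape_of_part la : sumn la <= m -> part_of (part_shape m la) = la.
Proof.
by move=> lm; apply: part_eq => i; rewrite nth_part_of ?decr_part ?prow_part.
Qed.

Definition parts : seq intpart := [seq part_of p | p <- enum [pred p | decr p & sz p == m]].

Lemma mem_parts la : (la \in parts) = (sumn la == m).
Proof.
apply/mapP/eqP => [[p]|lm].
  by rewrite mem_enum inE => /andP[dp /eqP pm] ->; rewrite sumn_part_of ?pm.
exists (part_shape m la); last by rewrite shape_of_part ?lm.
by rewrite mem_enum inE decr_part ?sz_part ?lm /=.
Qed.

Lemma parts_uniq : uniq parts.
Proof.
rewrite map_inj_in_uniq ?enum_uniq // => p q.
rewrite !mem_enum !inE => /andP[dp /eqP pm] /andP[dq /eqP qm] e.
by rewrite -[p]part_of_shape ?pm // e part_of_shape ?qm.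
Qed.

Lemma sum_parts (V : nmodType) (F : shape m -> V) :
  (forall p, ~~ (decr p && (sz p == m)) -> F p = 0%R) ->
  (\sum_p F p = \sum_(la <- parts) F (part_shape m la))%R.
Proof.
move=> F0; rewrite /parts big_map big_enum /= [LHS](bigID (fun p => decr p && (sz p == m))) /=.
rewrite [X in (_ + X)%R]big1 ?addr0 //.
by apply: eq_bigr => p /andP[dp /eqP pm]; rewrite part_of_shape ?pm.
Qed.

Lemma strip_chains_decr d mu p : strip_chains d mu p != 0 -> decr p.
Proof.
case: d => [|d]; last by case/strip_chains_step => ka [/strip_decr/decrP].
by rewrite /= eqb0 negbK => /eqP->; apply/decrP => i; rewrite !prow0.
Qed.

Definition kostka_num d (mu : nat -> nat) la := strip_chains d mu (part_shape m la).

(** A shape that is not decreasing, or not of size m, ends no chain of content [mu], so the sum over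
    shapes reduces to the partitions of m. *)
Lemma cauchy_parts (R : comNzRingType) E d x (mu : nat -> nat) :
  \sum_(e < E) mu e = m ->
  (\prod_(e < E) complete_poly d x (mu e) =
   \sum_(la <- parts) (kostka_num E mu la)%:R * schur_poly d x (part_shape m la) :> R)%R.
Proof.
move=> mum; rewrite (@cauchy_shapes m) ?mum // sum_parts // => p.
have [->|k0] := eqVneq (strip_chains E mu p) 0; first by rewrite mul0r.
by rewrite (strip_chains_decr k0) (strip_chains_sz k0) mum eqxx.
Qed.

Definition wpart la := \sum_(i < m.+1) i * nth 0 la i.

Lemma wsum_part la : sumn la = m -> wsum (part_shape m la) = wpart la.
Proof. by move=> lm; apply: eq_bigr => i _; rewrite prow_part ?lm. Qed.

(** This is [strip_chains_wsum] for the content [la']: the bound there equals [wpart la'], as d is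
    large enough to see all rows, and its equality case identifies the two partitions. *)
Lemma kostka_num_triangular d la la' : m <= d -> sumn la = m -> sumn la' = m ->
  kostka_num d (nth 0 la') la != 0 -> wpart la < wpart la' \/ la = la'.
Proof.
move=> md lm lm' k0; have [] := strip_chains_wsum k0; rewrite wsum_part //.
have -> : \sum_(e < d) e * nth 0 la' e = wpart la'.
  have dm : maxn d m.+1 = maxn m.+1 d by lia.
  have out e : m <= e -> nth 0 la' e = 0 by move=> me; rewrite nth_default //; have := part_size_le la'; lia.
  rewrite /wpart (big_ord_widen_cond (maxn d m.+1) xpredT (fun i => i * nth 0 la' i)) ?leq_maxl //.
  rewrite [RHS](big_ord_widen_cond (maxn d m.+1) xpredT (fun i => i * nth 0 la' i)) ?leq_maxr //=.
  rewrite big_mkcond [RHS]big_mkcond /=; apply: eq_bigr => i _.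
  by have := @out i; case: ltnP => i1; case: ltnP => i2 //= o; rewrite o ?muln0 //; lia.
rewrite leq_eqVlt => /orP[/eqP e h|]; [right|by left].
apply: part_eq => i; have [id|di] := ltnP i d.
  by rewrite -h // prow_part ?lm.
by rewrite !nth_default //; [have := part_size_le la'|have := part_size_le la]; lia.
Qed.

Lemma kostka_num_diag d la : m <= d -> sumn la = m -> kostka_num d (nth 0 la) la = 1.
Proof.
move=> md lm; apply: strip_chains_diag => i; rewrite ?prow_part ?lm //.
  by move=> di; rewrite nth_default //; have := part_size_le la; lia.
exact: part_nth_decr.
Qed.

End PartsOf.

(** * Coefficients of formal power series *)

Section SeriesCoefficients.
Local Open Scope ring_scope.
Variables (R : comNzRingType) (I : choiceType).
Local Notation S := (mseries R I).

Lemma mscoefD (f g : S) (m : {cmonom I}) : (f + g : S) m = f m + g m. Proof. by []. Qed.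
Lemma mscoef0 (m : {cmonom I}) : (0 : S) m = 0. Proof. by []. Qed.

Lemma mscoef_sum (J : Type) (r : seq J) (P : pred J) (F : J -> S) (m : {cmonom I}) :
  (\sum_(j <- r | P j) F j : S) m = \sum_(j <- r | P j) F j m.
Proof. exact: (big_morph (fun f : S => f m) (fun f g => mscoefD f g m) (mscoef0 m)). Qed.

Lemma mscoefMn (f : S) n (m : {cmonom I}) : (f *+ n : S) m = f m *+ n.
Proof. by elim: n => // n IH; rewrite !mulrS mscoefD IH. Qed.

Lemma mscoef1 (m : {cmonom I}) : (1 : S) m = (m == onecm I)%:R.
Proof. by rewrite -[LHS]/(if m == onecm I then 1 else 0); case: eqP. Qed.

Lemma mscoefM (f g : S) (m : {cmonom I}) :
  (f * g : S) m = \sum_(a <- mdivisors m) f a * g (divcm m a).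
Proof. by []. Qed.

Lemma mdivisors_le (m a : {cmonom I}) :
  reflect (forall i, (a i <= m i)%N) (a \in mdivisors m).
Proof.
apply: (iffP (mdivisorsP m a)) => [<- i|h]; first by rewrite mulcmE leq_addr.
by apply/eqP/cmP => i; rewrite mulcmE divcmE subnKC.
Qed.

Definition msmono (a : {cmonom I}) : S := MSeries (fun m => (m == a)%:R).

Lemma mscoef_mono a m : msmono a m = (m == a)%:R.
Proof. by []. Qed.

Lemma mscoef_monoM a (f : S) (m : {cmonom I}) :
  (msmono a * f : S) m = if a \in mdivisors m then f (divcm m a) else 0.
Proof.
rewrite mscoefM; case: ifP => am.
  rewrite (big_fsetD1 a) //= eqxx mul1r big1_fset ?addr0 // => b.
  by rewrite in_fsetD1 => /andP[/negbTE ba _] _; rewrite ba mul0r.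
rewrite big1_fset // => b bm _; rewrite mscoef_mono; case: eqP => [ba|]; last by rewrite mul0r.
by rewrite -ba bm in am.
Qed.

Lemma msmonoM a b : msmono a * msmono b = msmono (mulcm a b).
Proof.
apply: mseriesP => m; rewrite mscoef_monoM !mscoef_mono.
suff -> : (m == mulcm a b) = (a \in mdivisors m) && (divcm m a == b) by case: ifP.
apply/eqP/andP => [->|[/mdivisorsP am /eqP <-]]; last by rewrite am.
by rewrite mulcmK eqxx mdivisors_mul.
Qed.

Definition cmX (i : I) (k : nat) : {cmonom I} := iter k (mulcm (ucm i)) (onecm I).

Lemma cmXE i k j : cmX i k j = ((i == j) * k)%N.
Proof.
elim: k => [|k IH]; first by rewrite /cmX /= onecmE muln0.
by rewrite /= mulcmE ucmE IH mulnS.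
Qed.

Lemma msvarX i k : msvar R i ^+ k = msmono (cmX i k).
Proof.
elim: k => [|k IH]; first by apply: mseriesP => m; rewrite expr0 mscoef1.
by rewrite exprS IH -[msvar R i]/(msmono (ucm i)) msmonoM.
Qed.

Lemma mscoef_mulvarX (f : S) i k (m : {cmonom I}) :
  (f * msvar R i ^+ k : S) m = if (k <= m i)%N then f (divcm m (cmX i k)) else 0.
Proof.
rewrite mulrC msvarX mscoef_monoM; congr (if _ then _ else _).
apply/mdivisors_le/idP => [/(_ i)|ki j]; rewrite cmXE; first by rewrite eqxx mul1n.
by case: eqP => [<-|]; rewrite ?mul1n.
Qed.

End SeriesCoefficients.

Section SfunCoef.
Local Open Scope ring_scope.
Variables (R : comNzRingType) (N : nat).

Lemma schur_poly_coef0 d (p : shape N) (m : {cmonom nat}) i :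
  (d <= i)%N -> m i != 0%N -> schur_poly d (@msvar R nat) p m = 0.
Proof.
elim: d p m => [|d IH] p m di mi /=.
  case: eqP => _; last by rewrite mscoef0.
  by rewrite mscoef1; case: eqP => // m1; rewrite m1 onecmE in mi.
rewrite mscoef_sum big1 // => ka _; rewrite mscoef_mulvarX; case: ifP => // _.
by apply: IH (ltnW di) _; rewrite divcmE cmXE; case: eqP => [e|]; rewrite ?subn0 //; lia.
Qed.

(** Only a last strip of exactly [m d] boxes contributes: a higher power of [x d] does not divide
    the monomial, and a lower one leaves a power of [x d] which the earlier variables cannot
    supply. *)
Lemma schur_poly_coef d (p : shape N) (m : {cmonom nat}) :
  (forall i, (d <= i)%N -> m i = 0%N) -> schur_poly d (@msvar R nat) p m = (strip_chains d m p)%:R.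
Proof.
elim: d p m => [|d IH] p m md /=.
  have -> : m = onecm nat by apply/eqP/cmP => i; rewrite md // onecmE.
  by case: eqP => _; rewrite ?mscoef0 ?mscoef1 ?eqxx.
rewrite mscoef_sum natr_sum [RHS]big_mkcondr; apply: eq_bigr => ka ska.
rewrite mscoef_mulvarX; have := strip_sz ska => ks.
have ne i : d <> i -> divcm m (cmX d (sz p - sz ka)) i = m i.
  by move=> di; rewrite divcmE cmXE; case: eqP => // _; rewrite subn0.
case: ltngtP => km.
- rewrite (@schur_poly_coef0 d ka _ d) //; last by rewrite divcmE cmXE eqxx mul1n; lia.
  by case: eqP => // e; move: km; rewrite e addKn ltnn.
- by case: eqP => // e; move: km; rewrite e addKn ltnn.
- rewrite IH => [|i]; last first.
    rewrite leq_eqVlt => /orP[/eqP<-|di]; first by rewrite divcmE cmXE eqxx mul1n km subnn.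
    by rewrite ne ?md //; lia.
  rewrite -km subnKC // eqxx.
  by congr (_%:R); apply: strip_chains_ext => e ed; rewrite ne //; lia.
Qed.

End SfunCoef.

End PartitionEnumeration.

(** * Words and their contents *)

Section WordContents.
Local Open Scope nat_scope.

Section Words.
Variables (m : nat) (B : finType).
Local Notation word := {ffun 'I_m -> B}.
Implicit Types (w : word) (s : 'S_m).

Definition wcount w (b : B) := #|[pred k | w k == b]|.
Definition wact w s : word := [ffun k => w (s k)].
Definition wcont w : {ffun B -> 'I_m.+1} := [ffun b => inord (wcount w b)].

Lemma wcount_le w b : wcount w b <= m.
Proof. by rewrite -[X in _ <= X]card_ord max_card. Qed.

Lemma wcontE w b : wcont w b = wcount w b :> nat.
Proof. by rewrite ffunE inordK // ltnS wcount_le. Qed.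

Lemma wcount_count w b : wcount w b = count (fun k => w k == b) (enum 'I_m).
Proof. by rewrite /wcount -sum1_card -sum1_count big_enum_cond; apply: eq_bigl. Qed.

Lemma sum_wcount w : \sum_b wcount w b = m.
Proof.
rewrite -[RHS]card_ord -sum1_card (partition_big w xpredT) //=.
by apply: eq_bigr => b _; rewrite sum1_card.
Qed.

Lemma wcount_act w s b : wcount (wact w s) b = wcount w b.
Proof.
rewrite /wcount -(fintype.card_image (@perm_inj _ s)); apply: fintype.eq_card => k; rewrite !inE.
apply/fintype.imageP/eqP => [[j]|wk]; first by rewrite inE ffunE => /eqP<- ->.
by exists ((s^-1)%g k); rewrite ?inE ?ffunE permKV ?wk.
Qed.

Lemma word_perm w w' : (forall b, wcount w b = wcount w' b) -> exists s, w' = wact w s.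
Proof.
move=> h; have /tuple_permP[s es] : perm_eq [tuple w' k | k < m] [tuple w k | k < m].
  apply/allP => b _; apply/eqP => /=.
  have cE (v : word) : count_mem b [tuple v k | k < m] = wcount v b.
    by rewrite [LHS]count_map wcount_count val_ord_tuple.
  by rewrite [LHS]cE [RHS]cE h.
exists s; apply/ffunP => k; rewrite ffunE.
have := congr1 (fun t => nth (w' k) t k) es.
by rewrite -!tnth_nth !tnth_mktuple.
Qed.

Lemma word_of_count (n : B -> nat) : \sum_b n b = m -> exists w, forall b, wcount w b = n b.
Proof.
move=> nm; pose t := flatten [seq nseq (n b) b | b <- enum B].
have st : size t == m.
  rewrite size_flatten sumnE /shape big_map big_map big_enum -[X in _ == X]nm.
  by apply/eqP/eq_bigr => b _; rewrite /= size_nseq.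
exists [ffun k => tnth (Tuple st) k] => b.
transitivity (count_mem b (Tuple st)).
  rewrite wcount_count -[in RHS](map_tnth_enum (Tuple st)) [RHS]count_map.
  by apply: eq_count => k; rewrite /= ffunE.
rewrite /= count_flatten sumnE big_map big_map.
rewrite (bigD1_seq b) ?mem_enum ?enum_uniq //= count_nseq /= eqxx mul1n.
by rewrite big1 ?addn0 // => c cb; rewrite count_nseq /= (negbTE cb).
Qed.

(** Exchanging the sums weights each word by the order of its stabiliser. A content class is a
    single orbit, so orbit and stabiliser multiply to m! and each content contributes [g n] that
    many times. *)
Lemma burnside_words (V : nmodType) (g : {ffun B -> 'I_m.+1} -> V) :
  (\sum_(s : 'S_m) \sum_(w : word | wact w s == w) g (wcont w) =
   (\sum_(n : {ffun B -> 'I_m.+1} | (\sum_b n b)%N == m) g n) *+ m`!)%R.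
Proof.
rewrite (exchange_big_dep xpredT) //=.
rewrite (partition_big wcont (fun n => \sum_b n b == m)) => [|w _]; last first.
  by apply/eqP; rewrite -[RHS](sum_wcount w); apply: eq_bigr => b _; rewrite wcontE.
rewrite -sumrMnl; apply: eq_bigr => n /eqP/word_of_count[w0 w0n].
have cw w : wcont w = n -> forall b, wcount w0 b = wcount w b.
  by move=> e b; rewrite w0n -e wcontE.
(* The stabiliser of [w] and the set of permutations taking [w0] to [w] differ by a translation. The
   latter sets, for varying [w], partition the whole group. *)
transitivity (\sum_(w | wcont w == n) g n *+ #|[pred s | wact w0 s == w]|)%R.
  apply: eq_bigr => w /eqP wn; rewrite wn.
  transitivity (g n *+ #|[pred s | wact w s == w]|)%R; first by rewrite sumr_const.
  congr (_ *+ _)%R; have [s0 ws0] := word_perm (cw _ wn).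
  rewrite -(fintype.card_image (mulIg s0)); apply: fintype.eq_card => s; rewrite [RHS]inE.
  apply/fintype.imageP/eqP => [[u]|e].
    rewrite inE => /eqP wu ->; rewrite -[RHS]wu [in RHS]ws0.
    by apply/ffunP => k; rewrite !ffunE permM.
  exists (s * s0^-1)%g; last by rewrite mulgKV.
  rewrite inE [X in wact X _]ws0; apply/eqP/ffunP => k; rewrite !ffunE permM permKV.
  by rewrite -e ffunE.
rewrite sumrMnr; congr (_ *+ _)%R.
rewrite -[RHS](card_Sn m) -sum1_card (partition_big (wact w0) (fun w => wcont w == n)) => [|s _].
  by apply: eq_bigr => w _; rewrite sum1_card; apply: fintype.eq_card => s; rewrite !inE.
by apply/eqP/ffunP => b; apply/val_inj; rewrite /= wcontE wcount_act w0n.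
Qed.
End Words.

End WordContents.

(** Both sides are the coefficient of X^j in prod_i sum_k y_i^k X^k. Truncating at k = M is harmless
    for j <= M and puts the exponents in one finite type for all j. *)
Lemma complete_polyE (R : comNzRingType) M d (y : nat -> R) j : (j <= M)%N ->
  complete_poly d y j = \sum_(v : {ffun 'I_d -> 'I_M.+1} | (\sum_i v i)%N == j)
                 \prod_(i < d) y i ^+ v i.
Proof.
pose P e : {poly R} := \prod_(i < e) \sum_(k < M.+1) y i ^+ k *: 'X^k.
have PE e i : (i <= M)%N -> (P e)`_i = complete_poly e y i.
  elim: e i => [|e IH] i iM; first by rewrite /P big_ord0 coef1.
  rewrite /P big_ord_recr -/(P e) /= coefMr; apply: eq_bigr => k _.
  have kM : (k < M.+1)%N by have := ltn_ord k; lia.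
  rewrite IH; last by lia.
  rewrite coef_sum (bigD1 (Ordinal kM)) //= coefZ coefXn eqxx mulr1 big1 ?addr0 //.
  by move=> l; rewrite -val_eqE /= coefZ coefXn eq_sym => /negbTE->; rewrite mulr0.
move=> jM; rewrite -PE // /P bigA_distr_bigA /= coef_sum [RHS]big_mkcond /=.
apply: eq_bigr => v _; rewrite scaler_prod coefZ.
rewrite -(big_morph (fun k => 'X^k : {poly R}) (exprD 'X) (expr0 'X)) coefXn eq_sym.
by case: eqP; rewrite ?mulr1 ?mulr0.
Qed.

Section Characters.
Variables (m E : nat).
(** The permutation character h_mu on words of content [mu]. *)
Definition fixed_words (mu : nat -> nat) (s : 'S_m) : nat :=
  #|[pred w : {ffun 'I_m -> 'I_E} | [forall e, wcount w e == mu e] && (wact w s == w)]|.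

Lemma fixed_wordsV mu s : fixed_words mu (s^-1)%g = fixed_words mu s.
Proof.
apply: fintype.eq_card => w; rewrite !inE; congr (_ && _).
by apply/eqP/eqP => /ffunP h; apply/ffunP => k; [have := h (s k)|have := h ((s^-1)%g k)];
  rewrite !ffunE ?permK ?permKV.
Qed.

Variables (R : comNzRingType) (d : nat).
(** A word is fixed by s exactly when it is constant on the cycles of s, so this is the power sum of
    the cycle type of s. It is also the trace of A^{(x)m} s when A has eigenvalues y. *)
Definition power_char (y : 'I_d -> R) (s : 'S_m) : R :=
  \sum_(f : {ffun 'I_m -> 'I_d} | wact f s == f) \prod_k y (f k).

Lemma prod_wcount (B : finType) (f : {ffun 'I_m -> B}) (y : B -> R) :
  \prod_k y (f k) = \prod_b y b ^+ wcount f b.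
Proof.
rewrite (partition_big f xpredT) //=; apply: eq_bigr => b _.
by rewrite (eq_bigr (fun=> y b)) => [|k /eqP->//]; rewrite prodr_const.
Qed.

(** A pair of fixed words is one fixed word in the alphabet of pairs, so [burnside_words] applies
    there. Contents of such words are matrices, [g] imposes the row sums [mu], and summing over each
    row separately yields h_{mu_e}. *)
Lemma sum_fixed_words_power_char (mu : nat -> nat) (y : nat -> R) : (\sum_(e < E) mu e)%N = m ->
  \sum_(s : 'S_m) (fixed_words mu s)%:R * power_char (fun i => y i) s =
  (\prod_(e < E) complete_poly d y (mu e)) *+ m`!.
Proof.
move=> mum.
pose g (n : {ffun 'I_E * 'I_d -> 'I_m.+1}) : R :=
  if [forall e, (\sum_j n (e, j))%N == mu e] then \prod_(b : 'I_E * 'I_d) y b.2 ^+ n b else 0.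
transitivity (\sum_(s : 'S_m) \sum_(b : {ffun 'I_m -> 'I_E * 'I_d} | wact b s == b) g (wcont b)).
  apply: eq_bigr => s _; rewrite /fixed_words -sum1_card natr_sum mulr_suml.
  under eq_bigr do rewrite mul1r.
  rewrite pair_big_dep /=.
  rewrite (reindex (fun b : {ffun 'I_m -> 'I_E * 'I_d} =>
     ([ffun k => (b k).1], [ffun k => (b k).2]))) /=; last first.
    exists (fun p : {ffun 'I_m -> 'I_E} * {ffun 'I_m -> 'I_d} => [ffun k => (p.1 k, p.2 k)]).
      by move=> b _; apply/ffunP => k; rewrite !ffunE -surjective_pairing.
    by move=> [w f] _; congr (_, _); apply/ffunP => k; rewrite !ffunE.
  rewrite big_mkcond [RHS]big_mkcond /=; apply: eq_bigr => b _.
  have cE e : (\sum_j wcont b (e, j))%N = wcount [ffun k => (b k).1] e.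
    rewrite /wcount -sum1_card (partition_big (fun k => (b k).2) xpredT) //=.
    apply: eq_bigr => j _; rewrite wcontE /wcount -sum1_card; apply: eq_bigl => k.
    by rewrite !inE ffunE -pair_eqE.
  have -> : g (wcont b) = if [forall e, wcount [ffun k => (b k).1] e == mu e]
      then \prod_k y ([ffun k => (b k).2] k) else 0.
    rewrite /g (@eq_forallb 'I_E _ _ (fun e : 'I_E => congr1 (eq_op^~ (mu e)) (cE e))); case: ifP => // _.
    rewrite (eq_bigr (fun k => y (b k).2)) => [|k _]; last by rewrite ffunE.
    rewrite (@prod_wcount _ b (fun c => y c.2)).
    by apply: eq_bigr => c _; rewrite wcontE.
  have -> : (wact b s == b) = (wact [ffun k => (b k).1] s == [ffun k => (b k).1])
       && (wact [ffun k => (b k).2] s == [ffun k => (b k).2]).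
    apply/eqP/andP => [e|[/eqP/ffunP e1 /eqP/ffunP e2]].
      by split; apply/eqP/ffunP => k; rewrite !ffunE -{2}e ffunE.
    apply/ffunP => k; have := e1 k; have := e2 k; rewrite !ffunE.
    by case: (b (s k)) (b k) => [? ?] [? ?] /= -> ->.
  rewrite !inE; case: [forall e, _] => //=; last by case: ifP.
rewrite burnside_words; congr (_ *+ _).
transitivity (\prod_(e < E) \sum_(v : {ffun 'I_d -> 'I_m.+1} | (\sum_i v i)%N == mu e)
                 \prod_(i < d) y i ^+ v i); last first.
  apply: eq_bigr => e _; rewrite (@complete_polyE _ m) //.
  by rewrite -mum (bigD1 e) //= leq_addr.
rewrite bigA_distr_big_dep /=.
rewrite (reindex (fun n : {ffun 'I_E * 'I_d -> 'I_m.+1} => [ffun e => [ffun i => n (e, i)]])) /=; last first.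
  exists (fun F : {ffun 'I_E -> {ffun 'I_d -> 'I_m.+1}} => [ffun b => F b.1 b.2]).
    by move=> n _; apply/ffunP => -[e i]; rewrite !ffunE.
  by move=> F _; apply/ffunP => e; apply/ffunP => i; rewrite !ffunE.
rewrite big_mkcond [RHS]big_mkcond /=; apply: eq_bigr => n _; rewrite /g.
have -> : ([ffun e => [ffun i => n (e, i)]] \in
     family (fun e : 'I_E => [pred v : {ffun 'I_d -> 'I_m.+1} | (\sum_i v i)%N == mu e])) =
   [forall e, (\sum_j n (e, j))%N == mu e].
  apply: eq_forallb => e; rewrite inE ffunE; congr (_ == _).
  by apply: eq_bigr => i _; rewrite ffunE.
case: forallP => [h|_]; last by rewrite if_same.
rewrite ifT.
  rewrite (eq_bigr (fun b : 'I_E * 'I_d => y b.2 ^+ n (b.1, b.2))) => [|[]//].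
  rewrite -(pair_big xpredT xpredT (fun (e : 'I_E) (j : 'I_d) => y j ^+ n (e, j))) /=.
  by apply: eq_bigr => e _; apply: eq_bigr => i _; rewrite !ffunE.
rewrite (eq_bigr (fun b : 'I_E * 'I_d => n (b.1, b.2) : nat)) => [|[]//].
rewrite -[X in _ == X]mum -(pair_big xpredT xpredT (fun (e : 'I_E) (j : 'I_d) => n (e, j) : nat)) /=.
by apply/eqP/eq_bigr => e _; apply/eqP.
Qed.
End Characters.

(** * Characters of the symmetric group *)

Section Gram.
Variables (R : comNzRingType) (m E d : nat).

Definition cm_of (I : choiceType) (s : seq I) : {cmonom I} :=
  \big[@mulcm I / onecm I]_(i <- s) ucm i.

Lemma cm_ofE (I : choiceType) (s : seq I) i : cm_of s i = count_mem i s.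
Proof.
elim: s => [|j s IH]; first by rewrite /cm_of big_nil onecmE.
by rewrite /cm_of big_cons mulcmE -/(cm_of s) IH ucmE.
Qed.

Lemma prod_msvar (I : choiceType) (s : seq I) :
  \prod_(i <- s) msvar R i = msmono R (cm_of s).
Proof.
elim: s => [|i s IH].
  by rewrite /cm_of !big_nil; apply: mseriesP => a; rewrite mscoef1.
by rewrite /cm_of !big_cons IH -msmonoM.
Qed.

Lemma power_char_coef (nu : {cmonom nat}) (s : 'S_m) : (forall i, (d <= i)%N -> nu i = 0%N) ->
  power_char (fun i : 'I_d => msvar R (i : nat)) s nu = (fixed_words d nu s)%:R.
Proof.
move=> nud; rewrite /power_char mscoef_sum /fixed_words -sum1_card natr_sum big_mkcond [RHS]big_mkcond.
apply: eq_bigr => f _; rewrite inE andbC; case: ifP => //= _.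
have -> : \prod_k msvar R (f k : nat) = msmono R (cm_of [seq (f k : nat) | k <- enum 'I_m]).
  by rewrite -prod_msvar big_map big_enum.
rewrite mscoef_mono.
have cE (e : 'I_d) : wcount f e = cm_of [seq (f k : nat) | k <- enum 'I_m] e.
  by rewrite cm_ofE count_map wcount_count.
suff -> : (nu == cm_of [seq (f k : nat) | k <- enum 'I_m]) =
    [forall e, wcount f e == nu e] by case: ifP.
apply/eqP/forallP => [-> e|h]; first by rewrite cE.
apply/eqP/cmP => i; have [id|di] := ltnP i d.
  by have /eqP <- := h (Ordinal id); rewrite cE.
rewrite nud // cm_ofE count_map; apply/esym/eqP; rewrite -leqn0 leqNgt -has_count.
by apply/hasPn => k _ /=; apply: contraL di => /eqP <-; rewrite -ltnNge.
Qed.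

(** Take the y of [sum_fixed_words_power_char] to be formal variables and compare the coefficients
    of x^nu. The power sums give the words of content [nu], while Cauchy's identity gives the
    products of Kostka numbers. *)
Lemma fixed_words_gram (mu nu : nat -> nat) :
  (\sum_(e < E) mu e)%N = m -> (\sum_(e < d) nu e)%N = m ->
  \sum_(s : 'S_m) (fixed_words E mu s)%:R * (fixed_words d nu s)%:R =
  m`!%:R * \sum_(la <- parts m) (kostka_num m E mu la)%:R * (kostka_num m d nu la)%:R :> R.
Proof.
move=> mum num.
(* [nu] is an arbitrary function; its truncation below d is the monomial whose coefficient is
   read. *)
pose nu' : {cmonom nat} := cm_of (flatten [seq nseq (nu e) e | e <- iota 0 d]).
have nuE i : nu' i = if (i < d)%N then nu i else 0%N.
  rewrite cm_ofE count_flatten sumnE !big_map.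
  rewrite (eq_bigr (fun e => (e == i) * nu e)%N) => [|e _]; last first.
    by rewrite count_nseq /=.
  case: ltnP => id.
    rewrite (bigD1_seq i) ?iota_uniq ?mem_iota //= eqxx mul1n big1 ?addn0 // => e.
    by move=> /negbTE->.
  rewrite big_seq big1 // => e; rewrite mem_iota => /andP[_ ed].
  by case: eqP ed => // ->; rewrite add0n ltnNge id.
have nu0 i : (d <= i)%N -> nu' i = 0%N by rewrite nuE ltnNge => ->.
have e0 := sum_fixed_words_power_char d (@msvar R nat) mum.
rewrite (cauchy_parts d _ mum) in e0.
have := congr1 (fun f : mseries R nat => f nu') e0.
rewrite mscoefMn !mscoef_sum => e.
transitivity (\sum_(s : 'S_m) ((fixed_words E mu s)%:R * power_char (fun i : 'I_d => msvar R (i : nat)) s : mseries R nat) nu').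
  apply: eq_bigr => s _; rewrite [in RHS]mulr_natl mscoefMn power_char_coef // -[RHS]mulr_natl.
  congr (_ * _%:R); apply: fintype.eq_card => w; rewrite !inE; congr (_ && _).
  by apply: eq_forallb => i; rewrite nuE ltn_ord.
rewrite e -[LHS]mulr_natl; congr (_ * _); apply: eq_bigr => la _.
rewrite [in LHS]mulr_natl mscoefMn schur_poly_coef // -[LHS]mulr_natl; congr (_ * _%:R).
by apply: strip_chains_ext => i id; rewrite nuE id.
Qed.
End Gram.

(** * Spaces of intertwiners through averaging *)

Section HomTrace.
Variables (F : numFieldType) (gT : finGroupType) (G : {group gT}) (n1 n2 : nat).
Variables (rho1 : mx_representation F G n1) (rho2 : mx_representation F G n2).
Variable (D : 'M[F]_n2).
Hypothesis DC : forall g, g \in G -> D *m rho2 g = rho2 g *m D.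

(** Intertwiners into the submodule of [rho2] that is the image of [D]. Keeping [D] as a matrix
    avoids building this submodule as a representation. *)
Definition hom_mx (X : 'M[F]_(n1, n2)) : Prop :=
  (forall g, g \in G -> rho1 g *m X = X *m rho2 g) /\ X *m D = X.

Definition hom_proj (X : 'M[F]_(n1, n2)) : 'M[F]_(n1, n2) :=
  #|G|%:R^-1 *: \sum_(g in G) rho1 g^-1%g *m X *m (D *m rho2 g).

Lemma cardG_neq0 : #|G|%:R != 0 :> F.
Proof. by rewrite pnatr_eq0 -lt0n cardG_gt0. Qed.

Hypothesis DD : D *m D = D.

Lemma hom_projP X : hom_mx (hom_proj X).
Proof.
split=> [h Gh|].
  rewrite /hom_proj -scalemxAr -scalemxAl; congr (_ *: _).
  rewrite mulmx_sumr mulmx_suml (reindex_inj (mulIg h)) /=.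
  rewrite (eq_bigl (mem G)) => [|g]; last by rewrite groupMr.
  apply: eq_bigr => g Gg; rewrite invMg !repr_mxM ?groupV //.
  by rewrite !mulmxA -repr_mxM ?groupV // mulgV repr_mx1 mul1mx.
rewrite /hom_proj -scalemxAl; congr (_ *: _); rewrite mulmx_suml.
by apply: eq_bigr => g Gg; rewrite -!mulmxA -DC // (mulmxA D D) DD.
Qed.

Lemma hom_proj_id X : hom_mx X -> hom_proj X = X.
Proof.
case=> hX XD; rewrite /hom_proj (eq_bigr (fun=> X)) => [|g Gg].
  by rewrite sumr_const -scaler_nat scalerA mulVf ?scale1r // cardG_neq0.
by rewrite hX ?groupV // -!mulmxA (mulmxA (rho2 _) D) -DC ?groupV // -mulmxA -repr_mxM ?groupV // mulVg repr_mx1 mulmx1.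
Qed.

(** By [hom_ipE] this is the trace of [hom_proj], the averaging projector onto the intertwiners,
    hence the dimension of their space. *)
Definition hom_ip : F := #|G|%:R^-1 * \sum_(g in G) \tr (rho1 g^-1%g) * \tr (D *m rho2 g).

Lemma hom_ipE : hom_ip = \sum_i \sum_j hom_proj (delta_mx i j) i j.
Proof.
have tE g (i : 'I_n1) (j : 'I_n2) :
    (rho1 g^-1%g *m delta_mx i j *m (D *m rho2 g)) i j = rho1 g^-1%g i i * (D *m rho2 g) j j.
  rewrite !mxE (bigD1 j) //= big1 => [|k kj].
    rewrite !mxE (bigD1 i) //= big1 => [|k ki]; last by rewrite !mxE (negbTE ki) mulr0.
    by rewrite !mxE !eqxx mulr1 !addr0.
  rewrite !mxE big1 ?mul0r // => l _; rewrite !mxE (negbTE kj) andbF mulr0 //.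
transitivity (\sum_i \sum_j #|G|%:R^-1 * \sum_(g in G) rho1 g^-1%g i i * (D *m rho2 g) j j).
  rewrite /hom_ip; under [RHS]eq_bigr do rewrite -mulr_sumr.
  rewrite -mulr_sumr; congr (_ * _); under [RHS]eq_bigr do rewrite exchange_big.
  rewrite exchange_big; apply: eq_bigr => g _; rewrite mulr_suml.
  by apply: eq_bigr => i _; rewrite mulr_sumr.
apply: eq_bigr => i _; apply: eq_bigr => j _; rewrite mxE summxE; congr (_ * _).
by apply: eq_bigr => g _; rewrite tE.
Qed.

Lemma hom_projD X Y : hom_proj (X + Y) = hom_proj X + hom_proj Y.
Proof.
rewrite /hom_proj -scalerDr -big_split; congr (_ *: _); apply: eq_bigr => g _.
by rewrite mulmxDr mulmxDl.
Qed.

Lemma hom_projZ a X : hom_proj (a *: X) = a *: hom_proj X.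
Proof.
rewrite /hom_proj scalerA mulrC -scalerA; congr (_ *: _); rewrite scaler_sumr.
by apply: eq_bigr => g _; rewrite -scalemxAr -scalemxAl.
Qed.

Lemma hom_ip_eq0 : (forall X, hom_mx X -> X = 0) -> hom_ip = 0.
Proof.
move=> h; rewrite hom_ipE big1 // => i _; rewrite big1 // => j _.
by rewrite (h _ (hom_projP _)) mxE.
Qed.

(** On a line the projector is X |-> c(X) X0 with c linear, so its trace is c(X0), which is 1
    because X0 is fixed. *)
Lemma hom_ip_eq1 X0 : hom_mx X0 -> X0 != 0 ->
  (forall X, hom_mx X -> exists c, X = c *: X0) -> hom_ip = 1.
Proof.
move=> hX0 /eqP X0n h.
have [[a b] ab] : exists ab : 'I_n1 * 'I_n2, X0 ab.1 ab.2 != 0.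
  apply/existsP; apply: contra_notT X0n => /existsPn h0; apply/matrixP => i j.
  by have := h0 (i, j); rewrite negbK mxE => /eqP.
pose c X := hom_proj X a b / X0 a b.
have cE X : hom_proj X = c X *: X0.
  have [k kE] := h _ (hom_projP X); rewrite /c kE mxE mulfK //.
rewrite hom_ipE.
have proj0 : hom_proj 0 = 0 by rewrite -(scale0r X0) hom_projZ !scale0r.
transitivity (c (\sum_i \sum_j X0 i j *: delta_mx i j)); last first.
  by rewrite -matrix_sum_delta /c hom_proj_id // mulfV.
rewrite /c (big_morph hom_proj hom_projD proj0) summxE mulr_suml; apply: eq_bigr => i _.
rewrite (big_morph hom_proj hom_projD proj0) summxE mulr_suml; apply: eq_bigr => j _.
by rewrite hom_projZ cE !mxE mulrA mulfK // mulrC.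
Qed.

End HomTrace.

Section ContentProjection.
Variables (F : fieldType) (m d : nat).
Implicit Types (mu : nat -> nat).

(** The coordinate idempotent whose image is the permutation module on words of content [mu], inside
    the tensor power. *)
Definition cont_mx mu : 'M[F]_(tpow_dim m d) :=
  diag_mx (\row_a ([forall e, wcount (tpow_val a) e == mu e])%:R).

Lemma mulmx_cont n mu (X : 'M[F]_(n, tpow_dim m d)) a b :
  (X *m cont_mx mu) a b = if [forall e, wcount (tpow_val b) e == mu e] then X a b else 0.
Proof. by rewrite mul_mx_diag !mxE; case: ifP; rewrite ?mulr1 ?mulr0. Qed.

Lemma cont_mx_idem mu : cont_mx mu *m cont_mx mu = cont_mx mu.
Proof.
apply/matrixP => a b; rewrite mulmx_cont; case: ifP => // h.
by rewrite !mxE; case: eqP => // ->; rewrite h.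
Qed.

Lemma place_mxE (s : 'S_m) (a b : 'I_(tpow_dim m d)) :
  place_mx F d s a b = (tpow_val a == wact (tpow_val b) s)%:R.
Proof.
rewrite mxE; congr (nat_of_bool _)%:R; apply/eqP/eqP => ->; apply/ffunP => k.
  by rewrite !ffunE permK.
by rewrite !ffunE permKV.
Qed.

Lemma cont_mx_place mu s : cont_mx mu *m place_mx F d s = place_mx F d s *m cont_mx mu.
Proof.
apply/matrixP => a b; rewrite mulmx_cont mul_diag_mx mxE mxE place_mxE.
case: eqP => [->|_]; last by rewrite mulr0 if_same.
rewrite (@eq_forallb 'I_d _ _ (fun e : 'I_d => congr1 (eq_op^~ (mu e)) (wcount_act _ s e))).
by case: ifP; rewrite ?mulr1.
Qed.

Lemma mxtrace_cont_place mu s : \tr (cont_mx mu *m place_mx F d s) = (fixed_words d mu s)%:R.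
Proof.
rewrite /mxtrace /fixed_words -sum1_card natr_sum [RHS]big_mkcond [RHS](reindex (@tpow_val m d)) /=; last first.
  by exists (@tpow_rank m d) => x _; rewrite ?tpow_valK ?tpow_rankK.
apply: eq_bigr => a _; rewrite mul_diag_mx mxE mxE place_mxE inE eq_sym.
by case: [forall e, _]; case: (_ == _); rewrite /= ?mulr1 ?mulr0 ?mul0r.
Qed.

Lemma row_place (y : 'rV[F]_(tpow_dim m d)) s (f : {ffun 'I_m -> 'I_d}) :
  (y *m place_mx F d s) 0 (tpow_rank f) = y 0 (tpow_rank (wact f s)).
Proof.
rewrite mxE (bigD1 (tpow_rank (wact f s))) //= place_mxE !tpow_rankK eqxx mulr1.
rewrite big1 ?addr0 // => a an; rewrite place_mxE tpow_rankK.
by case: eqP => [e|]; rewrite ?mulr0 //; case/eqP: an; rewrite -e tpow_valK.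
Qed.
End ContentProjection.

(** * Polytabloids and their contents *)

Section SpechtGenerator.
Variables (F : numFieldType) (la : intpart).

(* Transport along E, as the type ['S_(sumn la)] depends on la. *)
Definition specht_at m (E : sumn la = m) :
    mx_representation F [set: 'S_m] (\rank (specht_mx F la)) :=
  match E in _ = m' return mx_representation F [set: 'S_m'] (\rank (specht_mx F la)) with
  | erefl => specht_repr F la end.

Lemma card_cell : #|{: cell la}| = sumn la.
Proof.
rewrite card_tagged sumnE big_map big_enum /= (sumn_sum_nth (leqnn _)).
by apply: eq_bigr => i _; rewrite card_ord.
Qed.

Lemma card_row_cells (e : nat) : #|[pred c : cell la | crow c == e :> nat]| = nth 0%N la e.
Proof.
have [es|se] := ltnP e (size la); last first.
  rewrite nth_default //; apply: fintype.eq_card0 => c; rewrite inE.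
  by apply/negbTE; rewrite neq_ltn (leq_trans (ltn_ord _) se).
pose c_ (j : 'I_(nth 0%N la e)) : cell la := existT _ (Ordinal es) j.
rewrite -[RHS]card_ord -(fintype.card_image (f := c_)).
  apply: fintype.eq_card => c; rewrite [LHS]inE; apply/eqP/fintype.imageP => [cr|[j' _ ->] //].
  exists (cast_ord (congr1 (fun i => nth 0%N la i) cr) (tagged c)) => //.
  by apply: cell_inj => //; apply/val_inj.
by move=> j j' e'; apply/val_inj; apply: (congr1 (@ccol la) e').
Qed.

Lemma card_row m (t : 'I_m -> cell la) (e : nat) : bijective t ->
  #|[pred k | crow (t k) == e :> nat]| = nth 0%N la e.
Proof.
move=> [g gK Kg]; rewrite -card_row_cells -(fintype.card_image (can_inj gK)).
apply: fintype.eq_card => c; rewrite [RHS]inE; apply/fintype.imageP/eqP => [[k]|ce].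
  by rewrite inE => /eqP <- ->.
by exists (g c); rewrite ?inE ?Kg //; apply/eqP.
Qed.

Local Notation m := (sumn la).

(** A column permutation s preserves the column stabiliser of [t], and translating the signed sum by
    s costs the sign of s. *)
Lemma polytabloid_sign (t : {ffun 'I_m -> cell la}) s : s \in col_stab t ->
  polytabloid F t *m place_mx F _ s = (-1) ^+ odd_perm s *: polytabloid F t.
Proof.
move=> st; rewrite polytabloidJ /polytabloid scaler_sumr.
have stE k : ccol (t (s k)) = ccol (t k) by move: st; rewrite inE => /forallP/(_ k)/eqP.
have stVE k : ccol (t ((s^-1)%g k)) = ccol (t k) by rewrite -[in RHS](permKV s k) stE.
have memE u : (u \in col_stab (tab_act s t)) = (u \in col_stab t).
  by rewrite !inE; apply: eq_forallb => k; rewrite !ffunE !stVE.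
rewrite [RHS](reindex_inj (mulgI s)) /=; apply: eq_big => u.
  rewrite memE !inE; apply/forallP/forallP => h k.
    by have := h (s k); rewrite permM stE.
  by have := h ((s^-1)%g k); rewrite permM permKV stVE.
move=> _; rewrite scalerA odd_permM signr_addb mulrA -expr2 sqrr_sign mul1r.
by rewrite tab_actM.
Qed.

(** The tabloid of [t] itself has coefficient 1: a permutation preserving both the row and the
    column of every entry is the identity. *)
Lemma polytabloid_neq0 (t : {ffun 'I_m -> cell la}) : injective t -> polytabloid F t != 0.
Proof.
move=> ti; apply/eqP => /rowP /(_ (tpow_rank (tabloid t))).
rewrite summxE mxE (bigD1 1%g) /=; last by rewrite inE; apply/forallP => k; rewrite perm1.
rewrite !mxE odd_perm1 expr0 mul1r big1 ?addr0 => [|s /andP[st s1]].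
  rewrite eqxx /= (_ : tab_act 1%g t = t) ?eqxx; first by move/eqP; rewrite oner_eq0.
  by apply/ffunP => k; rewrite ffunE invg1 perm1.
rewrite !mxE eqxx /=; case: eqP => [e|_]; last by rewrite mulr0.
case/eqP: s1; rewrite -[s]invgK; apply/eqP; rewrite eq_invg1; apply/eqP/permP => k.
rewrite perm1; apply: ti; apply: cell_inj.
  by have /ffunP/(_ k) := can_inj (@tpow_rankK _ _) e; rewrite !ffunE.
by move: st; rewrite inE => /forallP /(_ ((s^-1)%g k)); rewrite permKV => /eqP.
Qed.

(** Read as a word, a tabloid contains the letter r once for each box of row r. Hence the Specht
    module of [la] sits among the words of content [la]. *)
Lemma polytabloid_cont (t : {ffun 'I_m -> cell la}) : injective t ->
  polytabloid F t *m cont_mx F m (size la) (nth 0%N la) = polytabloid F t.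
Proof.
move=> ti; rewrite /polytabloid mulmx_suml; apply: eq_bigr => s _.
rewrite -scalemxAl; congr (_ *: _); apply/rowP => b; rewrite mulmx_cont.
case: ifP => // /negbT bc; rewrite !mxE eqxx /=; case: eqP => // e; case/negP: bc.
apply/forallP => r; rewrite e tpow_rankK.
have ta_inj : injective (tab_act s t).
  by move=> i j; rewrite !ffunE => /ti; apply: perm_inj.
have ta_bij : bijective (tab_act s t) by apply: inj_card_bij; rewrite // card_cell card_ord.
rewrite -(card_row r ta_bij); apply/eqP/fintype.eq_card => k.
by rewrite !inE -val_eqE ffunE.
Qed.
End SpechtGenerator.

(** * Words with distinct letters in each column *)

Section ColumnSorting.
Local Open Scope nat_scope.

(** The largest of n.+1 distinct numbers is at least n; removing it gives the induction. In the
    equality case it is n exactly. *)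
Lemma sumn_uniq (s : seq nat) : uniq s ->
  sumn (iota 0 (size s)) <= sumn s /\
  (sumn s = sumn (iota 0 (size s)) -> all (fun x => x < size s) s).
Proof.
move En: (size s) => n; elim: n s En => [|n IH] s sn us; first by case: s sn us.
have [x0 x0s] : exists x, x \in s by case: s sn {us} => // x s _; exists x; rewrite mem_head.
have bnd : exists n, forall x, x \in s -> x <= n.
  by exists (sumn s) => x /(nthP 0)[i _ <-]; apply: nth_le_sumn.
have [b bP] := bnd.
have exs : exists x, x \in s by exists x0.
case: (ex_maxnP exs bP) => M Ms Mmax.
have nM : n <= M.
  rewrite -ltnS -sn -(size_iota 0 M.+1); apply: uniq_leq_size => // x /Mmax.
  by rewrite mem_iota.
have sr : size (rem M s) = n by rewrite size_rem // sn.
have [le eq] := IH _ sr (rem_uniq M us).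
have -> : sumn s = M + sumn (rem M s) by rewrite (perm_sumn (perm_to_rem Ms)).
rewrite -addn1 iotaD /= add0n sumn_cat /= addn0; split=> [|e]; first by rewrite addnC leq_add.
have eM : M = n by lia.
rewrite (perm_all _ (perm_to_rem Ms)) /= eM addn1 ltnSn /=.
have : all (fun x => x < n) (rem M s) by apply: eq; lia.
by rewrite eM; apply: sub_all => x; apply: ltnW.
Qed.

Lemma sumn_uniq_lt (s : seq nat) : uniq s -> all (fun x => x < size s) s ->
  sumn s = sumn (iota 0 (size s)).
Proof.
move=> us /allP sl; apply/perm_sumn/uniq_perm => //; first exact: iota_uniq.
apply: (uniq_min_size us _ _).2; last by rewrite size_iota.
by move=> x /sl; rewrite mem_iota.
Qed.

Section Columns.
Variable la : intpart.

Lemma card_column (c : cell la) (r : nat) :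
  (r < #|[pred x : cell la | ccol x == ccol c]|) = (ccol c < nth 0 la r).
Proof.
have cri : {in [pred x : cell la | ccol x == ccol c] &, injective (@crow la)}.
  by move=> x y; rewrite !inE => /eqP xc /eqP yc e; apply: cell_inj; rewrite ?xc.
rewrite -(fintype.card_in_image cri).
have e : fintype.image (@crow la) [pred x : cell la | ccol x == ccol c] =i [pred i : 'I_(size la) | ccol c < nth 0 la i].
  move=> i; rewrite !inE; apply/fintype.imageP/idP => [[x]|lt].
    by rewrite inE => /eqP<- ->; apply: ccol_lt.
  by have [x [xi xc]] := cell_at lt; exists x; rewrite ?inE ?xc //; apply/val_inj.
rewrite (fintype.eq_card e); have [rs|sr] := ltnP r (size la).
  rewrite -[r]/(nat_of_ord (Ordinal rs)) -card_downset ?inE // => i j ij; rewrite !inE => /leq_trans; apply.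
  by rewrite -(subnK ij); elim: (j - i) => // k; apply: leq_trans; apply: part_nth_decr.
rewrite nth_default // ltn0 ltnNge (leq_trans _ sr) //.
by rewrite -[X in _ <= X](card_ord (size la)) max_card.
Qed.

(** The row indices of a column of length l are 0, ..., l-1, which minimise the sum of l distinct
    numbers by [sumn_uniq]. Equality of the totals forces equality in every column. *)
Lemma column_inj_sum (T : cell la -> nat) :
  (forall x y, ccol x = ccol y -> T x = T y -> x = y) ->
  \sum_(c : cell la) nat_of_ord (crow c) <= \sum_c T c /\
  (\sum_c T c = \sum_(c : cell la) nat_of_ord (crow c) -> forall c, ccol c < nth 0 la (T c)).
Proof.
move=> Ti; pose h := nth 0 la 0.
have hP (c : cell la) : ccol c < h.
  apply: leq_trans (ccol_lt c) _; rewrite /h; elim: (nat_of_ord (crow c)) => // k.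
  by apply: leq_trans; apply: part_nth_decr.
pose col c : 'I_h := Ordinal (hP c).
have colE c c' : (col c == col c') = (ccol c == ccol c') by [].
have E (f : cell la -> nat) : \sum_c f c = \sum_(j < h) sumn [seq f c | c <- enum [pred c | col c == j]].
  rewrite (partition_big col xpredT) //=; apply: eq_bigr => j _.
  by rewrite sumnE big_map big_enum.
have colP (f : cell la -> nat) (j : 'I_h) : (forall x y, ccol x = ccol y -> f x = f y -> x = y) ->
   uniq [seq f c | c <- enum [pred c | col c == j]].
  move=> fi; rewrite map_inj_in_uniq ?enum_uniq // => x y.
  by rewrite !mem_enum !inE => /eqP xj /eqP yj; apply: fi; rewrite -[LHS]/(val (col x)) xj -yj.
have colS (f : cell la -> nat) (j : 'I_h) (c : cell la) : col c = j ->
    size [seq f c | c <- enum [pred c | col c == j]] = #|[pred x : cell la | ccol x == ccol c]|.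
  by move=> cj; rewrite size_map -cardE; apply: fintype.eq_card => x; rewrite !inE -cj.
have crowE (j : 'I_h) : let s := [seq nat_of_ord (crow c) | c <- enum [pred c | col c == j]] in
    sumn s = sumn (iota 0 (size s)).
  apply: sumn_uniq_lt.
    by apply: colP => x y e /val_inj e'; apply: cell_inj.
  apply/allP => r /mapP[c]; rewrite mem_enum inE => /eqP cj ->.
  by rewrite (colS _ _ _ cj) card_column ccol_lt.
have szE (f g : cell la -> nat) (j : 'I_h) : size [seq f c | c <- enum [pred c | col c == j]] =
    size [seq g c | c <- enum [pred c | col c == j]] by rewrite !size_map.
have le j : sumn [seq nat_of_ord (crow c) | c <- enum [pred c | col c == j]] <=
    sumn [seq T c | c <- enum [pred c | col c == j]].
  rewrite crowE (szE _ T); exact: (sumn_uniq (colP T j Ti)).1.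
rewrite !E; split=> [|e c]; first by apply: leq_sum => j _.
have ej : sumn [seq T x | x <- enum [pred x | col x == col c]] =
          sumn [seq nat_of_ord (crow x) | x <- enum [pred x | col x == col c]].
  apply/eqP; rewrite eq_sym; move: e => /eqP; rewrite eq_sym.
  rewrite (leqif_sum (fun j _ => leqif_eq (le j))).
  by move=> /forallP/(_ (col c)).
have e1 : sumn [seq T x | x <- enum [pred x | col x == col c]] =
    sumn (iota 0 (size [seq T x | x <- enum [pred x | col x == col c]])).
  by rewrite ej crowE (szE _ T).
have /allP/(_ (T c)) := (sumn_uniq (colP T (col c) Ti)).2 e1.
rewrite -card_column (colS _ _ c) //; apply.
by apply: map_f; rewrite mem_enum inE.
Qed.

(** Among words with distinct letters in each column of [t], those of least letter sum are the
    rearrangements within columns of the word of row indices. This is the combinatorial fact behind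
    both the vanishing and the uniqueness of intertwiners. *)
Lemma column_sort m (t : 'I_m -> cell la) (f : 'I_m -> nat) : bijective t ->
  (forall k k', ccol (t k) = ccol (t k') -> f k = f k' -> k = k') ->
  \sum_k nat_of_ord (crow (t k)) <= \sum_k f k /\
  (\sum_k f k = \sum_k nat_of_ord (crow (t k)) ->
   exists s : 'S_m, forall k, ccol (t (s k)) = ccol (t k) /\ crow (t (s k)) = f k :> nat).
Proof.
move=> [u tK uK] fi; have := @column_inj_sum (f \o u) _.
have ti := can_inj tK.
have E (g : cell la -> nat) : \sum_c g c = \sum_k g (t k).
  by rewrite (reindex t) //; exists u => x _.
have Ef : \sum_c (f \o u) c = \sum_k f k by rewrite E; apply: eq_bigr => k _; rewrite /= tK.
rewrite Ef E.
case=> [x y xy /= fu|le eq]; first by rewrite -[x]uK -[y]uK; congr t; apply: fi; rewrite ?uK.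
split=> // e; have lt := eq e.
have /fin_all_exists[phi phiP] : forall k, exists x : cell la, crow x = f k :> nat /\ ccol x = ccol (t k).
  by move=> k; apply: cell_at; have := lt (t k); rewrite /= tK.
have phi_inj : injective (u \o phi).
  move=> k k' /= /(can_inj uK) e'; have [r1 c1] := phiP k; have [r2 c2] := phiP k'.
  by apply: fi; rewrite -?c1 -?c2 ?e' // -r1 -r2 e'.
by exists (perm phi_inj) => k; rewrite permE /= uK; have [-> ->] := phiP k.
Qed.

Lemma sum_crow m : sumn la = m -> \sum_(c : cell la) nat_of_ord (crow c) = wpart m la.
Proof.
move=> lm; rewrite /wpart.
rewrite (partition_big (@crow la) xpredT) //=.
rewrite (eq_bigr (fun i : 'I__ => i * nth 0 la i)) => [|i _]; last first.
  rewrite (eq_bigr (fun=> nat_of_ord i)) => [|c /eqP-> //]; rewrite sum_nat_const mulnC; congr (_ * _).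
  by rewrite -card_row_cells; apply: fintype.eq_card => c; rewrite [RHS]inE.
have sm : size la <= m.+1 by have := part_size_le la; lia.
rewrite (big_ord_widen_cond m.+1 xpredT (fun i => i * nth 0 la i) sm) /= big_mkcond.
by apply: eq_bigr => i _; case: ltnP => //= si; rewrite nth_default ?muln0.
Qed.
End Columns.

End ColumnSorting.

(** * Intertwiners from Specht modules to words *)

Section SpechtHom.
Variable F : numFieldType.

(** Collects, across the transport along [E], what is needed of polytabloids: [v] is the coordinate
    vector of one of them, antisymmetric along the columns of [t] and generating the module, and [i]
    is the inclusion among the words of content [la]. *)
Lemma specht_generator (la : intpart) m (E : sumn la = m) :
  exists (t : 'I_m -> cell la) (v : 'rV[F]_(\rank (specht_mx F la)))
         (i : 'M[F]_(\rank (specht_mx F la), tpow_dim m (size la))),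
  [/\ bijective t,
      forall s : 'S_m, (forall k, ccol (t (s k)) = ccol (t k)) ->
        v *m specht_at F E s = (-1) ^+ odd_perm s *: v,
      forall n (X : 'M[F]_(\rank (specht_mx F la), n)),
        (forall s, v *m specht_at F E s *m X = 0) -> X = 0 &
      [/\ forall s, specht_at F E s *m i = i *m place_mx F _ s,
          row_free i,
          i *m cont_mx F m (size la) (nth 0%N la) = i &
          v != 0]].
Proof.
case: _ / E; rewrite /specht_at; set U := specht_mx F la; set rho := specht_repr F la.
pose t := [ffun k : 'I_(sumn la) => enum_val (cast_ord (esym (card_cell la)) k)].
have ti : injective t by move=> k k'; rewrite !ffunE => /enum_val_inj /cast_ord_inj.
have tb : bijective t by apply: inj_card_bij; rewrite // card_cell card_ord.
have eU (u : {ffun 'I_(sumn la) -> cell la}) : injective u -> (polytabloid F u <= U)%MS.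
  move=> /injectiveP ui; rewrite /U /specht_mx (sumsmx_sup u) ?genmxE //.
have mod := specht_module F la.
pose v := in_submod U (polytabloid F t).
have vE s : v *m rho s = in_submod U (polytabloid F t *m place_mx F _ s).
  by rewrite (in_submodJ mod) ?inE ?eU.
exists t, v, (val_submod 1%:M); split=> //.
- move=> s st; rewrite vE polytabloid_sign; last first.
    by rewrite inE; apply/forallP => k; rewrite st.
  by rewrite linearZ.
- move=> n X vX.
  have UX : U *m (in_submod U 1%:M *m X) = 0.
    apply/sub_kermxP/sumsmx_subP => u /injectiveP ui; rewrite genmxE; apply/sub_kermxP.
    (* Any other tableau is a translate of [t], so its polytabloid is a translate of the generator,
       on which [X] vanishes by hypothesis. *)
    have [g gK Kg] := tb; have si : injective (g \o u) by move=> k k' /= /(can_inj Kg)/ui.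
    have -> : u = tab_act (perm si)^-1%g t.
      by apply/ffunP => k; rewrite ffunE invgK permE /= Kg.
    by rewrite -polytabloidJ mulmxA -in_submodE -vE vX.
  rewrite -[X]mul1mx -[1%:M](val_submodK) in_submodE -mulmxA.
  by have /submxP[W ->] := val_submodP (1%:M : 'M_(\rank U)); rewrite -mulmxA UX mulmx0.
split.
- by move=> s; rewrite -(val_submodJ mod) ?inE // mul1mx [RHS]val_submodE.
- by rewrite /row_free val_submod1.
- have /submxP[W ->] := val_submodP (1%:M : 'M_(\rank U)); rewrite -mulmxA; congr (_ *m _).
  apply/eqP; rewrite -subr_eq0 -{2}[U]mulmx1 -mulmxBr; apply/eqP/sub_kermxP.
  apply/sumsmx_subP => u /injectiveP ui; rewrite genmxE; apply/sub_kermxP.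
  by rewrite mulmxBr mulmx1 polytabloid_cont // subrr.
apply: contraTneq (polytabloid_neq0 F ti) => v0; rewrite negbK.
by rewrite -(in_submodK (eU _ ti)) -/v v0 linear0.
Qed.

Section Words.
Variables (la : intpart) (m : nat) (E : sumn la = m) (d : nat) (mu : nat -> nat).
Local Notation k := (\rank (specht_mx F la)).
Local Notation hom := (@hom_mx F _ [set: 'S_m]%G _ _ (specht_at F E) (place_repr F m d) (cont_mx F m d mu)).

(** As [v] generates, [X] is determined by the vector [v *m X], which inherits the antisymmetry of
    [v]. If a word repeats a letter within a column, the corresponding transposition fixes it, so
    its coefficient equals its own opposite and vanishes. *)
Lemma specht_word : exists (t : 'I_m -> cell la) (v : 'rV[F]_k),
  bijective t /\ forall X : 'M_(k, tpow_dim m d), hom X ->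
  (X <> 0 -> exists f, (v *m X) 0 (tpow_rank f) != 0) /\
  (forall f, (v *m X) 0 (tpow_rank f) != 0 ->
    [/\ (forall e : 'I_d, wcount f e = mu e),
        (forall i j, ccol (t i) = ccol (t j) -> f i = f j -> i = j) &
        forall s : 'S_m, (forall i, ccol (t (s i)) = ccol (t i)) ->
         (v *m X) 0 (tpow_rank (wact f s)) != 0]).
Proof.
have [t [v [_ [tb vs vspan _]]]] := specht_generator E.
exists t, v; split=> // X [XP XD].
have anti (s : 'S_m) f : (forall i, ccol (t (s i)) = ccol (t i)) ->
    (v *m X) 0 (tpow_rank (wact f s)) = (-1) ^+ odd_perm s * (v *m X) 0 (tpow_rank f).
  move=> st; rewrite -row_place -mulmxA -XP ?inE // mulmxA vs //.
  by rewrite -scalemxAl mxE.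
split=> [X0|f fn0].
  have [f fn|h] := pickP (fun f => (v *m X) 0 (tpow_rank f) != 0); first by exists f.
  case: X0; apply: vspan => s; rewrite -mulmxA XP ?inE // mulmxA.
  suff -> : v *m X = 0 by rewrite mul0mx.
  apply/rowP => b; rewrite [RHS]mxE -(tpow_valK b); apply/eqP.
  by rewrite -[_ == _]negbK h.
split.
- move=> e; move: fn0; rewrite -{1}XD mulmxA mulmx_cont tpow_rankK.
  by case: forallP => [h _|_]; [apply/eqP|rewrite eqxx].
- move=> i j ct fij; apply/eqP; apply: contraNT fn0 => ij.
  have fix_f : wact f (tperm i j) = f.
    by apply/ffunP => l; rewrite ffunE; case: tpermP => // ->.
  have h := anti (tperm i j) f; rewrite fix_f odd_tperm ij expr1 mulN1r in h.
  by rewrite -eqNr -h // => l; case: tpermP => // ->; rewrite ct.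
- by move=> s st; rewrite anti // mulf_neq0 // signr_eq0.
Qed.

End Words.
End SpechtHom.

Section SpechtOrtho.
Variable F : numFieldType.

Section Words.
Variables (la : intpart) (m : nat) (E : sumn la = m) (d : nat) (mu : nat -> nat).
Local Notation k := (\rank (specht_mx F la)).
Local Notation hom := (@hom_mx F _ [set: 'S_m]%G _ _ (specht_at F E) (place_repr F m d) (cont_mx F m d mu)).

Lemma sum_word (f : {ffun 'I_m -> 'I_d}) : (forall e : 'I_d, wcount f e = mu e) ->
  (\sum_i f i = \sum_(e < d) e * mu e)%N.
Proof.
move=> h; rewrite (partition_big f xpredT) //=; apply: eq_bigr => e _.
by rewrite (eq_bigr (fun=> nat_of_ord e)) => [|i /eqP-> //]; rewrite sum_nat_const -h mulnC.
Qed.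

Lemma sum_crow_tab (t : 'I_m -> cell la) : bijective t ->
  (\sum_i nat_of_ord (crow (t i)) = wpart m la)%N.
Proof. by move=> [g gK Kg]; rewrite -sum_crow // [RHS](reindex t) //; exists g => ? _. Qed.

(** A nonzero [X] yields a word of content [mu] with distinct letters in columns, to which
    [column_sort] applies. In the equality case this word rearranges the row indices, whose content
    is [la]. *)
Lemma specht_hom_weight X : hom X -> X <> 0 ->
  (wpart m la <= \sum_(e < d) e * mu e)%N /\
  ((\sum_(e < d) e * mu e)%N = wpart m la -> forall e : 'I_d, mu e = nth 0%N la e).
Proof.
have [t [v [tb H]]] := specht_word F E d mu.
move=> hX X0; have [/(_ X0)[f fn] /(_ f fn)[fc fi _]] := H X hX.
have [] := @column_sort _ _ t (fun i => nat_of_ord (f i)) tb.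
  by move=> i j c /val_inj; apply: fi.
rewrite (sum_word fc) (sum_crow_tab tb) => le eq; split=> // /eq[s sP] e.
have tsb : bijective (t \o s) by apply: bij_comp => //; exists (s^-1)%g; [exact: permK|exact: permKV].
rewrite -fc -(card_row _ tsb); apply: fintype.eq_card => i; rewrite !inE /=.
by have [_ ->] := sP i.
Qed.

(** At minimal weight all words in play are column rearrangements of one another, so by antisymmetry
    a single coefficient determines [v *m X]. The scalar c makes that coefficient of [X - c *: X0]
    vanish. *)
Lemma specht_hom_unique X0 X : (\sum_(e < d) e * mu e)%N = wpart m la ->
  hom X0 -> X0 <> 0 -> hom X -> exists c, X = c *: X0.
Proof.
have [t [v [tb H]]] := specht_word F E d mu.
move=> wE hX0 X0n hX.
have sort f : (forall e : 'I_d, wcount f e = mu e) ->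
   (forall i j, ccol (t i) = ccol (t j) -> f i = f j -> i = j) ->
   exists s : 'S_m, forall k, ccol (t (s k)) = ccol (t k) /\ crow (t (s k)) = f k :> nat.
  move=> fc fi; have [i j|_] := @column_sort _ _ t (fun i => nat_of_ord (f i)) tb.
    by move=> c /val_inj; apply: fi.
  by apply; rewrite (sum_word fc) (sum_crow_tab tb).
have [/(_ X0n)[f fn] /(_ f fn)[fc fi _]] := H _ hX0.
have [s sP] := sort f fc fi.
pose c := (v *m X) 0 (tpow_rank f) / (v *m X0) 0 (tpow_rank f).
exists c; apply/eqP; rewrite -subr_eq0; apply/negP => /negP Z0.
have hZ : hom (X - c *: X0).
  case: hX hX0 => XP XD [X0P X0D]; split=> [g Gg|].
    by rewrite mulmxBr mulmxBl -scalemxAr -scalemxAl XP ?X0P.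
  by rewrite mulmxBl -scalemxAl XD X0D.
have [/(_ (elimN eqP Z0))[f' fn'] h] := H _ hZ.
have [fc' fi' fs] := h f' fn'; have [s' sP'] := sort f' fc' fi'.
have /fs : forall i, ccol (t ((s * s'^-1)%g i)) = ccol (t i).
  move=> i; rewrite permM; have [<- _] := sP i.
  by have [<- _] := sP' ((s'^-1)%g (s i)); rewrite permKV.
have -> : wact f' (s * s'^-1)%g = f.
  apply/ffunP => i; apply/val_inj; rewrite ffunE permM /=.
  by have [_ <-] := sP' ((s'^-1)%g (s i)); have [_ <-] := sP i; rewrite permKV.
by rewrite mulmxBr -scalemxAr mxE [X in _ + X]mxE [X in _ - X]mxE /c divfK // subrr eqxx.
Qed.
End Words.

Definition specht_trace (la : intpart) m (E : sumn la = m) (s : 'S_m) : F := \tr (specht_at F E s).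

(** Bilinear rather than Hermitian, so that it makes sense without conjugation; positivity enters
    only through [char_ip_definite]. *)
Definition char_ip m (phi psi : 'S_m -> F) : F :=
  m`!%:R^-1 * \sum_(s : 'S_m) phi (s^-1)%g * psi s.

Lemma char_ipC m (phi psi : 'S_m -> F) : char_ip phi psi = char_ip psi phi.
Proof.
rewrite /char_ip; congr (_ * _); rewrite (reindex_inj invg_inj) /=.
by apply: eq_bigr => s _; rewrite invgK mulrC.
Qed.

Lemma hom_ip_char_ip m n1 n2 (rho1 : mx_representation F [set: 'S_m] n1)
    (rho2 : mx_representation F [set: 'S_m] n2) D :
  hom_ip rho1 rho2 D = char_ip (fun s => \tr (rho1 s)) (fun s => \tr (D *m rho2 s)).
Proof.
rewrite /hom_ip /char_ip cardsT card_Sn; congr (_ * _).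
by apply: eq_bigl => s; rewrite inE.
Qed.

Lemma sum_part_weight d (la : intpart) m : sumn la = m -> (size la <= d)%N ->
  (\sum_(e < d) e * nth 0 la e = wpart m la)%N.
Proof.
move=> lm ld; rewrite /wpart.
have sm : (size la <= m.+1)%N by have := part_size_le la; lia.
have H n : (size la <= n)%N -> (\sum_(e < n) e * nth 0 la e = \sum_(e < size la) e * nth 0 la e)%N.
  move=> sn; rewrite [RHS](big_ord_widen_cond n xpredT (fun e => e * nth 0 la e)%N sn) [RHS]big_mkcond.
  by apply: eq_bigr => e _; case: ltnP => //= se; rewrite nth_default ?muln0.
by rewrite !H.
Qed.

(** By symmetry [la] has the larger weight. An intertwiner to the module of [la'], followed by its
    inclusion among words, falls under [specht_hom_weight], which leaves only [la = la']. There
    [specht_hom_unique] makes the identity span all intertwiners. *)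
Lemma specht_trace_ortho (la la' : intpart) m (E : sumn la = m) (E' : sumn la' = m) :
  char_ip (specht_trace E) (specht_trace E') = (la == la')%:R.
Proof.
wlog le : la la' E E' / (wpart m la' <= wpart m la)%N.
  move=> H; have [le|/ltnW le] := leqP (wpart m la') (wpart m la); first exact: H.
  by rewrite char_ipC eq_sym; apply: H.
have -> : char_ip (specht_trace E) (specht_trace E') = hom_ip (specht_at F E) (specht_at F E') 1%:M.
  by rewrite hom_ip_char_ip /char_ip; congr (_ * _); apply: eq_bigr => s _; rewrite mul1mx.
have [_ [v [i [_ _ _ [iP ifree iD v0]]]]] := specht_generator F E'.
have comp X : hom_mx (G := [set: 'S_m]) (specht_at F E) (specht_at F E') 1%:M X ->
   hom_mx (G := [set: 'S_m]) (specht_at F E) (place_repr F m (size la')) (cont_mx F m _ (nth 0%N la')) (X *m i).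
  case=> XP _; split=> [g Gg|]; last by rewrite -mulmxA iD.
  by rewrite mulmxA XP // -!mulmxA; congr (_ *m _); apply: iP.
have i_inj n (X : 'M_(n, _)) : X *m i = 0 -> X = 0.
  by move=> Xi; apply: (row_free_inj ifree); rewrite Xi mul0mx.
have [lala|nla] := eqVneq la la'; last first.
  apply: hom_ip_eq0 => [g _||X hX]; rewrite ?mul1mx ?mulmx1 //.
  apply/eqP; apply/negP => /negP/eqP X0.
  have Xi0 : X *m i <> 0 by move/i_inj.
  have [le' eq] := specht_hom_weight (comp X hX) Xi0.
  rewrite (sum_part_weight E' (leqnn _)) in le' eq.
  have {}eq := eq (anti_leq (introT andP (conj le le'))).
  case/eqP: nla; apply: part_eq => r.
  have [rs|sr] := ltnP r (size la'); first by rewrite (eq (Ordinal rs)).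
  (* Rows 0 to [size la' - 1] of [la] already contain all m boxes, so later rows of [la] are
     empty. *)
  rewrite [RHS]nth_default //; apply/eqP; rewrite -leqn0.
  have s1 : (\sum_(0 <= e < size la') nth 0 la e = m)%N.
    by rewrite big_mkord -E' (sumn_sum_nth (leqnn _)); apply: eq_bigr => e _; rewrite -eq.
  have := sumn_sum_nth (leq_addr r.+1 (size la)); rewrite E.
  rewrite -(big_mkord xpredT (nth 0%N la)) (@big_cat_nat _ _ _ (size la')) //=; last by lia.
  rewrite s1 (@big_cat_nat _ _ _ r) //=; last by lia.
  by rewrite (@big_ltn _ _ _ r) //=; lia.
subst la'; rewrite (eq_irrelevance E' E) in comp iP *.
apply: (@hom_ip_eq1 _ _ _ _ _ _ _ _ _ _ 1%:M) => [g _||||X hX]; rewrite ?mul1mx ?mulmx1 //.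
- by split=> [g _|]; rewrite ?mul1mx ?mulmx1.
- by apply: contraNneq v0 => e; rewrite -(mulmx1 v) e mulmx0.
have h1 : hom_mx (G := [set: 'S_m]) (specht_at F E) (place_repr F m (size la)) (cont_mx F m _ (nth 0%N la)) i.
  by split=> [g Gg|]; rewrite ?iD //; apply: iP.
have i0 : i <> 0.
  by move=> i0; case/eqP: v0; apply: i_inj; rewrite i0 mulmx0.
have [|c Xc] := specht_hom_unique _ h1 i0 (comp X hX); first by rewrite (sum_part_weight E).
exists c; apply/eqP; rewrite -subr_eq0; apply/eqP/i_inj.
by rewrite mulmxBl Xc -scalemxAl mul1mx subrr.
Qed.

Lemma fixed_words_widen m d d' mu (s : 'S_m) : (d <= d')%N ->
  (forall e, (d <= e)%N -> mu e = 0%N) -> fixed_words d mu s = fixed_words d' mu s.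
Proof.
move=> dd mu0; pose f (w : {ffun 'I_m -> 'I_d}) : {ffun 'I_m -> 'I_d'} := [ffun k => widen_ord dd (w k)].
have f_inj : injective f.
  by move=> w w' /ffunP h; apply/ffunP => k; apply/val_inj; have := congr1 val (h k); rewrite !ffunE.
have fc w (e : 'I_d) : wcount (f w) (widen_ord dd e) = wcount w e.
  by apply: fintype.eq_card => k; rewrite !inE ffunE -!val_eqE.
have fs w : (wact (f w) s == f w) = (wact w s == w).
  rewrite -(inj_eq f_inj); congr (_ == _); by apply/ffunP => k; rewrite !ffunE.
rewrite /fixed_words -(fintype.card_image f_inj); apply: fintype.eq_card => w'; rewrite [RHS]inE.
apply/fintype.imageP/andP => [[w]|[/forallP cw /eqP sw]].
  rewrite inE => /andP[/forallP cw sw] ->; rewrite fs sw; split=> //; apply/forallP => e.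
  have [ed|de] := ltnP e d.
    by have := cw (Ordinal ed); rewrite -fc; congr (wcount _ _ == _); apply/val_inj.
  rewrite mu0 //; apply/eqP/fintype.eq_card0 => k; rewrite inE ffunE -val_eqE /=.
  by apply/negbTE; rewrite neq_ltn (leq_trans (ltn_ord _) de).
have wd k : (w' k < d)%N.
  rewrite ltnNge; apply/negP => /mu0; apply/eqP; rewrite -(eqP (cw (w' k))) -lt0n.
  by apply/card_gt0P; exists k; rewrite inE.
have e' : w' = f [ffun k => Ordinal (wd k)] by apply/ffunP => k; apply/val_inj; rewrite /= !ffunE.
exists [ffun k => Ordinal (wd k)] => //; rewrite inE -fs -e' sw eqxx andbT.
by apply/forallP => e; rewrite -fc -e' cw.
Qed.

(** The inclusion of the Specht module spans the line of intertwiners. Letters from [size la] on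
    never occur, which allows any larger alphabet. *)
Lemma specht_trace_word d (la : intpart) m (E : sumn la = m) : (m <= d)%N ->
  char_ip (specht_trace E) (fun s => (fixed_words d (nth 0%N la) s)%:R) = 1.
Proof.
move=> md; have sd : (size la <= d)%N by have := part_size_le la; lia.
have [_ [v [i [_ _ _ [iP ifree iD v0]]]]] := specht_generator F E.
have -> : char_ip (specht_trace E) (fun s => (fixed_words d (nth 0%N la) s)%:R) =
    hom_ip (specht_at F E) (place_repr F m (size la)) (cont_mx F m _ (nth 0%N la)).
  rewrite hom_ip_char_ip /char_ip; congr (_ * _); apply: eq_bigr => s _.
  by rewrite mxtrace_cont_place (fixed_words_widen _ sd) // => e se; rewrite nth_default.
have i0 : i <> 0.
  by move=> i0; case/eqP: v0; apply: (row_free_inj ifree); rewrite i0 mulmx0 mul0mx.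
have h1 : hom_mx (G := [set: 'S_m]) (specht_at F E) (place_repr F m (size la)) (cont_mx F m _ (nth 0%N la)) i.
  by split=> [g Gg|]; rewrite ?iD //; apply: iP.
apply: (@hom_ip_eq1 _ _ _ _ _ _ _ _ _ _ i) => [g _|||| X hX] //.
- exact: cont_mx_place.
- exact: cont_mx_idem.
- exact/eqP.
by apply: (specht_hom_unique _ h1 i0 hX); rewrite (sum_part_weight E).
Qed.
End SpechtOrtho.

(** * Young's rule *)

Lemma prim_root_ex (F : numClosedFieldType) N : (0 < N)%N -> exists z : F, N.-primitive_root z.
Proof.
move=> N0; have [r rE] := closed_field_poly_normal ('X^N - 1 : {poly F}).
have mo : ('X^N - 1 : {poly F}) \is monic by rewrite -['X^N - 1]/('X^N - 1%:P) monicXnsubC.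
rewrite (monicP mo) scale1r in rE.
have ru : uniq r by rewrite -separable_prod_XsubC -rE separable_Xn_sub_1 // pnatr_eq0 -lt0n.
have rsz : size r = N.
  by apply/eqP; rewrite -eqSS -(size_prod_XsubC _ id) -rE size_XnsubC.
have rN : all N.-unity_root r by apply/allP => z; rewrite -root_prod_XsubC -rE.
have /hasP[z _ zN] : has N.-primitive_root r by apply: has_prim_root; rewrite ?rsz.
by exists z.
Qed.

Section FiniteOrder.
Variable F : numClosedFieldType.

(** X^N - 1 annihilates A and splits with simple roots. The condition on [d] is kept because the
    eigenvalues must later be located both on the unit circle and in a cyclotomic field. *)
Lemma finite_order_diag n (A : 'M[F]_n.+1) N : (0 < N)%N -> A ^+ N = 1 ->
  exists (P : 'M[F]_n.+1) (d : 'rV[F]_n.+1),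
    [/\ P \in unitmx, A = invmx P *m diag_mx d *m P & forall i, d 0 i ^+ N = 1].
Proof.
move=> N0 AN; have [z zN] := prim_root_ex F N0.
have [P Pu /diagonalizable_forPex[d /(simmxLR Pu) AP]] : diagonalizable A.
  apply/diagonalizableP; exists [seq z ^+ i | i <- index_iota 0 N].
    rewrite map_inj_in_uniq ?iota_uniq // => i j; rewrite !mem_index_iota => /andP[_ iN] /andP[_ jN].
    by move/eqP; rewrite (eq_prim_root_expr zN) !modn_small // => /eqP.
  rewrite big_map factor_Xn_sub_1 //; apply: mxminpoly_min.
  by rewrite rmorphB rmorph1 /= rmorphXn /= horner_mx_X AN subrr.
rewrite mxpoly.conjVmx // in AP; exists P, d; split=> // i.
have AX k : A ^+ k = invmx P *m diag_mx (\row_j d 0 j ^+ k) *m P.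
  elim: k => [|k IH].
    rewrite (_ : \row_j _ = const_mx 1); last by apply/rowP => j; rewrite !mxE expr0.
    by rewrite diag_const_mx mulmx1 mulVmx.
  rewrite exprS IH {1}AP -!mulmxE !mulmxA mulmxK // -!mulmxA; congr (_ *m _).
  rewrite mulmxA; congr (_ *m _); apply/matrixP => a b; rewrite mul_diag_mx !mxE exprS mulrnAr.
  by [].
have : diag_mx (\row_j d 0 j ^+ N) = 1%:M.
  have := AX N; rewrite AN => /(congr1 (fun M => P *m M *m invmx P)).
  by rewrite !mulmxA mulmxV // mul1mx mulmxK // mulmx1 mulmxV.
by move=> /matrixP/(_ i i); rewrite !mxE eqxx mulr1n.
Qed.

Variables (gT : finGroupType) (G : {group gT}) (n : nat) (rho : mx_representation F G n).

Lemma repr_diag x : x \in G -> exists (P : 'M[F]_n) (d : 'rV[F]_n),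
    [/\ P \in unitmx, rho x = invmx P *m diag_mx d *m P & forall i, d 0 i ^+ #[x]%g = 1].
Proof.
move=> Gx; case: n rho => [|n'] r.
  exists 1%:M, 0; split; [exact: unitmx1| |by case].
  by apply/matrixP => -[].
apply: finite_order_diag; first exact: order_gt0.
by rewrite -repr_mxX // expg_order repr_mx1.
Qed.

(** The eigenvalues are roots of unity, so inverting them is conjugating them. *)
Lemma mxtrace_reprV x : x \in G -> \tr (rho x^-1%g) = (\tr (rho x))^*.
Proof.
move=> Gx; have [P [d [Pu rE d1]]] := repr_diag Gx.
have dn i : d 0 i * (d 0 i)^* = 1.
  rewrite -normCK (_ : `|d 0 i| = 1) ?expr1n //; apply/eqP.
  by rewrite -(@pexpr_eq1 _ _ #[x]%g) ?order_gt0 // -normrX d1 normr1.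
have tE e : \tr (invmx P *m diag_mx e *m P) = \sum_i e 0 i.
  by rewrite mxtrace_mulC mulmxA mulmxV // mul1mx mxtrace_diag.
have -> : rho x^-1%g = invmx P *m diag_mx (map_mx Num.conj d) *m P.
  rewrite repr_mxV // rE; set Q := _ *m _; set Q' := _ *m _.
  have QQ : Q' *m Q = 1%:M.
    rewrite /Q /Q' !mulmxA mulmxK // -[X in X *m _ = _]mulmxA mulmx_diag.
    rewrite (_ : \row_j _ = const_mx 1) ?diag_const_mx ?mulmx1 ?mulVmx //.
    by apply/rowP => j; rewrite !mxE mulrC dn.
  have Qu : Q \in unitmx by case/mulmx1_unit: QQ.
  by rewrite -[RHS](mulmxK Qu) QQ mul1mx.
rewrite rE !tE rmorph_sum; apply: eq_bigr => i _; by rewrite mxE.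
Qed.
End FiniteOrder.

Section YoungRule.
Variables (F : numClosedFieldType) (m d : nat).
Hypothesis md : (m <= d)%N.
Implicit Types (mu nu : nat -> nat) (la : intpart) (phi psi : 'S_m -> F).

Lemma char_ip_sumr (I : Type) (r : seq I) phi (c : I -> F) (psi : I -> 'S_m -> F) :
  char_ip phi (fun s => \sum_(i <- r) c i * psi i s) = \sum_(i <- r) c i * char_ip phi (psi i).
Proof.
rewrite /char_ip (eq_bigr (fun s => \sum_(i <- r) c i * (phi (s^-1)%g * psi i s))) => [|s _]; last first.
  by rewrite mulr_sumr; apply: eq_bigr => i _; rewrite mulrCA.
rewrite exchange_big mulr_sumr; apply: eq_bigr => i _.
by rewrite -mulr_sumr mulrCA.
Qed.

Lemma char_ipBr phi psi psi' : char_ip phi (fun s => psi s - psi' s) = char_ip phi psi - char_ip phi psi'.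
Proof.
rewrite /char_ip -mulrBr -sumrB; congr (_ * _); apply: eq_bigr => s _.
by rewrite mulrBr.
Qed.

Lemma eq_char_ip phi phi' psi psi' : phi =1 phi' -> psi =1 psi' -> char_ip phi psi = char_ip phi' psi'.
Proof. by move=> e e'; congr (_ * _); apply: eq_bigr => s _; rewrite e e'. Qed.

Lemma char_ip_definite phi : (forall s, phi (s^-1)%g = (phi s)^*) -> char_ip phi phi = 0 ->
  forall s, phi s = 0.
Proof.
move=> phiV /eqP; rewrite mulf_eq0 invr_eq0 pnatr_eq0 (gtn_eqF (fact_gt0 m)) /=.
rewrite (eq_bigr (fun s => `|phi s| ^+ 2)) => [|s _]; last by rewrite phiV normCKC.
rewrite psumr_eq0 => [/allP h s|s _]; last exact: exprn_ge0.
by have := h s (mem_index_enum _); rewrite expf_eq0 normr_eq0 => /eqP.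
Qed.

(** Extended by 0 to partitions of other sizes, so that sums over [parts m] need not carry proofs of
    the size. *)
Definition specht_char la (s : 'S_m) : F :=
  if sumn la =P m is ReflectT E then specht_trace F E s else 0.

Definition word_char mu (s : 'S_m) : F := (fixed_words d mu s)%:R.
Definition kostka_val mu la : F := (kostka_num m d mu la)%:R.

Lemma specht_charE la (E : sumn la = m) : specht_char la =1 specht_trace F E.
Proof. by move=> s; rewrite /specht_char; case: eqP => // E'; rewrite (eq_irrelevance E' E). Qed.

Lemma specht_char_ortho la la' : la \in parts m -> la' \in parts m ->
  char_ip (specht_char la) (specht_char la') = (la == la')%:R.
Proof.
rewrite !mem_parts => /eqP E /eqP E'.
by rewrite (eq_char_ip (specht_charE E) (specht_charE E')) specht_trace_ortho.
Qed.

Lemma specht_charV la s : specht_char la (s^-1)%g = (specht_char la s)^*.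
Proof. by rewrite /specht_char; case: eqP => [E|_]; rewrite ?conjC0 // /specht_trace mxtrace_reprV ?inE. Qed.

Lemma word_charV mu s : word_char mu (s^-1)%g = (word_char mu s)^*.
Proof. by rewrite /word_char fixed_wordsV rmorph_nat. Qed.

Lemma word_char_gram mu nu : (\sum_(e < d) mu e)%N = m -> (\sum_(e < d) nu e)%N = m ->
  char_ip (word_char mu) (word_char nu) = \sum_(la <- parts m) kostka_val mu la * kostka_val nu la.
Proof.
move=> mum num; rewrite /char_ip (eq_bigr (fun s => word_char mu s * word_char nu s)) => [|s _]; last first.
  by rewrite /word_char fixed_wordsV.
by rewrite (fixed_words_gram F mum num) mulKf // pnatr_eq0 -lt0n fact_gt0.
Qed.

(** With g the right-hand side, <h,h>, <h,g> and <g,g> all equal the sum of the squared Kostka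
    numbers, so h - g has norm zero. Only multiplicities with a nonzero Kostka number are required,
    which is what makes the induction below possible. *)
Lemma young_of_multiplicity mu : (\sum_(e < d) mu e)%N = m ->
  (forall la, la \in parts m -> kostka_val mu la != 0 -> char_ip (specht_char la) (word_char mu) = kostka_val mu la) ->
  forall s, word_char mu s = \sum_(la <- parts m) kostka_val mu la * specht_char la s.
Proof.
move=> mum mult s; apply/eqP; rewrite -subr_eq0; apply/eqP; move: s.
pose g s := \sum_(la <- parts m) kostka_val mu la * specht_char la s.
apply: (@char_ip_definite (fun s => word_char mu s - g s)) => [s|].
  rewrite rmorphB /= -word_charV rmorph_sum; congr (_ - _); apply: eq_bigr => la _.
  by rewrite rmorphM specht_charV /= rmorph_nat.
have hgE : char_ip (word_char mu) g = \sum_(la <- parts m) kostka_val mu la * kostka_val mu la.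
  rewrite char_ip_sumr big_seq [RHS]big_seq; apply: eq_bigr => la lam.
  have [->|k0] := eqVneq (kostka_val mu la) 0; first by rewrite !mul0r.
  by rewrite char_ipC mult.
have ggE : char_ip g g = \sum_(la <- parts m) kostka_val mu la * kostka_val mu la.
  rewrite char_ip_sumr big_seq [RHS]big_seq; apply: eq_bigr => la lam; congr (_ * _).
  rewrite char_ipC char_ip_sumr (bigD1_seq la) ?parts_uniq //= specht_char_ortho // eqxx mulr1.
  rewrite big_seq_cond big1 ?addr0 // => la' /andP[la'm /negbTE ne].
  by rewrite specht_char_ortho // eq_sym ne mulr0.
by rewrite char_ipBr ![char_ip (fun s => word_char mu s - g s) _]char_ipC !char_ipBr (char_ipC g) hgE ggE word_char_gram // !subrr.
Qed.

(** Induction on the weight of [la]. By triangularity the partitions occurring in h_la are [la],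
    with known multiplicity 1, and lighter ones, so Young's rule already holds for h_la. Expanding
    <h_la, h_mu> by this rule and by the Gram formula, the terms of lighter partitions cancel and
    leave the multiplicity of [la] in h_mu. *)
Lemma multiplicity_part n la mu : (wpart m la < n)%N -> la \in parts m -> (\sum_(e < d) mu e)%N = m ->
  char_ip (specht_char la) (word_char mu) = kostka_val mu la.
Proof.
elim: n la mu => // n IH la mu lan lam mum.
have lm : sumn la = m by apply/eqP; rewrite -mem_parts.
set nu := nth 0%N la.
have num : (\sum_(e < d) nu e)%N = m.
  by rewrite -[RHS]lm (sumn_sum_nth (n := d)) //; have := part_size_le la; lia.
have kd : kostka_val nu la = 1 by rewrite /kostka_val kostka_num_diag.
have tri la' : la' \in parts m -> kostka_val nu la' != 0 -> la' = la \/ (wpart m la' < n)%N.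
  move=> la'm; rewrite pnatr_eq0 => /kostka_num_triangular h.
  have lm' : sumn la' = m by apply/eqP; rewrite -mem_parts.
  by case: (h md lm' lm) => [lt|->]; [right; apply: leq_trans lt _|left].
have multd : char_ip (specht_char la) (word_char nu) = 1.
  by rewrite (eq_char_ip (specht_charE lm) (frefl _)) specht_trace_word.
have yr := @young_of_multiplicity nu num _.
have {}yr s : word_char nu s = \sum_(la' <- parts m) kostka_val nu la' * specht_char la' s.
  apply: yr => la' la'm k0; case: (tri la' la'm k0) => [->|lt]; first by rewrite multd kd.
  exact: IH.
have := word_char_gram num mum; rewrite char_ipC (eq_char_ip (frefl _) yr) char_ip_sumr.
rewrite (bigD1_seq la) ?parts_uniq //= [X in _ = X](bigD1_seq la) ?parts_uniq //= kd !mul1r.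
rewrite [X in _ + X = _](_ : _ = \sum_(la' <- parts m | la' != la) kostka_val nu la' * kostka_val mu la').
  by move/addIr => <-; rewrite char_ipC.
rewrite big_seq_cond [RHS]big_seq_cond; apply: eq_bigr => la' /andP[la'm ne].
have [->|k0] := eqVneq (kostka_val nu la') 0; first by rewrite !mul0r.
case: (tri la' la'm k0) => [e|lt]; first by rewrite e eqxx in ne.
by rewrite char_ipC IH.
Qed.

Lemma multiplicity la mu : la \in parts m -> (\sum_(e < d) mu e)%N = m ->
  char_ip (specht_char la) (word_char mu) = kostka_val mu la.
Proof. exact: multiplicity_part (ltnSn _). Qed.

Lemma young_rule mu s : (\sum_(e < d) mu e)%N = m ->
  word_char mu s = \sum_(la <- parts m) kostka_val mu la * specht_char la s.
Proof. by move=> mum; apply: young_of_multiplicity => // la lam _; apply: multiplicity. Qed.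

End YoungRule.

(** * Traces on Schur functors *)

Lemma mxtrace_tens (R : comNzRingType) m n (A : 'M[R]_m) (B : 'M[R]_n) :
  \tr (A *t B) = \tr A * \tr B.
Proof.
rewrite /mxtrace mulr_suml; under [RHS]eq_bigr do rewrite mulr_sumr.
rewrite pair_big /= (reindex (@mxtens_index m n)) /=.
  by apply: eq_bigr => -[i j] _; rewrite tensmxE.
by exists (@mxtens_unindex m n) => k _; rewrite ?mxtens_indexK ?mxtens_unindexK.
Qed.

(** The first two conditions make [e] a projector with kernel [U]. As it commutes with the action,
    its image is a copy of the quotient. *)
Lemma mxtrace_factmod (F : fieldType) (gT : finGroupType) (G : {group gT}) n
    (rG : mx_representation F G n) (U : 'M_n) (modU : mxmodule rG U) (e : 'M_n) x :
  U *m e = 0 -> (1%:M - e <= U)%MS -> rG x *m e = e *m rG x ->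
  \tr (factmod_repr modU x) = \tr (rG x *m e).
Proof.
move=> Ue eU ex; pose p := in_factmod U 1%:M; pose j := val_factmod (1%:M : 'M_(\rank (cokermx U))).
have pE k (W : 'M_(k, n)) : W *m p = in_factmod U W by rewrite -in_factmodE.
have jp : j *m p = 1%:M by rewrite pE val_factmodK.
have pje : p *m j *m e = e.
  apply/eqP; rewrite eq_sym -subr_eq0 -{1}[e]mul1mx -mulmxBl; apply/eqP.
  have /submxP[W ->] : (1%:M - p *m j <= U)%MS.
    by rewrite -in_factmod_eq0 -pE mulmxBl mul1mx -mulmxA jp mulmx1 subrr.
  by rewrite -mulmxA Ue mulmx0.
have ep : e *m p = p.
  apply/eqP; rewrite eq_sym -subr_eq0 -{1}[p]mul1mx -mulmxBl pE.
  by rewrite in_factmod_eq0.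
have -> : factmod_repr modU x = j *m rG x *m p by rewrite pE.
transitivity (\tr ((rG x *m p) *m (j *m e))); last by rewrite -(mulmxA (rG x)) (mulmxA p j) pje.
by rewrite [RHS]mxtrace_mulC -(mulmxA j e) (mulmxA e) -ex -(mulmxA (rG x)) ep [in RHS]mulmxA.
Qed.

Section SchurTrace.
Variables (F : numClosedFieldType) (la : intpart).
Variables (gT : finGroupType) (G : {group gT}) (d : nat).
Variable rW : mx_representation F G d.
Local Notation m := (sumn la).
Local Notation k := (\rank (specht_mx F la)).

Lemma mxtrace_schur_specht x : x \in G ->
  \tr (schur_repr la rW x) =
  m`!%:R^-1 * \sum_(s : 'S_m) \tr (tpow_mx m (rW x) *m place_mx F d s) * \tr (specht_repr F la s).
Proof.
move=> Gx; set rho := specht_repr F la.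
(* The average of the diagonal action of S_m: coinvariants are identified with invariants, which is
   possible as m! is invertible. *)
pose e : 'M_(tpow_dim m d * k) := m`!%:R^-1 *: \sum_(s : 'S_m) place_mx F d s *t rho s.
have f0 : m`!%:R != 0 :> F by rewrite pnatr_eq0 -lt0n fact_gt0.
have placeM (s t : 'S_m) : place_mx F d (s * t)%g = place_mx F d s *m place_mx F d t.
  by have [_ h] := place_mx_repr F m d; apply: h; rewrite inE.
have rhoM (s t : 'S_m) : rho (s * t)%g = rho s *m rho t by rewrite repr_mxM ?inE.
have rho1 : rho 1%g = 1%:M by rewrite repr_mx1.
rewrite (mxtrace_factmod _ (e := e)).
- rewrite /= /tens_specht_mx -scalemxAr mxtraceZ mulmx_sumr raddf_sum /=; congr (_ * _).
  by apply: eq_bigr => s _; rewrite tensmx_mul mul1mx mxtrace_tens.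
- apply/sub_kermxP/sumsmx_subP => s _; rewrite genmxE; apply/sub_kermxP.
  rewrite /e -scalemxAr mulmx_sumr; under eq_bigr do rewrite mulmxBl !tensmx_mul !mul1mx.
  rewrite sumrB [X in _ - X](reindex_inj (mulgI s)) /= -sumrB big1 ?scaler0 // => t _.
  by rewrite -placeM -rhoM mulKg subrr.
- have -> : 1%:M - e = m`!%:R^-1 *: \sum_(s : 'S_m) (1%:M - place_mx F d s *t rho s).
    rewrite sumrB scalerBr sumr_const card_Sn -scaler_nat scalerA mulVf // scale1r //.
  apply/scalemx_sub/summx_sub => s _.
  apply: (submx_trans _ (sumsmx_sup s _ (submx_refl _))) => //; rewrite genmxE.
  (* This factor turns the generator [place s (x) 1 - 1 (x) rho s^-1] of the balanced span into
     [1 - place s (x) rho s]. *)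
  apply/submxP; exists (- (1%:M *t rho s)).
  rewrite mulmxBr !mulNmx !tensmx_mul !mul1mx !mulmx1 -rhoM mulgV rho1 tensmx11.
  by rewrite opprK addrC.
- rewrite /= /tens_specht_mx /e -scalemxAr -scalemxAl mulmx_sumr mulmx_suml; congr (_ *: _).
  by apply: eq_bigr => s _; rewrite !tensmx_mul mul1mx mulmx1 tpow_place.
Qed.
End SchurTrace.

(** Pads the eigenvalues by zeros, as [complete_poly] takes its variables from a sequence indexed by
    nat. *)
Definition row_fun (F : nmodType) n (y : 'rV[F]_n) (i : nat) : F :=
  if insub i is Some j then y 0 j else 0.

Lemma row_funE (F : nmodType) n (y : 'rV[F]_n) (i : 'I_n) : row_fun y i = y 0 i.
Proof. by rewrite /row_fun valK. Qed.

Lemma complete_poly0 (R : comNzRingType) d (y : nat -> R) : complete_poly d y 0 = 1.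
Proof. by elim: d => //= d IH; rewrite big_ord1 subn0 IH expr0 mulr1. Qed.

Section MonomialBound.
Implicit Types (mu : {cmonom nat}).

(** One bound for two needs: no variable of index at or beyond it occurs in [mu], and it is at least
    the degree, as Young's rule requires of the number of letters. *)
Definition cm_bound mu := (mdeg mu + \sum_(i <- finsupp mu) i.+1)%N.

Lemma cm_bound_deg mu : (mdeg mu <= cm_bound mu)%N.
Proof. exact: leq_addr. Qed.

Lemma cm_boundP mu i : (cm_bound mu <= i)%N -> mu i = 0%N.
Proof.
move=> bi; apply/eqP; rewrite cmE_eq0; apply/negP => ii; move: bi.
rewrite leqNgt => /negP; apply; rewrite /cm_bound (big_fsetD1 i) //=; lia.
Qed.

Lemma big_cm_bound (T : Type) (idx : T) (op : Monoid.com_law idx) mu n (f : nat -> T) :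
  (forall i, (n <= i)%N -> mu i = 0%N) -> (forall i, mu i = 0%N -> f i = idx) ->
  \big[op/idx]_(i < n) f i = \big[op/idx]_(i <- finsupp mu) f i.
Proof.
move=> mun f0; rewrite -(big_mkord xpredT f) [LHS](bigID (fun i => mu i != 0%N)) /=.
rewrite [X in op _ X]big1 ?Monoid.mulm1 => [|i]; last by rewrite negbK => /eqP/f0.
rewrite -big_filter; apply: perm_big; apply: uniq_perm; rewrite ?filter_uniq ?iota_uniq ?fset_uniq //.
move=> i; rewrite mem_filter mem_index_iota cmE_neq0 andbC /=.
case: (ltnP i n) => //= ni; apply/esym/negbTE; rewrite -cmE_eq0; exact/eqP/mun.
Qed.

Lemma sum_cm_bound mu n : (forall i, (n <= i)%N -> mu i = 0%N) -> (\sum_(e < n) mu e)%N = mdeg mu.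
Proof. by move=> mun; rewrite (big_cm_bound _ mun) // mdegE. Qed.
End MonomialBound.

Lemma kostka_deg (la : intpart) (mu : {cmonom nat}) : sumn la != mdeg mu -> kostka la mu = 0%N.
Proof.
move=> ne; rewrite (@kostkaE (sumn la) (cm_bound mu)) //; last exact: cm_boundP.
apply/eqP; apply: contraNT ne => /strip_chains_sz; rewrite sz_part // => ->.
by rewrite sum_cm_bound //; apply: cm_boundP.
Qed.

Lemma kostka_valE (F : numClosedFieldType) (la : intpart) n (mu : {cmonom nat}) : sumn la = mdeg mu ->
  (forall i, (n <= i)%N -> mu i = 0%N) -> kostka_val F (mdeg mu) n mu la = (kostka la mu)%:R.
Proof. by move=> lm mun; rewrite (@kostkaE (mdeg mu) n) ?lm. Qed.

Section Alphabet.
Variables (F : numClosedFieldType) (gT : finGroupType) (G : {group gT}) (n : nat).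
Variable rW : mx_representation F G n.

Lemma mxtrace_tpow_place m (P : 'M[F]_n) (y : 'rV[F]_n) (s : 'S_m) : P \in unitmx ->
  \tr (tpow_mx m (invmx P *m diag_mx y *m P) *m place_mx F n s) =
  power_char (fun i : 'I_n => row_fun y i) s.
Proof.
move=> Pu; rewrite -mulmxA tpow_mxM -mulmxA mxtrace_mulC tpow_mxM -!mulmxA.
rewrite -tpow_place (mulmxA (tpow_mx m P)) -tpow_mxM mulmxV // tpow_mx1 mul1mx.
rewrite /mxtrace /power_char [RHS]big_mkcond [RHS](reindex (@tpow_val m n)) /=; last first.
  by exists (@tpow_rank m n) => x _; rewrite ?tpow_valK ?tpow_rankK.
apply: eq_bigr => a _; rewrite mxE (bigD1 a) //= big1 ?addr0 => [|b ba].
  rewrite place_mxE eq_sym !mxE; case: eqP => _; rewrite ?mulr1 ?mulr0 //.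
  by apply: eq_bigr => k _; rewrite mxE eqxx row_funE.
have [k kab] : exists k, tpow_val a k != tpow_val b k.
  apply/existsP; apply: contraNT ba => /existsPn h; apply/eqP/(can_inj (@tpow_valK m n))/ffunP => k.
  by apply/eqP; move: (h k); rewrite negbK eq_sym.
by rewrite mxE (bigD1 k) //= mxE (negbTE kab) !mul0r.
Qed.

Lemma mxtrace_schur m (la : intpart) x (P : 'M[F]_n) (y : 'rV[F]_n) : sumn la = m -> x \in G ->
  P \in unitmx -> rW x = invmx P *m diag_mx y *m P ->
  \tr (schur_repr la rW x) = m`!%:R^-1 *
    \sum_(s : 'S_m) power_char (fun i : 'I_n => row_fun y i) s * specht_char F la s.
Proof.
move=> <- Gx Pu rE; rewrite mxtrace_schur_specht // rE; congr (_ * _).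
by apply: eq_bigr => s _; rewrite mxtrace_tpow_place // (specht_charE F (erefl (sumn la))).
Qed.

Lemma schur_trace_sum x (P : 'M[F]_n) (y : 'rV[F]_n) (mu : {cmonom nat}) : x \in G ->
  P \in unitmx -> rW x = invmx P *m diag_mx y *m P ->
  \sum_(la <- parts (mdeg mu)) (kostka la mu)%:R * \tr (schur_repr la rW x) =
  \prod_(i <- finsupp mu) complete_poly n (row_fun y) (mu i).
Proof.
move=> Gx Pu rE; set m := mdeg mu; set E := cm_bound mu.
have muE := @cm_boundP mu; rewrite -/E in muE.
have f0 : m`!%:R != 0 :> F by rewrite pnatr_eq0 -lt0n fact_gt0.
rewrite -(big_cm_bound (n := E) _ muE) => [|i ->]; last exact: complete_poly0.
apply: (mulfI f0); rewrite [RHS]mulr_natl -(sum_fixed_words_power_char _ _ (sum_cm_bound muE)).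
rewrite big_seq mulr_sumr.
under eq_bigr => la lam.
  rewrite mem_parts in lam; rewrite (mxtrace_schur (eqP lam) Gx Pu rE) mulrCA mulVKf //.
  over.
rewrite -big_seq; under eq_bigr do rewrite mulr_sumr.
rewrite exchange_big; apply: eq_bigr => s _ /=.
rewrite -/(word_char F E mu s) (young_rule F (cm_bound_deg mu)) ?sum_cm_bound // mulr_suml.
rewrite big_seq [RHS]big_seq; apply: eq_bigr => la; rewrite mem_parts => /eqP lam.
by rewrite kostka_valE // mulrCA mulrC.
Qed.
End Alphabet.

Definition word_map m E (p : nat -> nat) (w : {ffun 'I_m -> 'I_E}) : {ffun 'I_m -> 'I_E} :=
  [ffun k => insubd (w k) (p (w k))].

Lemma word_mapP m E (p q : nat -> nat) (mu nu : nat -> nat) (w : {ffun 'I_m -> 'I_E}) :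
  cancel p q -> cancel q p -> (forall i, mu i = nu (p i)) ->
  (forall i, (E <= i)%N -> mu i = 0%N) -> (forall i, (E <= i)%N -> nu i = 0%N) ->
  (forall e : 'I_E, wcount w e = mu e) ->
  (forall k, word_map p w k = p (w k) :> nat) /\ (forall e : 'I_E, wcount (word_map p w) e = nu e).
Proof.
move=> pK qK munu mu0 nu0 wc.
have fE k : word_map p w k = p (w k) :> nat.
  rewrite ffunE val_insubd ifT // ltnNge; apply/negP => /nu0; rewrite -munu -wc => /eqP.
  by apply/negP; rewrite -lt0n; apply/card_gt0P; exists k; rewrite inE.
split=> // e; rewrite -(qK e) -munu.
have [qe|eq] := ltnP (q e) E; last first.
  rewrite mu0 //; apply: fintype.eq_card0 => k; rewrite inE -val_eqE /= fE.
  by apply/eqP => h; move: eq; rewrite -h pK leqNgt ltn_ord.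
rewrite -(wc (Ordinal qe)); apply: fintype.eq_card => k; rewrite !inE -!val_eqE /= fE.
by apply/eqP/eqP => [<-|->]; rewrite ?pK ?qK.
Qed.

(** Relabelling letters by [p] commutes with permuting positions, so h_mu and h_nu are the same
    character, and [multiplicity] reads both Kostka numbers off it. E bounds both supports, so [p]
    keeps the letters that occur below E. *)
Lemma kostka_sym (la : intpart) (mu nu : {cmonom nat}) (p : nat -> nat) : bijective p ->
  (forall i, mu i = nu (p i)) -> kostka la mu = kostka la nu.
Proof.
move=> [q pK qK] munu.
have numu i : nu i = mu (q i) by rewrite munu qK.
have dE : mdeg mu = mdeg nu.
  rewrite !mdegE (eq_bigr (fun i => nu (p i))) => [|i _]; last exact: munu.
  rewrite -(big_map p xpredT nu); apply: perm_big; apply: uniq_perm; rewrite ?fset_uniq //.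
    by rewrite map_inj_uniq ?fset_uniq //; apply: can_inj pK.
  move=> i; have <- := qK i; rewrite (mem_map (can_inj pK)).
  by rewrite -!cmE_neq0 munu.
have [lm|lm] := eqVneq (sumn la) (mdeg mu); last by rewrite !kostka_deg -?dE.
set m := mdeg mu in lm dE; pose E := maxn (cm_bound mu) (cm_bound nu).
have mu0 i : (E <= i)%N -> mu i = 0%N by rewrite geq_max => /andP[/cm_boundP].
have nu0 i : (E <= i)%N -> nu i = 0%N by rewrite geq_max => /andP[_ /cm_boundP].
have mE : (m <= E)%N by rewrite leq_max cm_bound_deg.
have hcE (s : 'S_m) : fixed_words E mu s = fixed_words E nu s :> nat.
  apply: (card_in_cancel (f := word_map p) (g := word_map q)).
  - move=> w; rewrite !inE => /andP[/forallP cw /eqP sw].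
    have [fE fc] := word_mapP pK qK munu mu0 nu0 (fun e => eqP (cw e)).
    apply/andP; split; first by apply/forallP => e; rewrite fc.
    by apply/eqP/ffunP => k; apply/val_inj; rewrite [wact _ _ _]ffunE /= !fE; have /ffunP/(_ k) := sw; rewrite ffunE => ->.
  - move=> w; rewrite !inE => /andP[/forallP cw /eqP sw].
    have [fE fc] := word_mapP qK pK numu nu0 mu0 (fun e => eqP (cw e)).
    apply/andP; split; first by apply/forallP => e; rewrite fc.
    by apply/eqP/ffunP => k; apply/val_inj; rewrite [wact _ _ _]ffunE /= !fE; have /ffunP/(_ k) := sw; rewrite ffunE => ->.
  - move=> w; rewrite inE => /andP[/forallP cw _].
    have [fE fc] := word_mapP pK qK munu mu0 nu0 (fun e => eqP (cw e)).
    have [gE _] := word_mapP qK pK numu nu0 mu0 fc.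
    by apply/ffunP => k; apply/val_inj; rewrite /= gE fE pK.
  - move=> w; rewrite inE => /andP[/forallP cw _].
    have [fE fc] := word_mapP qK pK numu nu0 mu0 (fun e => eqP (cw e)).
    have [gE _] := word_mapP pK qK munu mu0 nu0 fc.
    by apply/ffunP => k; apply/val_inj; rewrite /= gE fE qK.
have lp : la \in parts m by rewrite mem_parts lm.
have := multiplicity algC mE lp (sum_cm_bound mu0).
have := multiplicity algC mE lp (etrans (sum_cm_bound nu0) (esym dE)).
rewrite (eq_char_ip (frefl _) (fun s => congr1 (fun k => k%:R) (hcE s))) => -> /eqP.
rewrite /kostka_val eqr_nat => /eqP; rewrite /kostka_num -!kostkaE ?lm //.
Qed.

(** * Products of formal power series *)

Section Keyed.
Variables (R : comNzRingType) (I J : choiceType) (key : I -> J).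
Local Notation S := (mseries R I).
Implicit Types (M : {cmonom I}).

Definition mrestrict (j : J) M : {cmonom I} :=
  mkcmonom [fsfun i in finsupp M => if key i == j then M i else 0%N | 0%N].

Lemma mrestrictE j M i : mrestrict j M i = if key i == j then M i else 0%N.
Proof.
rewrite cmE /= fsfun_fun; case: ifP => // /negbT; rewrite -cmE_eq0 => /eqP->.
by rewrite if_same.
Qed.

Definition keyed (j : J) (f : S) := forall M i, M i != 0%N -> key i != j -> f M = 0.

(** Factors with different keys share no variable, so M factors in only one way, into its
    restrictions. The lemma serves both with [key := id], for one Euler factor per variable, and
    with [key := fst], for one Schur function per alphabet. *)
Lemma mscoef_prod_keyed (f : J -> S) (r : seq J) M : uniq r -> (forall j, keyed j (f j)) ->
  (\prod_(j <- r) f j : S) M =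
  if all (fun i => key i \in r) (finsupp M) then \prod_(j <- r) f j (mrestrict j M) else 0.
Proof.
move=> + fk; elim: r M => [|j r IH] M /=.
  move=> _; rewrite !big_nil mscoef1; case: eqP => [->|M1].
    by rewrite (_ : all _ _) //; apply/allP => i; rewrite -cmE_neq0 onecmE.
  case: allP => // h; case: M1; apply/eqP/cmP => i; rewrite onecmE; apply/eqP.
  by rewrite cmE_eq0; apply/negP => /h.
move=> /andP[jr ur]; rewrite !big_cons mscoefM.
have jM : mrestrict j M \in mdivisors M.
  by apply/mdivisors_le => i; rewrite mrestrictE; case: ifP.
have restE i : divcm M (mrestrict j M) i = if key i == j then 0%N else M i.
  by rewrite divcmE mrestrictE; case: ifP; rewrite ?subnn ?subn0.
rewrite (big_fsetD1 (mrestrict j M)) //= [X in _ + X]big1_fset ?addr0 => [|a]; last first.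
  rewrite in_fsetD1 => /andP[ane /mdivisors_le aM] _.
  have [h|] := pselect (exists i, a i != 0%N /\ key i != j).
    by have [i [ai ki]] := h; rewrite (fk j _ i) ?mul0r.
  move=> nex; have ka i : key i != j -> a i = 0%N.
    by move=> ki; apply/eqP; apply: contrapT => ai; apply: nex; exists i; split=> //; apply/negP.
  have /existsNP[i ai] : ~ forall i, a i = mrestrict j M i.
    by move=> e; case/eqP: ane; apply/eqP/cmP.
  have ki : key i = j.
    by apply/eqP; apply: contrapT => /negP ki; apply: ai; rewrite mrestrictE (negbTE ki) ka.
  rewrite IH // ifF ?mulr0 //; apply/negbTE/allPn; exists i; last by rewrite ki.
  rewrite -cmE_neq0 divcmE subn_eq0 -ltnNge ltn_neqAle aM andbT.
  by apply/eqP => e; apply: ai; rewrite mrestrictE ki eqxx.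
rewrite IH //.
have -> : all (fun i => key i \in r) (finsupp (divcm M (mrestrict j M))) =
          all (fun i => key i \in j :: r) (finsupp M).
  apply/allP/allP => h i; rewrite -cmE_neq0.
    move=> Mi; rewrite inE; case: eqVneq => //= ki; apply: h.
    by rewrite -cmE_neq0 restE (negbTE ki).
  rewrite restE; case: (eqVneq (key i) j) => // ki Mi.
  have : i \in finsupp M by rewrite -cmE_neq0.
  by move/h; rewrite inE (negbTE ki).
case: ifP => _; last by rewrite mulr0.
congr (_ * _); rewrite big_seq [RHS]big_seq; apply: eq_bigr => k kr.
congr (f k _); apply/eqP/cmP => i; rewrite !mrestrictE restE.
case: eqVneq => // ki; case: eqVneq => // kj.
by rewrite -kj ki kr in jr.
Qed.
End Keyed.

Section UniqueLimit.
Variables (R : comNzRingType) (I J : choiceType).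

Lemma ms_lim_unique (u : {fset J} -> mseries R I) F G : ms_lim u F -> ms_lim u G -> F = G.
Proof.
move=> uF uG; apply: mseriesP => m; have [D hD] := uF m; have [D' hD'] := uG m.
by rewrite -(hD (D `|` D')) ?fsubsetUl // hD' // fsubsetUr.
Qed.

Lemma infprodE (f : J -> mseries R I) F : has_prod f F -> infprod f = F.
Proof. by move=> fF; apply: xget_unique => // G /ms_lim_unique; apply. Qed.
End UniqueLimit.

Section Const.
Variables (R : comNzRingType) (I : choiceType).

Lemma mscoef_constM (c : R) (f : mseries R I) m : (msconst I c * f : mseries R I) m = c * f m.
Proof.
rewrite mscoefM (big_fsetD1 (onecm I)) /=; last first.
  by apply/mdivisors_le => i; rewrite onecmE.
rewrite eqxx big1_fset ?addr0 => [|a].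
  by congr (_ * f _); apply/eqP/cmP => i; rewrite divcmE onecmE subn0.
by rewrite in_fsetD1 => /andP[/negbTE-> _] _; rewrite mul0r.
Qed.

Fact msconst_is_zmod_morphism : zmod_morphism (@msconst R I).
Proof. by move=> a b; apply: mseriesP => m /=; case: ifP => _; rewrite ?subr0. Qed.
Fact msconst_is_monoid_morphism : monoid_morphism (@msconst R I).
Proof.
split=> [|a b]; first by [].
by apply: mseriesP => m; rewrite mscoef_constM /=; case: ifP => _; rewrite ?mulr0.
Qed.
HB.instance Definition _ :=
  GRing.isZmodMorphism.Build R (mseries R I) (@msconst R I) msconst_is_zmod_morphism.
HB.instance Definition _ :=
  GRing.isMonoidMorphism.Build R (mseries R I) (@msconst R I) msconst_is_monoid_morphism.
End Const.

(** Coefficient form of (1 - y_d t) H_{d+1}(t) = H_d(t), where H_d is the generating series of the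
    h_k in d variables. *)
Lemma complete_poly_rec (R : comNzRingType) d (y : nat -> R) k :
  complete_poly d.+1 y k = complete_poly d y k + (if k is k'.+1 then y d * complete_poly d.+1 y k' else 0).
Proof.
rewrite [complete_poly d.+1 y k]/= big_ord_recl subn0 expr0 mulr1; congr (_ + _).
case: k => [|k]; first by rewrite big_ord0.
rewrite mulr_sumr; apply: eq_bigr => i _ /=.
by rewrite /bump /= add1n subSS exprS mulrCA.
Qed.

Section Hseries.
Variables (F : fieldType) (I : choiceType) (v : I).
Local Notation S := (mseries F I).

(** The generating series sum_k h_k(y) t^k at t = x_v, that is, prod_i (1 - y_i x_v)^-1. *)
Definition complete_series n (y : nat -> F) : S :=
  MSeries (fun M => if all (pred1 v) (finsupp M) then complete_poly n y (M v) else 0).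

Lemma complete_seriesE n y M :
  complete_series n y M = if all (pred1 v) (finsupp M) then complete_poly n y (M v) else 0.
Proof. by []. Qed.

Lemma complete_series_keyed n y : keyed id v (complete_series n y).
Proof.
move=> M i Mi ni /=; rewrite ifF //; apply/negbTE/allPn; exists i => //.
by rewrite -cmE_neq0.
Qed.

Lemma complete_series_restrict n y M : complete_series n y (mrestrict id v M) = complete_poly n y (M v).
Proof.
rewrite /= mrestrictE eqxx ifT //; apply/allP => i; rewrite -cmE_neq0 mrestrictE /=; move: (M i) => k.
by case: (i == v).
Qed.

Lemma complete_series_step n y : (1 - msvar F v * msconst I (y n)) * complete_series n.+1 y = complete_series n y.
Proof.
apply: mseriesP => M.
have -> : (1 - msvar F v * msconst I (y n)) * complete_series n.+1 y =
    complete_series n.+1 y - (msconst I (y n) * complete_series n.+1 y) * msvar F v ^+ 1 by rewrite expr1; ring.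
transitivity (complete_series n.+1 y M - (msconst I (y n) * complete_series n.+1 y * msvar F v ^+ 1 : S) M); first by [].
rewrite mscoef_mulvarX mscoef_constM.
have dE i : divcm M (cmX v 1) i = (M i - (v == i))%N by rewrite divcmE cmXE muln1.
case: ltnP => Mv.
  have -> : complete_series n.+1 y (divcm M (cmX v 1)) = if all (pred1 v) (finsupp M) then complete_poly n.+1 y (M v).-1 else 0.
    rewrite complete_seriesE dE eqxx subn1; congr (if _ then _ else _).
    apply/allP/allP => h i; rewrite -cmE_neq0 => Mi /=.
      apply: contraT => /= iv; have /h : i \in finsupp (divcm M (cmX v 1)).
        by rewrite -cmE_neq0 dE [v == i]eq_sym (negbTE iv) subn0.
      by rewrite /= (negbTE iv).
    by apply: (h i); rewrite -cmE_neq0; apply: contraNneq Mi; rewrite dE => ->.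
  rewrite !complete_seriesE; case: ifP => _; last by rewrite mulr0 subr0.
  by case: (M v) Mv => // k _; rewrite [complete_poly n.+1 y k.+1]complete_poly_rec addrK.
rewrite subr0 !complete_seriesE; case: ifP => // _.
by move: Mv; rewrite leqn0 => /eqP->; rewrite !complete_poly0.
Qed.

Lemma prod_complete_series n (y : nat -> F) : \prod_(i < n) (1 - msvar F v * msconst I (y i)) * complete_series n y = 1.
Proof.
elim: n => [|n IH]; last by rewrite big_ord_recr /= -mulrA complete_series_step.
rewrite big_ord0 mul1r; apply: mseriesP => M; rewrite mscoef1 /=.
case: (M =P onecm I) => [->|M1].
  rewrite onecmE ifT //; apply/allP => i; by rewrite -cmE_neq0 onecmE.
case: ifP => // /allP h; case: eqP => // Mv; case: M1; apply/eqP/cmP => i.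
rewrite onecmE; apply/eqP; rewrite cmE_eq0; apply/negP => iM.
by move: (iM); rewrite (eqP (h i iM)) -cmE_neq0 Mv.
Qed.

Local Notation C := (map_mx (@msconst F I)).

Lemma det_complete_series n (P : 'M[F]_n) (y : 'rV[F]_n) : P \in unitmx ->
  \det (1%:M - msvar F v *: map_mx (msconst I) (invmx P *m diag_mx y *m P)) *
  complete_series n (row_fun y) = 1.
Proof.
move=> Pu; rewrite -[RHS](prod_complete_series n (row_fun y)); congr (_ * _).
pose D : 'M[S]_n := 1%:M - msvar F v *: C (diag_mx y).
have PP : C (invmx P) *m C P = 1%:M by rewrite -map_mxM mulVmx // map_mx1.
have -> : 1%:M - msvar F v *: C (invmx P *m diag_mx y *m P) = C (invmx P) *m D *m C P.
  rewrite /D mulmxBr mulmxBl mulmx1 PP -scalemxAr -scalemxAl; congr (_ - _ *: _).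
  by rewrite !map_mxM.
rewrite !det_mulmx mulrAC -det_mulmx PP det1 mul1r.
have -> : D = diag_mx (\row_i (1 - msvar F v * msconst I (row_fun y i))).
  apply/matrixP => i j; rewrite !mxE row_funE; case: eqP => [->|_].
    by rewrite !mulr1n.
  by rewrite !mulr0n [msconst I 0](rmorph0 (@msconst F I)) mulr0 subr0.
by rewrite det_diag; apply: eq_bigr => i _; rewrite mxE.
Qed.
End Hseries.

Section Alphabets.
Variables (R : comNzRingType) (Q : choiceType).
Implicit Types (M : {cmonom (Q * nat)%type}) (q : Q).

(** Written exactly as the monomial in [in_alphabet], so that the two are convertible. *)
Definition alph q M : {cmonom nat} :=
  mkcmonom [fsfun i in [fset v.2 | v in finsupp M] => M (q, i) | 0%N].

Lemma alphE q M i : alph q M i = M (q, i).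
Proof.
rewrite cmE /= fsfun_fun; case: ifP => // /negbT; apply: contraNeq => Mqi.
by apply/imfsetP; exists (q, i) => //=; rewrite -cmE_neq0 eq_sym.
Qed.

Lemma in_alphabet_keyed q (f : mseries R nat) : keyed fst q (in_alphabet q f).
Proof.
move=> M i Mi ni /=; rewrite ifF //; apply/negbTE/allPn; exists i => //.
by rewrite -cmE_neq0.
Qed.

Lemma in_alphabet_restrict q (f : mseries R nat) M :
  in_alphabet q f (mrestrict fst q M) = f (alph q M).
Proof.
rewrite /= ifT; last first.
  by apply/allP => i; rewrite -cmE_neq0 mrestrictE; case: ifP.
congr (f _); apply/eqP/cmP => i.
by rewrite -/(alph q (mrestrict fst q M)) !alphE mrestrictE eqxx.
Qed.

Definition keys M : {fset Q} := [fset v.1 | v in finsupp M].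

Lemma mem_keys q M : reflect (exists i, M (q, i) != 0%N) (q \in keys M).
Proof.
rewrite /keys; apply: (iffP (imfsetP _ _ _ _)) => [[[q' i] /= vM ->]|[i Mi]]; first by exists i; rewrite cmE_neq0.
by exists (q, i); rewrite //= -cmE_neq0.
Qed.

Lemma all_keys M (r : seq Q) :
  all (fun v => v.1 \in r) (finsupp M) = all (mem r) (keys M).
Proof.
apply/allP/allP => h.
  by move=> q /mem_keys[i Mi]; apply: (h (q, i)); rewrite -cmE_neq0.
by move=> [q i]; rewrite -cmE_neq0 => Mi; apply: h; apply/mem_keys; exists i.
Qed.

Lemma mdeg_alph q M : (mdeg (alph q M) == 0%N) = (q \notin keys M).
Proof.
apply/idP/idP => [|h].
  apply: contraTN => /mem_keys[i Mi]; rewrite mdegE (big_fsetD1 i) /=; last first.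
    by rewrite -cmE_neq0 alphE.
  by rewrite alphE addn_eq0 (negbTE Mi).
rewrite mdegE big1_fset // => i _ _; rewrite alphE; apply/eqP.
by apply: contraNT h => Mi; apply/mem_keys; exists i.
Qed.

Lemma prod_alph (T : Type) (idx : T) (op : Monoid.com_law idx) M (G : Q -> nat -> T) :
  \big[op/idx]_(v <- finsupp M) G v.1 (M v) =
  \big[op/idx]_(q <- keys M) \big[op/idx]_(i <- finsupp (alph q M)) G q (alph q M i).
Proof.
rewrite (partition_big_imfset _ fst) /=; apply: eq_bigr => q _.
rewrite -big_filter.
transitivity (\big[op/idx]_(v <- [seq (q, i) | i <- finsupp (alph q M)]) G v.1 (M v)).
  apply: perm_big; apply: uniq_perm.
  - by rewrite filter_uniq ?fset_uniq.
  - by rewrite map_inj_uniq ?fset_uniq // => i j [].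
  move=> [q' i]; rewrite mem_filter /=; apply/andP/mapP => [[/eqP -> Mi]|[j jM [-> ->]]].
    by exists i => //; rewrite -cmE_neq0 alphE cmE_neq0.
  by rewrite eqxx -cmE_neq0 -alphE cmE_neq0.
by rewrite big_map; apply: eq_bigr => i _; rewrite alphE.
Qed.
End Alphabets.

Lemma big_cm_sym (T : Type) (idx : T) (op : Monoid.com_law idx) (mu nu : {cmonom nat})
    (p : nat -> nat) (f : nat -> T) : bijective p -> (forall i, mu i = nu (p i)) ->
  \big[op/idx]_(i <- finsupp mu) f (mu i) = \big[op/idx]_(i <- finsupp nu) f (nu i).
Proof.
move=> [q pK qK] munu; rewrite (eq_bigr (fun i => f (nu (p i)))) => [|i _]; last by rewrite munu.
rewrite -(big_map p xpredT (fun i => f (nu i))); apply: perm_big; apply: uniq_perm; rewrite ?fset_uniq //.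
  by rewrite map_inj_uniq ?fset_uniq //; apply: can_inj pK.
move=> i; have <- := qK i; rewrite (mem_map (can_inj pK)).
by rewrite -!cmE_neq0 munu.
Qed.

(** * From one alphabet to all of them *)

Section Expansion.
Variables (F : fieldType) (Q : choiceType).
Variables (t : Q -> intpart -> F) (n : Q -> nat) (y : Q -> nat -> F).
Hypothesis alphabet_sum : forall q (mu : {cmonom nat}),
  \sum_(la <- parts (mdeg mu)) (kostka la mu)%:R * t q la =
  \prod_(i <- finsupp mu) complete_poly (n q) (y q) (mu i).
Local Notation S := (mseries F (Q * nat)%type).
Local Notation tuple_of_parts := {fsfun Q -> intpart with empty_part}.
Implicit Types (la : tuple_of_parts) (M : {cmonom (Q * nat)%type}).

(** Closed form of the infinite product: a variable absent from M would only contribute h_0 = 1. *)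
Definition euler_series : S :=
  MSeries (fun M => \prod_(v <- finsupp M) complete_poly (n v.1) (y v.1) (M v)).

Definition tuple_term la : S :=
  msconst _ (\prod_(q <- finsupp la) t q (la q)) *
  \prod_(q <- finsupp la) in_alphabet q (schur (la q) F).

Lemma euler_has_prod :
  has_prod (fun v : Q * nat => complete_series v (n v.1) (y v.1)) euler_series.
Proof.
move=> M; exists (finsupp M) => D MD.
rewrite (mscoef_prod_keyed (key := id)) ?fset_uniq //; last by move=> v; apply: complete_series_keyed.
rewrite ifT; last by apply/allP => v vM; apply: (fsubsetP MD).
rewrite (eq_bigr (fun v : Q * nat => complete_poly (n v.1) (y v.1) (M v))) => [|v _]; last exact: complete_series_restrict.
apply/esym/big_fset_incl => // v _; rewrite -cmE_eq0 => /eqP->; exact: complete_poly0.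
Qed.

Lemma euler_seriesE M : euler_series M =
  \prod_(q <- keys M) \prod_(i <- finsupp (alph q M)) complete_poly (n q) (y q) (alph q M i).
Proof. exact: (prod_alph _ M (fun q k => complete_poly (n q) (y q) k)). Qed.

Lemma tuple_termE la M : tuple_term la M =
  if all (mem (finsupp la)) (keys M)
  then \prod_(q <- finsupp la) ((kostka (la q) (alph q M))%:R * t q (la q)) else 0.
Proof.
rewrite mscoef_constM (mscoef_prod_keyed (key := fst)) ?fset_uniq //; last first.
  by move=> q; apply: in_alphabet_keyed.
rewrite all_keys; case: ifP => _; last by rewrite mulr0.
rewrite [RHS]big_split [LHS]mulrC; apply: (congr2 *%R) => //.
by apply: eq_bigr => q _; apply: in_alphabet_restrict.
Qed.

(** If an alphabet of M carries the empty partition, both sides vanish: its part of M has positive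
    degree, so the Kostka number is 0. *)
Lemma tuple_term_supp la M : finsupp la `<=` keys M ->
  tuple_term la M = \prod_(q <- keys M) ((kostka (la q) (alph q M))%:R * t q (la q)).
Proof.
move=> sub; rewrite tuple_termE; case: allP => h.
  suff -> : finsupp la = keys M by [].
  by apply/eqP; rewrite eqEfsubset sub; apply/fsubsetP => q /h.
have [q qM nq] : exists2 q, q \in keys M & q \notin finsupp la.
  by apply/fsubsetPn; apply/negP => /fsubsetP.
rewrite (big_fsetD1 q) //= fsfun_dflt // kostka_deg ?mul0r //.
by rewrite eq_sym mdeg_alph negbK.
Qed.

Lemma tuple_term_neq0 la M : tuple_term la M != 0 ->
  finsupp la = keys M /\ forall q, q \in keys M -> sumn (la q) = mdeg (alph q M).
Proof.
rewrite tuple_termE; case: allP => [h|]; last by rewrite eqxx.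
move=> p0; have d q : q \in finsupp la -> sumn (la q) = mdeg (alph q M).
  move=> ql; apply/eqP; apply: contraNT p0 => ne.
  by rewrite (big_fsetD1 q) //= kostka_deg // !mul0r.
have e : finsupp la = keys M; last by split=> // q; rewrite -e; apply: d.
apply/eqP; rewrite eqEfsubset; apply/andP; split; apply/fsubsetP => q; last by move/h.
move=> ql; have := ql; rewrite mem_finsupp -[q \in _]negbK -mdeg_alph -(d q ql).
apply: contraNN => /eqP s0; apply/eqP/part_eq => i; rewrite nth_nil.
by have := nth_le_sumn (la q) i; rewrite s0 leqn0 => /eqP.
Qed.

(** Only the finitely many families matching the multidegree of M contribute to its coefficient.
    Their sum is the expansion of a product over the alphabets of M, each factor being given by
    [alphabet_sum]. *)
Lemma tuple_has_sum : has_sum tuple_term euler_series.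
Proof.
(* A common finite pool for all alphabets, so that distributivity applies to functions into one
   type; partitions of the wrong size for their alphabet contribute 0. *)
move=> M; pose L : {fset intpart} := [fset la in flatten [seq parts (mdeg (alph q M)) | q <- keys M]].
pose mk (phi : {ffun keys M -> L}) : tuple_of_parts :=
  [fsfun q : keys M => val (phi q) | empty_part].
have mkE phi (q : keys M) : mk phi (val q) = val (phi q).
  by rewrite /mk fsfun_ffun insubT /=; [exact: valP|move=> h; congr (val (phi _)); apply: val_inj].
have mk_supp phi : finsupp (mk phi) `<=` keys M by apply: finsupp_sub.
have mk_inj : injective mk.
  by move=> phi psi e; apply/ffunP => q; apply: val_inj; rewrite -!mkE e.
exists [fset mk phi | phi in {: {ffun keys M -> L}}] => D sub.
rewrite mscoef_sum -(big_fset_incl _ sub) => [|la _ nla]; last first.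
  apply/eqP; apply: contraNT nla => /tuple_term_neq0[e d].
  have laL (q : keys M) : la (val q) \in L.
    rewrite in_fset /=; apply/flatten_mapP; exists (val q); first exact: valP.
    by rewrite mem_parts d ?valP.
  apply/imfsetP; exists [ffun q => FSetSub (laL q)] => //; apply/fsfunP => q.
  have [qM|nq] := boolP (q \in keys M).
    by rewrite -[q]/(val (FSetSub qM)) mkE ffunE.
  by rewrite !fsfun_dflt ?e //; apply: contra nq; apply/fsubsetP/mk_supp.
rewrite big_imfset; last by move=> phi psi _ _; apply: mk_inj.
rewrite euler_seriesE big_seq_fsetE.
transitivity (\prod_(q : keys M) \sum_(la : L)
   (kostka (val la) (alph (val q) M))%:R * t (val q) (val la)).
  rewrite bigA_distr_bigA /=.
  transitivity (\sum_(phi <- enum {: {ffun keys M -> L}}) tuple_term (mk phi) M).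
    by apply: perm_big; apply: uniq_perm; rewrite ?enum_uniq ?enum_finmem_uniq.
  rewrite big_enum; apply: eq_bigr => phi _.
  rewrite tuple_term_supp // big_seq_fsetE; apply: eq_bigr => q _.
  by rewrite mkE.
apply: eq_bigr => q _; rewrite -alphabet_sum.
rewrite -(big_seq_fsetE _ _ xpredT (fun lam => (kostka lam (alph (val q) M))%:R * t (val q) lam)).
transitivity (\sum_(lam <- [fset lam in parts (mdeg (alph (val q) M))])
   (kostka lam (alph (val q) M))%:R * t (val q) lam).
  apply/esym/big_fset_incl => [|lam _].
    apply/fsubsetP => lam; rewrite !in_fset /= => laP.
    by apply/flatten_mapP; exists (val q); first exact: valP.
  by rewrite in_fset /= mem_parts => ne; rewrite kostka_deg ?mul0r.
apply: perm_big; apply: uniq_perm; rewrite ?fset_uniq ?parts_uniq // => lam.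
by rewrite in_fset.
Qed.
End Expansion.

(** * Cyclotomic values *)

(** [Qab] asks for an abstract abelian extension with an embedding, so Q(z) is built from the
    minimal polynomial of z. It is a splitting field of X^N - 1, hence Galois, and automorphisms
    raise the root to powers, hence commute. *)
Lemma cyclotomic_subfield (C : numClosedFieldType) N (z : C) : N.-primitive_root z ->
  exists (E : splittingFieldType rat) (iota : {rmorphism E -> C}),
    [/\ galois 1%AS {:E}, abelian 'Gal({:E} / 1%AS)%g & exists x, iota x = z].
Proof.
move=> zN; have N0 := prim_order_gt0 zN.
(* The minimal polynomial of z is obtained as a nonzero rational polynomial of least size vanishing
   at z; minimality gives irreducibility. *)
pose has_size k := `[< exists q : {poly rat}, [/\ q != 0, root (map_poly ratr q) z & size q = k] >].
have ex_size : exists k, has_size k.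
  exists N.+1; apply/asboolP; exists ('X^N - 1); split.
  - by rewrite -size_poly_eq0 size_XnsubC.
  - by rewrite rmorphB /= rmorph1 map_polyXn /root !hornerE (prim_expr_order zN) subrr.
  - exact: size_XnsubC.
case: (ex_minnP ex_size) => k /asboolP[p [p0 pz pk]] kmin.
have irr : irreducible_poly p.
  apply/(subfx_irreducibleP pz p0) => q qz q0; rewrite pk; apply: kmin.
  by apply/asboolP; exists q.
pose L : fieldExtType rat := SubFieldExtType pz irr.
pose iota : {rmorphism L -> C} := @subfx_inj _ _ ratr z p.
pose w : L := subfx_root _ z p.
have iw : iota w = z by apply: subfx_inj_root.
have wN : N.-primitive_root w by rewrite -(fmorph_primitive_root iota) iw.
have gen (x : L) : exists q : {poly rat}, x = (map_poly (in_alg L) q).[w].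
  by have [q ->] := subfxEroot pz p0 x; exists q.
pose rs := [seq w ^+ i | i <- index_iota 0 N].
have w_rs : w \in rs.
  apply/mapP; exists (1 %% N)%N; last by rewrite (prim_expr_mod wN).
  by rewrite mem_index_iota ltn_mod.
have split_w : splittingFieldFor 1 ('X^N - 1 : {poly L}) {:L}.
  exists rs; first by rewrite big_map (factor_Xn_sub_1 wN) eqpxx.
  apply/vspaceP => x; rewrite memvf; have [q ->] := gen x.
  apply: rpred_horner; last exact: seqv_sub_adjoin.
  apply/polyOverP => i; rewrite coef_map; apply: memvZ; apply: mem1v.
have over1 : ('X^N - 1 : {poly L}) \is a polyOver 1%VS.
  by rewrite rpredB ?rpred1 ?rpredX ?polyOverX.
have ax : SplittingField.axiom L by exists ('X^N - 1).
pose E : splittingFieldType rat := HB.pack L (FieldExt_isSplittingField.Build _ L ax).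
exists E, iota; split; last by exists w.
  apply/splitting_galoisField; exists ('X^N - 1); split=> //.
  by apply: separable_Xn_sub_1; rewrite -(fmorph_eq0 iota) rmorph_nat pnatr_eq0 -lt0n.
have gw (g : gal_of {:E}) : exists i, g (w : E) = (w : E) ^+ i.
  have [|i gi] := prim_rootP wN (x := g (w : E)); last by exists i.
  by rewrite -rmorphXn /= (prim_expr_order wN) rmorph1.
have ghorner (g : gal_of {:E}) (q : {poly rat}) (u : E) :
    g (map_poly (in_alg E) q).[u] = (map_poly (in_alg E) q).[g u].
  rewrite -horner_map /= -map_poly_comp; congr _.[_]; apply: eq_map_poly => a /=.
  by rewrite linearZ rmorph1.
apply/centsP => g _ h _; apply/eqP/gal_eqP => a _.
have [q ->] := gen a; rewrite !galM ?memvf // !ghorner; congr _.[_].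
have [i gi] := gw g; have [j hj] := gw h.
by rewrite gi hj !rmorphXn /= gi hj -!exprM mulnC.
Qed.

Section Values.
Variables (C : fieldType) (A : C -> Prop).
Hypotheses (A1 : A 1) (AB : forall a b, A a -> A b -> A (a - b))
           (AM : forall a b, A a -> A b -> A (a * b)).

Lemma closed0 : A 0.
Proof. by rewrite -(subrr 1); apply: AB. Qed.

Lemma closedD a b : A a -> A b -> A (a + b).
Proof.
move=> Aa Ab; rewrite -[b]opprK -[- b]sub0r; apply: AB => //.
by apply: AB => //; apply: closed0.
Qed.

Lemma closed_sum (I : Type) (r : seq I) (f : I -> C) : (forall i, A (f i)) -> A (\sum_(i <- r) f i).
Proof. by move=> Af; elim/big_ind: _ => //; [apply: closed0|apply: closedD]. Qed.

Lemma closed_prod (I : Type) (r : seq I) (f : I -> C) : (forall i, A (f i)) -> A (\prod_(i <- r) f i).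
Proof. by move=> Af; elim/big_ind: _. Qed.

Lemma closed_nat k : A k%:R.
Proof.
elim: k => [|k IH]; first exact: closed0.
by rewrite -addn1 natrD; apply: closedD.
Qed.

Lemma closedX a k : A a -> A (a ^+ k).
Proof. by move=> Aa; elim: k => [|k IH]; rewrite ?expr0 // exprS; apply: AM. Qed.

Lemma closed_complete_poly d (y : nat -> C) k : (forall i, A (y i)) -> A (complete_poly d y k).
Proof.
move=> Ay; elim: d k => [|d IH] k /=; first exact: closed_nat.
by apply: closed_sum => i; apply: AM; [apply: IH|apply: closedX].
Qed.
End Values.

Lemma mxtrace_tens_mx (Q : choiceType) (gT : Q -> finGroupType) (G : forall q, {group gT q})
    (F : fieldType) (d : Q -> nat) (V : forall q, mx_representation F (G q) (d q))
    (x : prod_group G) (s : seq Q) :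
  \tr (tens_mx V x s) = \prod_(q <- s) \tr (V q (sgval (x q))).
Proof.
elim: s => [|q s IH] /=; first by rewrite big_nil mxtrace1.
by rewrite big_cons mxtrace_tens IH.
Qed.

Section Symmetry.
Variables (F : fieldType) (Q : choiceType).
Variables (t : Q -> intpart -> F) (n : Q -> nat) (y : Q -> nat -> F).
Variables (M M' : {cmonom (Q * nat)%type}).
Hypothesis MM : forall q, exists2 p : nat -> nat, bijective p & forall i, M (q, i) = M' (q, p i).

Lemma alph_sym q : exists2 p : nat -> nat, bijective p & forall i, alph q M i = alph q M' (p i).
Proof. by have [p pb h] := MM q; exists p => // i; rewrite !alphE. Qed.

Lemma keys_sym : keys M = keys M'.
Proof.
apply/fsetP => q; have [p [p' pK p'K] h] := MM q.
apply/mem_keys/mem_keys => -[i Mi]; first by exists (p i); rewrite -h.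
by exists (p' i); rewrite h p'K.
Qed.

Lemma euler_series_sym : euler_series n y M = euler_series n y M'.
Proof.
rewrite !euler_seriesE keys_sym; apply: eq_bigr => q _.
by have [p pb h] := alph_sym q; apply: (big_cm_sym _ _ pb h).
Qed.

Lemma tuple_term_sym la : tuple_term t la M = tuple_term t la M'.
Proof.
rewrite !tuple_termE keys_sym; case: ifP => // _; apply: eq_bigr => q _.
by have [p pb h] := alph_sym q; rewrite (kostka_sym _ pb h).
Qed.
End Symmetry.

Theorem proposition3p17 (R : realType)
    (K : fieldExtType rat) (L : splittingFieldType K)
    (galLK : galois 1%AS {:L})
    (n : nat) (rho : mx_representation (complex R) 'Gal({:L} / 1%AS)%g n)
    (P : primeIdeal K -> primeIdeal L)
    (P_over : forall q : primeIdeal K, lies_over (P q) q)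
    (sigma : GLK P)
    (sigma_frob : forall q : primeIdeal K, frobenius q (P q) (sgval (sigma q))) :
  [/\ has_prod (artin_factor rho sigma) (artin_series rho sigma),
      AK (artin_series rho sigma),
      (forall la : multipart K, AK (schur_term rho sigma la)) &
      has_sum (schur_term rho sigma) (artin_series rho sigma)].
Proof.
pose x q := sgval (sigma q).
have xG q := subgP (sigma q).
pose V q := Vrepr P rho q.
pose nV q := \rank (rfix_mx rho (Defs.inertia_group (P q))).
(* Each [x q] lies in a subquotient of the Galois group, so its order divides N and one root of
   unity serves all primes. *)
pose N := #|'Gal({:L} / 1%AS)%g|.
have N0 : (0 < N)%N by apply: cardG_gt0.
have xN q : (#[x q]%g %| N)%N.
  apply: dvdn_trans (order_dvdG (xG q)) _; apply: dvdn_trans (dvdn_quotient _ _) _.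
  by apply: cardSg; apply: subsetIl.
have D_ex q : exists d : 'M_(nV q) * 'rV_(nV q),
    [/\ d.1 \in unitmx, V q (x q) = invmx d.1 *m diag_mx d.2 *m d.1 & forall i, d.2 0 i ^+ #[x q]%g = 1].
  by have [A [d h]] := repr_diag (V q) (xG q); exists (A, d).
pose D q := projT1 (cid (D_ex q)); have DP q := projT2 (cid (D_ex q)).
rewrite -/(D _) in DP.
pose y q := row_fun (D q).2.
pose t q la := \tr (schur_repr la (V q) (x q)).
have alphabet_sum q (mu : {cmonom nat}) :
    \sum_(la <- parts (mdeg mu)) (kostka la mu)%:R * t q la =
    \prod_(i <- finsupp mu) complete_poly (nV q) (y q) (mu i).
  by have [Du Vx _] := DP q; apply: schur_trace_sum (xG q) Du Vx.
have factorE : artin_factor rho sigma = fun v => complete_series v (nV v.1) (y v.1).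
  apply/funext => v; have [Du Vx _] := DP v.1.
  have := det_complete_series v (D v.1).2 Du; rewrite -Vx -/(y v.1) => dh.
  exact: mulr1_eq dh.
have prodE := euler_has_prod nV y; rewrite -factorE in prodE.
have seriesE : artin_series rho sigma = euler_series nV y by apply: infprodE.
have termE : schur_term rho sigma = tuple_term t.
  apply/funext => la; rewrite /schur_term /schurW /tuple_term; congr (msconst _ _ * _).
  exact: mxtrace_tens_mx.
have [z zN] := prim_root_ex (complex R) N0.
have [E [iota [galE abE [w wz]]]] := cyclotomic_subfield zN.
(* All values lie in the image of the single field Q(z), whose closure under ring operations is
   immediate; for [Qab] itself this would involve composita. *)
pose A (a : complex R) := exists e, iota e = a.
have A1 : A 1 by exists 1; rewrite rmorph1.
have AB a b : A a -> A b -> A (a - b).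
  by move=> [e <-] [f <-]; exists (e - f); rewrite rmorphB.
have AM a b : A a -> A b -> A (a * b).
  by move=> [e <-] [f <-]; exists (e * f); rewrite rmorphM.
have AQ a : A a -> Qab a by move=> Aa; exists E, iota.
have A_root k (a : complex R) : (k %| N)%N -> a ^+ k = 1 -> A a.
  move=> kN ak; have [|i ->] := prim_rootP zN (x := a).
    by rewrite -(divnK kN) mulnC exprM ak expr1n.
  by apply: closedX => //; exists w.
have Ay q i : A (y q i).
  rewrite /y /row_fun; case: insubP => [j _ _|_]; last exact: closed0.
  by have [_ _ h] := DP q; apply: A_root (xN q) (h j).
have At q la : A (t q la).
  (* The Schur functor is again a representation of the same finite group, so its own eigenvalues at
     [x q] are roots of unity of order dividing N. *)
  have [B [d [Bu e h]]] := repr_diag (schur_repr la (V q)) (xG q).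
  rewrite /t e mxtrace_mulC mulmxA mulmxV // mul1mx mxtrace_diag.
  by apply: closed_sum => // i; apply: A_root (xN q) (h i).
rewrite seriesE termE; split; first exact: prodE.
- split=> [M|M M' MM]; last exact: euler_series_sym.
  by apply: AQ; apply: closed_prod => // v; apply: closed_complete_poly.
- move=> la; split=> [M|M M' MM]; last exact: tuple_term_sym.
  apply: AQ; rewrite tuple_termE; case: ifP => _; last exact: closed0.
  by apply: closed_prod => // q; apply: AM => //; apply: closed_nat.
exact: tuple_has_sum.
Qed.
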